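(* Let $\Omega\subset\mathbb{R}^N$ be a regular bounded open set whose boundary $\partial\Omega$ is divided into two disjoint parts $\Gamma_D$ and $\Gamma_N$, with $\Gamma_D$ of nonzero surface measure. Let $0<\gamma<|\Omega|$, $0<\mu_1\le\mu_2$, $0<\kappa_1\le\kappa_2$, $0<\rho_1<\rho_2$. Let $V_D=\{v\in H^1(\Omega)^N\mid v=0\text{ on }\Gamma_D\}$ (in the trace sense), $e(u)=(\nabla u+\nabla u^\top)/2$, $\rho(\theta)=\rho_1+(\rho_2-\rho_1)\theta$, $A^+(\theta)=A_1+(A_2-A_1)\theta$ with $$A_i=2\mu_iI_4+\Big(\kappa_i-\frac{2\mu_i}{N}\Big)I_2\otimes I_2\quad(i=1,2),$$ and $$\mathrm{ad}^*_\gamma=\Big\{\theta\in L^\infty(\Omega)\ \Big|\ 0\le\theta\le1\ \text{a.e.},\ \int_\Omega\theta\,dx=\gamma\Big\}.$$ Consider the problem $$(P^+)\qquad \max_{\theta\in\mathrm{ad}^*_\gamma}\ \inf_{u\in V_D\setminus\{0\}}\frac{\int_\Omega A^+(\theta)e(u):e(u)\,dx}{\int_\Omega\rho(\theta)|u|^2\,dx}$$ and the problem $$(P^* )\qquad \max_{\theta\in\mathrm{ad}^*_\gamma}\ \inf_{u\in V_D\setminus\{0\}}\frac{\int_\Omega A^*(\theta)e(u):e(u)\,dx}{\int_\Omega\rho(\theta)|u|^2\,dx},$$ where $A^*(\theta)e(u):e(u)$ denotes the Hashin--Shtrikman upper bound, i.e. the pointwise maximum of $A^*e(u):e(u)$ over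 the G-closure $G_\theta$. Then $(P^+)$ is a pseudo-concave maximization problem (its objective is a pseudo-concave function of $\theta$ in the closed convex set $\mathrm{ad}^*_\gamma\subset L^\infty(\Omega)$), and thus every (Clarke) stationary point of $(P^+)$ is a global maximizer. Moreover, the optimal value of $(P^+)$ is no less than the optimal value of $(P^* )$.
   Context: ''Regular'' means the boundary is regular enough (e.g. Lipschitz) for traces and Korn's inequality. $I_2$ is the second-order identity tensor and $I_4$ the fourth-order identity tensor, so $A_i\xi=2\mu_i\xi+(\kappa_i-2\mu_i/N)\operatorname{tr}(\xi)I_2$ for symmetric $\xi\in\mathbb{R}^{N\times N}$. $A:B=\operatorname{tr}(A^\top B)$ for matrices. The optimal value of a maximization problem is the supremum of its objective over the feasible set. G-closure and Hashin--Shtrikman bound: a sequence of uniformly elliptic and bounded symmetric elasticity tensors $A^n\in L^\infty(\Omega)$ $H$-converges to $A^*$ if for every $f\in H^{-1}(\Omega)^N$ the solutions $u_n\in H_0^1(\Omega)^N$ of $-\mathrm{div}\,A^ne(u_n)=f$ satisfy $u_n\rightharpoonup u$ weakly in $H_0^1(\Omega)^N$ and $A^ne(u_n)\rightharpoonup A^*e(u)$ weakly in $L^2(\Omega)^{N\times N}$, where $u\in H_0^1(\Omega)^N$ solves $-\mathrm{div}\,A^*e(u)=f$. For a constant $\tau\in[0,1]$, $G_\tau$ (the G-closure of the two isotropic materials $A_1,A_2$ in proportions $1-\tau,\tau$) is the set of constant tensors $A^*$ that are $H$-limits of sequences $A^+(\chi_n)$, with characteristic functions $\chi_n\in L^\infty(\Omega;\{0,1\})$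 converging weakly$^*$ in $L^\infty(\Omega)$ to $\tau$; for $\theta\in L^\infty(\Omega;[0,1])$, $A^*\in G_\theta$ means $A^*(x)\in G_{\theta(x)}$ for a.e. $x$. The notation $A^*(\theta)e(u):e(u)$ stands for the function $x\mapsto\max_{A^*\in G_{\theta(x)}}A^*e(u)(x):e(u)(x)$ (the maximizing tensor may depend on $e(u)(x)$). Generalized concavity notions, with $X=L^\infty(\Omega)$: for $D\subseteq X$ open and $f:D\to\mathbb{R}$ locally Lipschitz, $$f^\circ(\theta;d)=\limsup_{\theta'\to\theta,\ t\downarrow0}\frac{f(\theta'+td)-f(\theta')}{t},\qquad \partial f(\theta)=\{g\in X^*\mid f^\circ(\theta;d)\ge\langle g,d\rangle_{X^*,X}\ \forall d\in X\}$$ (Clarke subdifferential). A locally Lipschitz $f:D\to\mathbb{R}$ on an open convex set $D$ is pseudo-concave in $D$ if for all $\theta,\theta'\in D$ and all $g\in\partial f(\theta)$, $f(\theta)<f(\theta')$ implies $\langle g,\theta'-\theta\rangle>0$. For a closed convex set $S$, $f$ is pseudo-concave in $S$ if it admits a locally Lipschitz extension to some open convex set $D\supseteq S$ that is pseudo-concave in $D$. A pseudo-concave maximization problem is the maximization of a pseudo-concave function over a closed convex set. A point $\theta^*\in S$ is a Clarke stationary point of $\max_{\theta\in S}f(\theta)$ if there is $g\in\partial f(\theta^* )$ with $\langle g,\theta-\theta^*\rangle\le0$ for all $\theta\in S$. Here the objective of $(P^+)$ is considered, by the same formula, on an open convex set $D\subset L^\infty(\Omega)$ containing $\mathrm{ad}^*_\gamma$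 on which the coefficients remain uniformly elliptic and bounded, e.g. $D=\{\theta\mid-\varepsilon<\operatorname{ess\,inf}\theta\le\operatorname{ess\,sup}\theta<1+\varepsilon\}$ with $\varepsilon>0$ small enough that $\mu_1-\varepsilon(\mu_2-\mu_1)$, $\kappa_1-\varepsilon(\kappa_2-\kappa_1)$ and $\rho_1-\varepsilon(\rho_2-\rho_1)$ are all positive (the Clarke subdifferential at points of $\mathrm{ad}^*_\gamma$ does not depend on this choice). *)

(* Defs.v *)
From HB Require Import structures.
From mathcomp Require Import all_boot all_order all_algebra.
From mathcomp Require Import all_classical all_reals all_analysis.
From mathcomp Require Import measurable_realfun ess_sup_inf hoelder lra.

Set Implicit Arguments.
Unset Strict Implicit.
Unset Printing Implicit Defensive.

Import Order.TTheory GRing.Theory Num.Theory.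
Import numFieldNormedType.Exports.

Local Open Scope classical_set_scope.
Local Open Scope ring_scope.

Definition rV_display : measure_display.
Proof. exact. Qed.

Section borel_rV.
Context {R : realType} {n : nat}.

HB.instance Definition _ := @isMeasurable.Build rV_display 'rV[R]_n
  <<s (@open 'rV[R]_n) >> (@sigma_algebra0 _ setT _)
  (@sigma_algebraC _ _) (@sigma_algebra_bigcup _ setT _).

Lemma open_measurable_rV (U : set 'rV[R]_n) : open U -> measurable U.
Proof. by move=> oU; apply: sub_sigma_algebra. Qed.

Lemma open_rV_bigcup_balls (U : set 'rV[R]_n) : open U ->
  U = \bigcup_(p in [set p : 'rV[rat]_n * nat |
        ball (map_mx ratr p.1 : 'rV[R]_n) (p.2.+1%:R^-1) `<=` U])
      ball (map_mx ratr p.1 : 'rV[R]_n) (p.2.+1%:R^-1).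
Proof.
move=> oU; apply/seteqP; split => [x Ux|x [p /= pU]]; last exact: pU.
have /nbhs_ballP[e /= e0 eU] : nbhs x U by exact: open_nbhs_nbhs.
have e20 : 0 < e / 2 by rewrite divr_gt0.
have [k _ /(_ k (leqnn k)) /= ke] := near_infty_natSinv_lt (PosNum e20).
have k0 : 0 < k.+1%:R^-1 :> R by rewrite invr_gt0 ltr0n.
have qE (i : 'I_n) : exists q : rat, `|ratr q - x 0 i| < k.+1%:R^-1.
  have [|q] := @rat_in_itvoo R (x 0 i - k.+1%:R^-1) (x 0 i + k.+1%:R^-1).
    by move: k0; set a := _^-1; lra.
  rewrite in_itv/= => /andP[q1 q2]; exists q.
  by rewrite ltr_norml; apply/andP; split; move: q1 q2; set a := _^-1; lra.
have [q qx] := choice qE.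
have ballE : ball (map_mx ratr (\row_i q i) : 'rV[R]_n) k.+1%:R^-1 x.
  by split => // i j; rewrite (ord1 i) /ball /= !mxE; exact: qx.
exists (\row_i q i, k) => //= y yb; apply: eU.
have kW : k.+1%:R^-1 <= e / 2 by exact: ltW.
have := ball_triangle (ball_sym (le_ball kW ballE)) (le_ball kW yb).
by rewrite -splitr.
Qed.

Lemma measurable_fun_rV d (T : measurableType d) (f : T -> 'rV[R]_n) :
  (forall i, measurable_fun setT (fun x => f x 0 i)) -> measurable_fun setT f.
Proof.
move=> mf; apply: (@measurability _ _ _ _ setT f (@open 'rV[R]_n)) => //.
move=> _ [U oU <-]; rewrite setTI.
rewrite (open_rV_bigcup_balls oU) preimage_bigcup bigcup_mkcond.
apply: countable_bigcupT_measurable => // -[q k]; case: ifPn => // _ /=.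
rewrite (_ : _ @^-1` _ = \bigcap_(i in [set: 'I_n])
    ((fun x => f x 0 i) @^-1` ball (ratr (q 0 i) : R) k.+1%:R^-1)); last first.
  apply/seteqP; split => [x /= [_ xb] i _ /=|x xb].
    by have := xb 0 i; rewrite mxE.
  split; first by rewrite invr_gt0 ltr0n.
  by move=> i j; rewrite (ord1 i) mxE; exact: xb.
apply: fin_bigcap_measurable => // i _; rewrite -[X in measurable X]setTI.
by apply: mf => //; by apply: open_measurable; exact: ball_open.
Qed.

Lemma measurable_coord (i : 'I_n) :
  measurable_fun [set: 'rV[R]_n] (fun x => x 0 i).
Proof.
apply: (measurability _ (RGenOpens.measurableE R)) => //.
move=> _ [_ [a [b ->]] <-]; rewrite setTI; apply: open_measurable_rV.
apply: open_comp; last exact: interval_open.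
by move=> x _; exact: coord_continuous.
Qed.

End borel_rV.

Section lebesgue_rV_def.
Context {R : realType}.

Definition consrV n (p : R * 'rV[R]_n) : 'rV[R]_n.+1 :=
  \row_i oapp (fun j => p.2 0 j) p.1 (unlift ord0 i).

Lemma measurable_consrV n :
  measurable_fun [set: measurableTypeR R * 'rV[R]_n] (@consrV n).
Proof.
apply: measurable_fun_rV => i.
under eq_fun do rewrite mxE.
case: unliftP => [j _|_] /=; last exact: measurable_fst.
by apply: (measurableT_comp (measurable_coord j)); exact: measurable_snd.
Qed.

Section step.
Variables (n : nat) (m : {sigma_finite_measure set 'rV[R]_n -> \bar R}).

Definition vol_step : set 'rV[R]_n.+1 -> \bar R :=
  pushforward (@lebesgue_measure R \x m)%E (@consrV n).

Let mcons (A : set 'rV[R]_n.+1) : measurable A ->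
  measurable ((@consrV n) @^-1` A : set (measurableTypeR R * 'rV[R]_n)).
Proof. by move=> mA; rewrite -[X in measurable X]setTI; exact: measurable_consrV. Qed.

Let vol_step0 : vol_step set0 = 0%E.
Proof. by rewrite /vol_step /pushforward preimage_set0 measure0. Qed.

Let vol_step_ge0 A : (0 <= vol_step A)%E.
Proof. by rewrite /vol_step /pushforward measure_ge0. Qed.

Let vol_step_sigma_additive : semi_sigma_additive vol_step.
Proof.
move=> F mF tF mUF; rewrite /vol_step /pushforward preimage_bigcup.
apply: measure_semi_sigma_additive.
- by move=> k; exact: mcons.
- apply/trivIsetP => /= i j _ _ ij; rewrite -preimage_setI.
  by move/trivIsetP : tF => /(_ _ _ _ _ ij) ->//; rewrite preimage_set0.
- by rewrite -preimage_bigcup; exact: mcons.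
Qed.

HB.instance Definition _ := isMeasure.Build _ _ _ vol_step
  vol_step0 vol_step_ge0 vol_step_sigma_additive.

Let unconsrV (x : 'rV[R]_n.+1) : measurableTypeR R * 'rV[R]_n :=
  (x 0 ord0, \row_j x 0 (lift ord0 j)).

Let consrVK : cancel (@consrV n) unconsrV.
Proof.
move=> [a y]; rewrite /unconsrV /consrV /= mxE unlift_none /=; congr pair.
by apply/rowP => j; rewrite !mxE liftK.
Qed.

Let vol_step_sigma_finite : sigma_finite setT vol_step.
Proof.
have /sigma_finiteP[F [TF ndF Foo]] := sigma_finiteT (@lebesgue_measure R).
have /sigma_finiteP[G [TG ndG Goo]] := sigma_finiteT m.
exists (fun k => unconsrV @^-1` (F k `*` G k)) => [|k].
  rewrite -preimage_bigcup (_ : \bigcup_k _ = setT) ?preimage_setT//.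
  apply/seteqP; split => // -[x y] _.
  have [i _ Fx] : (\bigcup_k F k) x by rewrite -TF.
  have [j _ Gy] : (\bigcup_k G k) y by rewrite -TG.
  exists (maxn i j) => //; split.
    by have /subsetPset := ndF _ _ (leq_maxl i j); apply.
  by have /subsetPset := ndG _ _ (leq_maxr i j); apply.
have [mF Fk] := Foo k; have [mG Gk] := Goo k; split; last first.
  rewrite /vol_step /pushforward -comp_preimage (_ : _ \o _ = id); last first.
    by apply/funext => p; rewrite /= consrVK.
  by rewrite preimage_id product_measure1E// lte_mul_pinfty// ge0_fin_numE.
have mu : measurable_fun setT unconsrV.
  apply/measurable_fun_pairP; split => /=; first exact: measurable_coord.
  apply: measurable_fun_rV => i; under eq_fun do rewrite mxE.
  exact: measurable_coord.
by rewrite -[X in measurable X]setTI; apply: mu => //; exact: measurableX.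
Qed.

HB.instance Definition _ := Measure_isSigmaFinite.Build _ _ _ vol_step
  vol_step_sigma_finite.

End step.

(* Lebesgue measure on R^n, as an iterated product of the measure on R *)
Fixpoint lebesgue_rV n : {sigma_finite_measure set 'rV[R]_n -> \bar R} :=
  if n is k.+1 then vol_step (lebesgue_rV k) else dirac (0 : 'rV[R]_0).

End lebesgue_rV_def.

Section euclidean.
Context {R : realType} {N : nat}.
Implicit Types (x y : 'rV[R]_N) (A B : 'M[R]_N).

Definition edot x y : R := \sum_i x 0 i * y 0 i.

(* the library norm on ['rV[R]_N] is the sup norm *)
Definition enorm x : R := Num.sqrt (edot x x).

Definition ddot A B : R := \tr (A^T *m B).

Definition sym_part A : 'M[R]_N := 2^-1 *: (A + A^T).

Definition boundary (Om : set 'rV[R]_N) := closure Om `\` interior Om.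

(* Near each boundary point, [Om] is the part above the graph of a Lipschitz
   function in some direction [nu]; a function of the components orthogonal to
   [nu] is encoded as a function on the whole space invariant along [nu]. *)
Definition lipschitz_boundary (Om : set 'rV[R]_N) :=
  forall x, boundary Om x ->
    exists nu r L (g : 'rV[R]_N -> R),
      [/\ enorm nu = 1, 0 < r,
          (forall y z, `|g y - g z| <= L * enorm (y - z)),
          (forall y t, g (y + t *: nu) = g y) &
          forall y, enorm (y - x) < r -> (Om y <-> g y < edot y nu)].

End euclidean.

(* [T] with its discrete sigma-algebra, so that [mu_ext] over it is an infimum
   over all countable covers *)
Definition discrete_meas (T : Type) : Type := T.

Definition discrete_display : measure_display.
Proof. exact. Qed.

Section discrete_meas.
Variable T : pointedType.
HB.instance Definition _ := Pointed.on (discrete_meas T).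
HB.instance Definition _ := @isMeasurable.Build discrete_display
  (discrete_meas T) setT I (fun _ _ => I) (fun _ _ => I).
End discrete_meas.

Section hausdorff.
Context {R : realType} {N : nat}.
Local Notation E := 'rV[R]_N.
Variable s : nat.
Local Open Scope ereal_scope.

(* [diam A ^ s], with value 0 at the empty set and 1 at the other sets
   if [s = 0]; [+oo] if [A] has diameter larger than [delta] *)
Definition hweight (delta : R) (A : set E) : \bar R :=
  if `[< forall x y, A x -> A y -> (enorm (x - y) <= delta)%R >] then
    ereal_sup (0 |` [set z | exists x y,
      [/\ A x, A y & z = (enorm (x - y) ^+ s)%:E]])
  else +oo.

Definition hausdorff_pre (delta : R) : set E -> \bar R :=
  mu_ext (hweight delta : set (discrete_meas E) -> \bar R).

(* without the normalization constant *)
Definition hausdorff (A : set E) : \bar R :=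
  ereal_sup [set hausdorff_pre delta A | delta in [set d | (0 < d)%R]].

Let hweight0 delta : hweight delta set0 = 0.
Proof.
rewrite /hweight; case: asboolP => [_|[]//].
rewrite (_ : [set z | _] = set0) ?setU0 ?ereal_sup1//.
by apply/seteqP; split => // z [x [y []]].
Qed.

Let hweight_ge0 delta A : 0 <= hweight delta A.
Proof.
rewrite /hweight; case: ifPn => _; last by rewrite leey.
by apply: ereal_sup_ubound; left.
Qed.

Let hausdorff_pre_ge0 delta A : 0 <= hausdorff_pre delta A.
Proof. exact: mu_ext_ge0. Qed.

Let hausdorff0 : hausdorff set0 = 0.
Proof.
apply/eqP; rewrite eq_le; apply/andP; split.
  apply: ge_ereal_sup => _ [d _ <-].
  by rewrite /hausdorff_pre mu_ext0.
apply: (le_trans (hausdorff_pre_ge0 1 set0)); apply: ereal_sup_ubound.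
by exists 1%R => //=.
Qed.

Let hausdorff_ge0 A : 0 <= hausdorff A.
Proof.
apply: (le_trans (hausdorff_pre_ge0 1 A)); apply: ereal_sup_ubound.
by exists 1%R => //=.
Qed.

Let le_hausdorff : {homo hausdorff : A B / A `<=` B >-> A <= B}.
Proof.
move=> A B AB; apply: ge_ereal_sup => _ [d d0 <-].
apply: (@le_trans _ _ (hausdorff_pre d B)); first exact: le_mu_ext.
by apply: ereal_sup_ubound; exists d.
Qed.

Let hausdorff_sigma_subadditive : sigma_subadditive hausdorff.
Proof.
move=> F; apply: ge_ereal_sup => _ [d d0 <-].
apply: (@le_trans _ _ (\sum_(i <oo) hausdorff_pre d (F i))).
  exact: mu_ext_sigma_subadditive.
apply: lee_nneseries => [i _ _|i _]; first exact: hausdorff_pre_ge0.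
by apply: ereal_sup_ubound; exists d.
Qed.

HB.instance Definition _ := isOuterMeasure.Build R E hausdorff
  hausdorff0 hausdorff_ge0 le_hausdorff hausdorff_sigma_subadditive.

End hausdorff.

Section generalized_concavity.
Context {R : realType} {X : lmodType R}.
(* [nrm] is only a seminorm in the application: elements of L^oo are
   represented by functions, not by classes modulo a.e. equality *)
Variable nrm : X -> R.
Implicit Types (D S : set X) (f : X -> R) (x y d : X) (g : X -> R).

Definition nopen D :=
  forall x, D x -> exists2 r, 0 < r & forall y, nrm (y - x) < r -> D y.

Definition nclosed S := nopen (~` S).

Definition locally_lipschitz D f := forall x, D x ->
  exists r L, 0 < r /\ forall y z, D y -> D z ->
    nrm (y - x) < r -> nrm (z - x) < r -> `|f y - f z| <= L * nrm (y - z).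

Definition clarke_derivative f x d : \bar R :=
  ereal_inf [set ereal_sup [set q | exists y t,
      [/\ nrm (y - x) < r, 0 < t < r &
          q = ((f (y + t *: d) - f y) / t)%:E]]
    | r in [set r : R | 0 < r]].

Definition dual_space : set (X -> R) :=
  [set g | linear g /\ exists C, forall d, `|g d| <= C * nrm d].

Definition clarke_subdiff f x : set (X -> R) :=
  [set g | dual_space g /\ forall d, ((g d)%:E <= clarke_derivative f x d)%E].

(* The values of [f] outside the open set [D] are irrelevant. *)
Definition pseudo_concave_on D f :=
  [/\ nopen D, convex_set D, locally_lipschitz D f &
      forall x y g, D x -> D y -> clarke_subdiff f x g ->
        f x < f y -> 0 < g (y - x)].

(* In particular the objective [F] is finite on [S]. *)
Definition pseudo_concave_in S (F : X -> \bar R) :=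
  [/\ nclosed S, convex_set S &
      exists D f, [/\ S `<=` D, forall x, S x -> F x = (f x)%:E &
                      pseudo_concave_on D f]].

Definition clarke_stationary S f x :=
  S x /\ exists2 g, clarke_subdiff f x g & forall y, S y -> g (y - x) <= 0.

End generalized_concavity.

Section tensors.
Context {R : realType} {N : nat}.
Local Notation M := 'M[R]_N.

(* Fourth-order tensors act on matrices; only their restriction to symmetric
   matrices matters. *)
Definition elasticity_tensor (al be : R) (A : M -> M) :=
  [/\ linear A,
      (forall xi, xi^T = xi -> (A xi)^T = A xi),
      (forall xi eta, xi^T = xi -> eta^T = eta ->
        ddot (A xi) eta = ddot xi (A eta)) &
      (forall xi, xi^T = xi ->
        al * ddot xi xi <= ddot (A xi) xi <= be * ddot xi xi)].

Definition iso_tensor (mu ka : R) (xi : M) : M :=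
  (2 * mu) *: xi + ((ka - 2 * mu / N%:R) * \tr xi) *: 1%:M.

Definition mix_tensor (A1 A2 : M -> M) (tau : R) (xi : M) : M :=
  A1 xi + tau *: (A2 xi - A1 xi).

End tensors.

Section domain.
Context {R : realType} {N : nat}.
Local Notation E := 'rV[R]_N.
Local Notation M := 'M[R]_N.

Definition partial (i : 'I_N) (f : E -> R) (x : E) : R :=
  'D_(delta_mx 0 i) f x.

Definition smooth (f : E -> R) := forall s : seq 'I_N,
  continuous (foldr partial f s) /\
  forall i x, derivable (foldr partial f s) x (delta_mx 0 i).

Definition smooth_field (phi : E -> E) := forall i, smooth (fun x => phi x 0 i).

Definition jacobian_field (phi : E -> E) (x : E) : M :=
  \matrix_(i, j) partial j (fun y => phi y 0 i) x.

Definition test_function (Om : set E) (f : E -> R) :=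
  smooth f /\
  exists K, [/\ compact K, K `<=` Om & forall x, ~ K x -> f x = 0].

Definition test_field (Om : set E) (phi : E -> E) :=
  forall i, test_function Om (fun x => phi x 0 i).

(* A vector field [v.1] together with its gradient [v.2] *)
Local Notation field := ((E -> E) * (E -> M))%type.

Definition classical_field (phi : E -> E) : field := (phi, jacobian_field phi).

Variables (Om : set E) (oOm : open Om).

(* Lebesgue measure on [Om]; the values of functions outside [Om] are
   irrelevant. *)
Definition leb_on : set E -> \bar R :=
  mrestr (lebesgue_rV N) (open_measurable_rV oOm).

HB.instance Definition _ := Measure.on leb_on.

Local Notation m := leb_on.

Definition L2_field (u : E -> E) :=
  forall i, (fun x => u x 0 i) \in Lfun m 2%:E.

Definition L2_matrix (G : E -> M) :=
  forall i j, (fun x => G x i j) \in Lfun m 2%:E.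

Definition weak_gradient (u : E -> E) (G : E -> M) :=
  forall i j phi, test_function Om phi ->
    \int[m]_x (u x 0 i * partial j phi x) = - \int[m]_x (G x i j * phi x).

(* H^1(Om)^N: the gradient being determined a.e. by the field, it is carried
   along instead of being chosen. *)
Definition H1 : set field :=
  [set v | [/\ L2_field v.1, L2_matrix v.2 & weak_gradient v.1 v.2]].

Definition H1_sqnorm (v : field) : \bar R :=
  (\int[m]_x (edot (v.1 x) (v.1 x) + ddot (v.2 x) (v.2 x))%:E)%E.

Definition H1_norm (v : field) : R := Num.sqrt (fine (H1_sqnorm v)).

(* H^1_0(Om)^N *)
Definition H10 : set field :=
  [set v | H1 v /\ exists phi : nat -> E -> E,
    (forall k, test_field Om (phi k)) /\
    (H1_sqnorm (classical_field (phi k) - v)%R @[k --> \oo] --> 0)%E].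

(* H^{-1}(Om)^N *)
Definition Hm1 : set (field -> R) :=
  [set f | (forall a v w, H10 v -> H10 w -> f (a *: v + w) = a * f v + f w) /\
           exists C, forall v, H10 v -> `|f v| <= C * H1_norm v].

(* The surface measure is the Hausdorff measure of dimension N - 1, up to a
   constant factor. *)
Local Notation surface := (@hausdorff R N N.-1).
Local Notation surface_type := (caratheodory_type surface).

(* The trace is the continuous extension to H^1(Om) of the restriction to the
   boundary of the functions that are smooth up to the boundary. *)
Definition is_trace (v : field) (g : E -> E) :=
  (forall i, measurable_fun (boundary Om : set surface_type)
     (fun x : surface_type => g x 0 i)) /\
  exists phi : nat -> E -> E,
    [/\ forall k, smooth_field (phi k),
        (H1_sqnorm (classical_field (phi k) - v)%R @[k --> \oo] --> 0)%E &
        ((\int[(surface : set surface_type -> \bar R)]_(x in boundary Om)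
          (edot (phi k x - g x) (phi k x - g x))%R%:E) @[k --> \oo] --> 0)%E].

Definition VD (GD : set E) : set field :=
  [set v | H1 v /\ exists g, is_trace v g /\
    surface (GD `&` [set x | g x != 0]) = 0%E].

Definition strain (v : field) (x : E) : M := sym_part (v.2 x).

Section quotient.
Variables (V : set field) (W : R -> M -> \bar R) (rho : R -> R).

Definition rayleigh (theta : E -> R) (v : field) : \bar R :=
  ((\int[m]_x W (theta x) (strain v x)) *
   ((\int[m]_x (rho (theta x) * edot (v.1 x) (v.1 x)))^-1)%R%:E)%E.

Definition min_rayleigh (theta : E -> R) : \bar R :=
  ereal_inf [set rayleigh theta v |
    v in [set v | V v /\ ~ {ae m, forall x, v.1 x = 0}]].

End quotient.

Definition tensor_field (al be : R) (A : E -> M -> M) :=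
  (forall xi i j, measurable_fun setT (fun x => A x xi i j)) /\
  {ae m, forall x, elasticity_tensor al be (A x)}.

(* weak solution in H^1_0 of - div (A e(u)) = f *)
Definition solves (A : E -> M -> M) (f : field -> R) (u : field) :=
  H10 u /\
  forall v, H10 v -> \int[m]_x ddot (A x (strain u x)) (strain v x) = f v.

Definition weak_cvg_H10 (u_ : nat -> field) (u : field) :=
  forall f, Hm1 f -> f (u_ n) @[n --> \oo] --> f u.

Definition weak_cvg_L2 (s_ : nat -> E -> M) (s : E -> M) :=
  forall T, L2_matrix T ->
    (\int[m]_x ddot (s_ n x) (T x)) @[n --> \oo] --> \int[m]_x ddot (s x) (T x).

(* The solutions exist, and are unique as elements of H^1_0, by ellipticity. *)
Definition H_converges (A : nat -> E -> M -> M) (Ast : E -> M -> M) :=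
  [/\ (exists al be, 0 < al /\ forall n, tensor_field al be (A n)),
      (exists al be, 0 < al /\ tensor_field al be Ast) &
      forall f, Hm1 f -> exists (u_ : nat -> field) (u : field),
        [/\ forall n, solves (A n) f (u_ n), solves Ast f u,
            weak_cvg_H10 u_ u &
            weak_cvg_L2 (fun n x => A n x (strain (u_ n) x))
                        (fun x => Ast x (strain u x))]].

Definition weak_star_cvg (chi : nat -> E -> R) (theta : E -> R) :=
  forall w, w \in Lfun m 1%E ->
    (\int[m]_x (chi n x * w x)) @[n --> \oo] --> \int[m]_x (theta x * w x).

Definition G_closure (A1 A2 : M -> M) (tau : R) : set (M -> M) :=
  [set Ast | 0 <= tau <= 1 /\ exists chi : nat -> E -> R,
    [/\ forall n, measurable_fun setT (chi n),
        forall n x, chi n x = 0 \/ chi n x = 1,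
        weak_star_cvg chi (cst tau) &
        H_converges (fun n x => mix_tensor A1 A2 (chi n x)) (cst Ast)]].

Definition HS_upper_bound (A1 A2 : M -> M) (tau : R) (xi : M) : \bar R :=
  ereal_sup [set (ddot (A xi) xi)%:E | A in G_closure A1 A2 tau].

Local Notation Linf := (LfunType m (leey 1)).

Definition Linfty_norm (theta : Linf) : R :=
  fine ('N[m]_(+oo%E) [EFin \o theta])%E.

Definition admissible (gamma : R) : set Linf :=
  [set theta | {ae m, forall x, 0 <= theta x <= 1} /\
               \int[m]_x theta x = gamma].

Definition ess_band (eps : R) : set Linf :=
  [set theta | ((- eps)%:E < ess_inf m (EFin \o theta))%E /\
               (ess_sup m (EFin \o theta) < (1 + eps)%:E)%E].

End domain.

Arguments Linfty_norm {R N Om oOm} theta.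
Arguments admissible {R N Om} oOm gamma.
Arguments ess_band {R N Om} oOm eps.

(* Elements are functions, not classes modulo a.e. equality. *)
Notation Linfty oOm := (LfunType (leb_on oOm) (leey 1)).

(* Main.v *)
Require Import Defs.
From mathcomp Require Import all_boot all_order all_algebra.
From mathcomp Require Import all_classical all_reals all_analysis.
From mathcomp Require Import measurable_realfun ess_sup_inf hoelder lra.

(** For a fixed field [v], the numerator and the denominator of the Rayleigh
    quotient of [(P^+)] are affine in [theta]. If [f x < f y], then near [x]
    all quotients at [z + (y - x)] exceed [f z] by a fixed margin, so at a
    nearly optimal [v] for [z] the affine dependence forces the quotient to
    decrease, at a rate independent of [z] and [v], when [z] moves in the
    direction [x - y]. The Clarke derivative of [f] at [x] in that direction
    is therefore negative, which is pseudo-concavity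
    ([fractional_inf_pseudo_concave]). No compactness of the set of fields
    enters: what makes the estimates uniform in [v] is that the energy and the
    mass of [v] vary, relatively to their values, at most proportionally to the
    L^oo distance of the coefficients ([affine_int_lip],
    [objective_fractional_inf]). A stationary point that is not a maximizer
    would contradict pseudo-concavity at once.

    For the optimal values it suffices that every [Ast] in the G-closure [G_tau]
    lies below the arithmetic mean [A^+(tau)] as a quadratic form
    ([voigt_bound]): the objective of the relaxed problem is then below that of
    [(P^+)] for each [theta]. To get this bound, choose a smooth field [w] compactly
    supported in the domain whose strain at a given point is a prescribed
    symmetric matrix, take for load [f] the one that [Ast] equilibrates with
    [w], and let [u_n] be the solutions with the oscillating tensors [A^n]. They
    converge weakly to a field [u] with the strain of [w]. For a test function
    [phi >= 0], expand
      0 <= int phi A^n (e(u_n) - e(u)) : (e(u_n) - e(u)).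
    The terms linear in [A^n] converge by weak convergence of the stresses and
    of the characteristic functions, and the remaining one,
    int phi A^n e(u_n) : e(u_n - u), tends to 0 ([div_curl]), because [phi] can
    be moved into the field at the cost of terms in [u_n - u] without
    derivatives, which vanish in the limit by compactness ([Korn], [rellich]).
    In the limit int phi (A^+(tau) - Ast) e(u) : e(u) >= 0 for all [phi], hence
    the bound at the chosen point.

    Compactness rests on an explicit estimate ([rellich_estimate]): up to a
    small multiple of the Dirichlet integral, the L^2 norm of a compactly
    supported function is controlled by its means over the cells of a grid. *)

Set Implicit Arguments.
Unset Strict Implicit.
Unset Printing Implicit Defensive.

Import Order.TTheory GRing.Theory Num.Theory.
Import numFieldNormedType.Exports.

Local Open Scope classical_set_scope.
Local Open Scope ring_scope.

(** * Infima of quotients of affine functions *)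

(** The infimum over [v] is expressed by a lower bound and by approximate
    minimizers, since it need not be attained. The constant [K] bounds the
    relative variation of numerators and denominators uniformly in [v]; this
    uniformity replaces compactness of [V]. *)
Record fractional_inf (R : realType) (X : lmodType R) (I : Type)
    (nrm : X -> R) (D : set X) (V : set I) (num den : X -> I -> R)
    (f : X -> R) (K : R) : Prop := FractionalInf {
  frac_nrmD : forall x y, nrm (x + y) <= nrm x + nrm y ;
  frac_nrmZ : forall a x, nrm (a *: x) = `|a| * nrm x ;
  frac_open : nopen nrm D ;
  frac_convex : convex_set D ;
  frac_K0 : 0 < K ;
  num_affine : forall v x y t, V v ->
    num (x + t *: (y - x)) v = num x v + t * (num y v - num x v) ;
  den_affine : forall v x y t, V v ->
    den (x + t *: (y - x)) v = den x v + t * (den y v - den x v) ;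
  num_ge0 : forall x v, D x -> V v -> 0 <= num x v ;
  den_gt0 : forall x v, D x -> V v -> 0 < den x v ;
  num_lip : forall x y v, D x -> D y -> V v ->
    `|num y v - num x v| <= K * nrm (y - x) * num x v ;
  den_lip : forall x y v, D x -> D y -> V v ->
    `|den y v - den x v| <= K * nrm (y - x) * den x v ;
  frac_lb : forall x v, D x -> V v -> f x * den x v <= num x v ;
  frac_inf : forall x (e : R), D x -> 0 < e ->
    exists2 v, V v & num x v < (f x + e) * den x v }.

Section seminorm.
Context {R : realType} {X : lmodType R}.
Variable nrm : X -> R.
Hypothesis nrmD : forall x y, nrm (x + y) <= nrm x + nrm y.
Hypothesis nrmZ : forall a x, nrm (a *: x) = `|a| * nrm x.

Lemma seminorm0 : nrm 0 = 0.
Proof. by rewrite -(scale0r (0 : X)) nrmZ normr0 mul0r. Qed.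

Lemma seminormN x : nrm (- x) = nrm x.
Proof. by rewrite -scaleN1r nrmZ normrN1 mul1r. Qed.

Lemma seminormB x y : nrm (x - y) = nrm (y - x).
Proof. by rewrite -seminormN opprB. Qed.

Lemma seminorm_ge0 x : 0 <= nrm x.
Proof. by have := nrmD x (- x); rewrite subrr seminormN seminorm0; lra. Qed.

End seminorm.

Section fractional_program.
Context {R : realType} {X : lmodType R} {I : Type}.
Implicit Types (nrm : X -> R) (D : set X) (V : set I) (num den : X -> I -> R).

Lemma fractional_inf_ge0 nrm D V num den f K (F : fractional_inf nrm D V num den f K) x : D x -> 0 <= f x.
Proof.
move=> Dx; apply/ler_addgt0Pr => e e0; have [v Vv h] := frac_inf F Dx e0.
have := num_ge0 F Dx Vv; have := den_gt0 F Dx Vv; move: h.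
by set N := num _ _; set d := den _ _; nra.
Qed.

(** An almost optimal [v] at [x] is a competitor at [y], where its quotient
    has changed by a factor at most (1 + a) / (1 - a) <= 1 + 4 a, for [a = K
    * nrm (y - x)]. *)
Lemma fractional_inf_ratio nrm D V num den f K (F : fractional_inf nrm D V num den f K) x y : D x -> D y -> K * nrm (y - x) <= 1 / 2 ->
  f y <= (1 + 4 * (K * nrm (y - x))) * f x.
Proof.
move=> Dx Dy a2; have K0 := frac_K0 F.
have nrm_ge0 := seminorm_ge0 (frac_nrmD F) (frac_nrmZ F).
have a0 : 0 <= K * nrm (y - x) by rewrite mulr_ge0// ltW.
apply/ler_addgt0Pr => e e0.
have e'0 : 0 < e / 3 by rewrite divr_gt0.
have [v Vv h] := frac_inf F Dx e'0.
have Nx := num_ge0 F Dx Vv; have dx := den_gt0 F Dx Vv; have dy := den_gt0 F Dy Vv.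
have := frac_lb F Dy Vv.
have := num_lip F Dx Dy Vv; rewrite ler_norml => /andP[_ nl].
have := den_lip F Dx Dy Vv; rewrite ler_norml => /andP[dl _].
move: a0 a2 Nx dx dy h nl dl (fractional_inf_ge0 F Dx); set a := K * _.
move: (num x v) (num y v) (den x v) (den y v) (f x) (f y) => N N' d d' u u'.
move=> a0 a2 N0 d0 d'0 h nl dl u0 lb.
have s1 : u' * d' <= (1 + a) * ((u + e / 3) * d) by nra.
have s2 : (1 + a) * d <= (1 + 4 * a) * d'.
  have p1 : (1 + 4 * a) * ((1 - a) * d) <= (1 + 4 * a) * d'.
    by rewrite ler_wpM2l//; lra.
  have a20 : 0 <= 1 - 2 * a by lra.
  have := mulr_ge0 (mulr_ge0 a0 a20) (ltW d0).
  by lra.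
have s3 : u' * d' <= ((1 + 4 * a) * (u + e / 3)) * d' by nra.
have : u' <= (1 + 4 * a) * (u + e / 3) by rewrite -(ler_pM2r d'0).
have : a * e <= 1 / 2 * e by rewrite ler_pM2r.
by lra.
Qed.

Lemma fractional_inf_locally_lipschitz nrm D V num den f K (F : fractional_inf nrm D V num den f K) : locally_lipschitz nrm D f.
Proof.
move=> x Dx; have K0 := frac_K0 F.
have nrm_ge0 := seminorm_ge0 (frac_nrmD F) (frac_nrmZ F).
exists (1 / (8 * K)), (8 * K * f x); split.
  by rewrite divr_gt0// mulr_gt0.
have key y z : D y -> D z -> nrm (y - x) < 1 / (8 * K) ->
    nrm (z - x) < 1 / (8 * K) -> f y - f z <= 8 * K * f x * nrm (y - z).
  move=> Dy Dz; rewrite ltr_pdivlMr ?mulr_gt0// => yr.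
  rewrite ltr_pdivlMr ?mulr_gt0// => zr.
  have yz : nrm (y - z) <= nrm (y - x) + nrm (z - x).
    by rewrite (seminormB (frac_nrmZ F) z) (le_trans _ (frac_nrmD F _ _))// addrA subrK.
  have yzr : K * nrm (y - z) <= 1 / 2 by move: yz yr zr K0; nra.
  have zxr : K * nrm (z - x) <= 1 / 2 by move: zr K0 (seminorm_ge0 (frac_nrmD F) (frac_nrmZ F) (z - x)); nra.
  have h1 := fractional_inf_ratio F Dz Dy yzr.
  have h2 := fractional_inf_ratio F Dx Dz zxr.
  have h3 : f z <= 2 * f x by move: h2 zr (fractional_inf_ge0 F Dx); nra.
  have a0 : 0 <= K * nrm (y - z) by rewrite mulr_ge0// ltW.
  by move: h1 h3 a0; nra.
move=> y z Dy Dz yr zr; rewrite ler_norml; apply/andP; split; last exact: key.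
by rewrite lerNl opprB (seminormB (frac_nrmZ F) y); exact: key.
Qed.

(** Take [v] almost optimal at [z]. At [y' = z + (y - x)], close to [y], its
    quotient exceeds [f z] by a margin; by affinity the point [w] beyond [z]
    on the line from [y'] has quotient at most [f z] minus a multiple of
    [t]. The error in the choice of [v] is eliminated at the end, so the
    rate [c] depends on [x] and [y] only. *)
Lemma fractional_inf_descent nrm D V num den f K (F : fractional_inf nrm D V num den f K) x y : D x -> D y -> f x < f y ->
  exists c r : R, [/\ 0 < c, 0 < r &
    forall z t, nrm (z - x) < r -> 0 < t < r ->
      f (z + t *: (x - y)) <= f z - c * t].
Proof.
move=> Dx Dy fxy; have K0 := frac_K0 F.
pose n := nrm (y - x).
have nrm_ge0 := seminorm_ge0 (frac_nrmD F) (frac_nrmZ F).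
have n0 : 0 <= n by exact: nrm_ge0.
pose de := (f y - f x) / 3; have de0 : 0 < de by rewrite /de; lra.
have [rx rx0 Dxr] := frac_open F Dx; have [ry ry0 Dyr] := frac_open F Dy.
have [lx [Lx [lx0 lipx]]] := fractional_inf_locally_lipschitz F Dx.
have [ly [Ly [ly0 lipy]]] := fractional_inf_locally_lipschitz F Dy.
have nrm00 : nrm 0 = 0 by exact: (seminorm0 (frac_nrmZ F)).
pose M := 1 + `|Lx| + `|Ly|.
have M0 : 0 < M by rewrite /M; have := normr_ge0 Lx; have := normr_ge0 Ly; lra.
(* the radius keeps all points in the domain and within the reach of the Lipschitz bounds *)
pose r := Num.min (Num.min (rx / (1 + n)) ry) (Num.min (Num.min lx ly)
  (Num.min (de / M) (Num.min 1 (1 / (2 * K * (1 + n)))))).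
have n1 : 0 < 1 + n by lra.
have r0 : 0 < r.
  rewrite /r !lt_min; have k0 : 0 < 2 * K * (1 + n) by rewrite !mulr_gt0.
  by do ?[apply/andP; split]; rewrite // divr_gt0.
have c0 : 0 < 1 + 2 * K * n.
  by have := mulr_ge0 (ltW K0) n0; lra.
exists (de / (1 + 2 * K * n)), r; split => //; first by rewrite divr_gt0.
move=> z t zr /andP[t0 tr].
have small s : s < r -> [/\ s * (1 + n) < rx, s < ry, s < lx, s < ly &
    [/\ s * M < de, s < 1 & s * (2 * K * (1 + n)) < 1]].
  rewrite /r !lt_min -!andbA => /and5P[+ s2 s3 s4 /and3P[+ s6 +]].
  by rewrite !ltr_pdivlMr ?mulr_gt0//; split.
have [z1 z2 z3 z4 [z5 z6 z7]] := small _ zr.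
have [t1 t2 t3 t4 [t5 t6 t7]] := small _ tr.
pose y' := z + (y - x); have y'y : y' - y = z - x.
  by rewrite /y' addrA addrAC addrK.
have Dz : D z.
  by apply: Dxr; have := mulr_ge0 (nrm_ge0 (z - x)) n0; clear -z1; lra.
have Dy' : D y' by apply: Dyr; rewrite y'y.
set w := z + t *: (x - y).
have wz : w - z = t *: (x - y) by rewrite /w addrC addKr.
have nwz : nrm (w - z) = t * n by rewrite wz (frac_nrmZ F) gtr0_norm// (seminormB (frac_nrmZ F)).
have Dw : D w.
  apply: Dxr; have := frac_nrmD F (w - z) (z - x); rewrite addrA subrK nwz.
  case: (ltP (nrm (z - x)) t) => zt; first by clear -t1 zt; lra.
  by have := ler_wpM2r n0 zt; clear -z1; lra.
have fz : f z < f x + de.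
  have := lipx _ _ Dz Dx z3; rewrite subrr nrm00 => /(_ lx0).
  rewrite ler_norml => /andP[_]; have : Lx * nrm (z - x) < de.
    apply: le_lt_trans z5; rewrite mulrC ler_wpM2l ?nrm_ge0//.
    by rewrite /M; have := ler_norm Lx; have := normr_ge0 Ly; clear; lra.
  by clear; lra.
have fy' : f y - de < f y'.
  have := lipy _ _ Dy' Dy; rewrite y'y subrr nrm00 => /(_ z4 ly0).
  rewrite ler_norml => /andP[+ _]; have : Ly * nrm (z - x) < de.
    apply: le_lt_trans z5; rewrite mulrC ler_wpM2l ?nrm_ge0//.
    by rewrite /M; have := ler_norm Ly; have := normr_ge0 Lx; clear; lra.
  by clear; lra.
have fzy' : f z + de <= f y'.
  have : f y = f x + 3 * de by rewrite /de; clear; lra.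
  by clear -fz fy'; lra.
have wE : w = z + (- t) *: (y' - z).
  by rewrite /w /y' [z + _ - z]addrC addKr scaleNr -scalerN opprB.
apply/ler_addgt0Pr => e e0.
have e'0 : 0 < e / 4 by rewrite divr_gt0.
have [v Vv h] := frac_inf F Dz e'0.
have dz := den_gt0 F Dz Vv; have dw := den_gt0 F Dw Vv; have dy := den_gt0 F Dy' Vv.
have lbw := frac_lb F Dw Vv; have lby := frac_lb F Dy' Vv.
have numw : num w v = num z v - t * (num y' v - num z v).
  by rewrite wE (num_affine F)// mulNr.
have denw : den w v = den z v - t * (den y' v - den z v).
  by rewrite wE (den_affine F)// mulNr.
have := den_lip F Dz Dw Vv; rewrite nwz ler_norml => /andP[dl1 _].
have := den_lip F Dy' Dw Vv.
have -> : nrm (w - y') = (1 + t) * n.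
  have -> : w - y' = - ((1 + t) *: (y - x)).
    by rewrite -scalerN opprB scalerDl scale1r /w /y' opprD addrACA subrr add0r opprB addrC.
  by rewrite (seminormN (frac_nrmZ F)) (frac_nrmZ F) ger0_norm ?addr_ge0// ltW.
rewrite ler_norml => /andP[_ dl2].
have b1 : den z v <= 2 * den w v.
  have h1 : K * (t * n) <= 1 / 2.
    by have := mulr_gt0 K0 t0; clear -t7; lra.
  by have := ler_wpM2r (ltW dz) h1; clear -dl1; lra.
have b2 : den w v <= (1 + 2 * K * n) * den y' v.
  have h1 : K * ((1 + t) * n) <= 2 * K * n.
    have -> : 2 * K * n = K * (2 * n) by clear; lra.
    by rewrite ler_pM2l// ler_wpM2r//; clear -t6; lra.
  by have := ler_wpM2r (ltW dy) h1; clear -dl2; lra.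
move: numw denw h lbw lby b1 b2 dz dw dy fzy' c0; rewrite -/w.
move: (num w v) (num z v) (num y' v) (den w v) (den z v) (den y' v)
  (f w) (f z) (f y') (1 + 2 * K * n) => Nw Nz Ny dw dz dy fw fz' fy'' C.
move=> numw denw h lbw lby b1 b2 dz0 dw0 dy0 fzy C0.
have s0 : (fz' + de) * dy <= Ny by rewrite (le_trans _ lby)// ler_pM2r.
have s1 : fw * dw <= fz' * dw + (1 + t) * (e / 4) * dz - t * (de * dy).
  rewrite (le_trans lbw)//.
  have := ler_wpM2l (ltW t0) s0.
  have t10 : 0 <= 1 + t by clear -t0; lra.
  have := ler_wpM2l t10 (ltW h).
  by rewrite denw numw; clear; lra.
have s2 : (1 + t) * (e / 4) * dz <= e * dw.
  have h1 : (1 + t) * (e / 4) * dz <= 2 * (e / 4) * dz.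
    by rewrite ler_pM2r// ler_pM2r//; clear -t6; lra.
  by have := ler_wpM2l (ltW e0) b1; clear -h1; lra.
have s3 : de / C * dw <= de * dy.
  rewrite mulrAC ler_pdivrMr//.
  by have := ler_wpM2l (ltW de0) b2; clear; lra.
rewrite -(ler_pM2r dw0).
have : t * (de / C * dw) <= t * (de * dy) by rewrite ler_pM2l.
by move: s1 s2 s3; clear; lra.
Qed.

(** By the descent estimate the Clarke derivative at [x] in the direction [x
    - y] is at most [- c], and so is [g (x - y)] for each subgradient [g]. *)
Lemma fractional_inf_pseudo_concave nrm D V num den f K (F : fractional_inf nrm D V num den f K) : pseudo_concave_on nrm D f.
Proof.
split; first exact: (frac_open F).
- exact: (frac_convex F).
- exact: (fractional_inf_locally_lipschitz F).
move=> x y g Dx Dy [[lg _] gle] fxy.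
have [c [r [c0 r0 desc]]] := fractional_inf_descent F Dx Dy fxy.
have : g (x - y) <= - c.
  rewrite -lee_fin (le_trans (gle _))//.
  apply: (@le_trans _ _ (ereal_sup [set q | exists y0 t,
      [/\ nrm (y0 - x) < r, 0 < t < r &
      q = ((f (y0 + t *: (x - y)) - f y0) / t)%:E]])).
    by apply: ereal_inf_lbound; exists r.

  apply: ge_ereal_sup => _ [z [t [zr tr ->]]].
  rewrite lee_fin; have t0 : 0 < t by case/andP: tr.
  by rewrite ler_pdivrMr//; have := desc z t zr tr; lra.
have -> : g (x - y) = - g (y - x).
  have gl := lg (-1) (y - x) 0; move: gl.
  have g0 : g 0 = 0.
    by have := lg 1 0 0; rewrite scale1r addr0 scale1r => /eqP; rewrite -subr_eq subrr => /eqP.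
  by rewrite addr0 g0 addr0 !scaleN1r opprB.
by lra.
Qed.

End fractional_program.

(** * Integrable and square-integrable functions *)

Section lebesgue_spaces.
Context d (T : measurableType d) (R : realType).
Variable mu : {measure set T -> \bar R}.
Implicit Types f g h : T -> R.

Definition L1 f := f \in Lfun mu 1%E.
Definition L2 f := f \in Lfun mu 2%:E.

Lemma L1_measurable f : L1 f -> measurable_fun setT f.
Proof. by rewrite /L1 inE => /andP[/[!inE]]. Qed.

Lemma L2_measurable f : L2 f -> measurable_fun setT f.
Proof. by rewrite /L2 inE => /andP[/[!inE]]. Qed.

Lemma L1_integrable f : L1 f -> mu.-integrable setT (EFin \o f).
Proof. by move/Lfun1_integrable. Qed.

Lemma le_L1 f g : measurable_fun setT f -> (forall x, `|f x| <= `|g x|) ->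
  L1 g -> L1 f.
Proof.
move=> mf fg /L1_integrable ig; apply/Lfun1_integrable.
apply: le_integrable ig => //; first exact/measurable_EFinP.
by move=> x _ /=; rewrite lee_fin.
Qed.

Lemma L1D f g : L1 f -> L1 g -> L1 (fun x => f x + g x).
Proof. by move=> lf lg; exact: (rpredD lf lg). Qed.

Lemma L1B f g : L1 f -> L1 g -> L1 (fun x => f x - g x).
Proof. by move=> lf lg; exact: (rpredB lf lg). Qed.

Lemma L1Z a f : L1 f -> L1 (fun x => a * f x).
Proof. by move=> lf; exact: (rpredZ a lf). Qed.

Lemma L1_0 : L1 (fun=> 0).
Proof. exact: rpred0. Qed.

Lemma L1_sum (I : Type) (r : seq I) (P : pred I) (F : I -> T -> R) :
  (forall i, P i -> L1 (F i)) -> L1 (fun x => \sum_(i <- r | P i) F i x).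
Proof.
move=> h; rewrite (_ : (fun x => _) = \sum_(i <- r | P i) F i); last first.
  by apply/funext => x; rewrite fct_sumE.
exact: rpred_sum.
Qed.

Let L2_submod : submod_closed (Lfun mu 2%:E).
Proof. by apply: Lfun_submod_closed; rewrite lee1n. Qed.

Lemma L2_0 : L2 (fun=> 0).
Proof. by have [] := L2_submod. Qed.

Lemma L2Z a f : L2 f -> L2 (fun x => a * f x).
Proof.
move=> lf; have [_ /(_ a _ _ lf L2_0)] := L2_submod.
by rewrite (_ : _ + _ = fun x => a * f x)//; apply/funext => x; rewrite fctE addr0.
Qed.

Lemma L2D f g : L2 f -> L2 g -> L2 (fun x => f x + g x).
Proof.
move=> lf lg; have [_ /(_ 1 _ _ lf lg)] := L2_submod.
by rewrite (_ : _ + _ = fun x => f x + g x)//; apply/funext => x; rewrite fctE scale1r.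
Qed.

Lemma L2B f g : L2 f -> L2 g -> L2 (fun x => f x - g x).
Proof.
move=> lf /(L2Z (-1)) lg; have := L2D lf lg; congr L2.
by apply/funext => x; rewrite mulN1r.
Qed.

Lemma L2_sum (I : Type) (r : seq I) (P : pred I) (F : I -> T -> R) :
  (forall i, P i -> L2 (F i)) -> L2 (fun x => \sum_(i <- r | P i) F i x).
Proof.
move=> h; elim: r => [|i r ih].
  by under eq_fun do rewrite big_nil; exact: L2_0.
under eq_fun do rewrite big_cons.
by case: (boolP (P i)) => // Pi; apply: L2D => //; exact: h.
Qed.

Lemma L2M f g : L2 f -> L2 g -> L1 (fun x => f x * g x).
Proof. exact: Lfun2_mul_Lfun1. Qed.

Lemma L2_sqr f : L2 f -> L1 (fun x => f x ^+ 2).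
Proof. by move=> /Lfun2_integrable_sqr/Lfun1_integrable. Qed.

Lemma L2P f : measurable_fun setT f -> L1 (fun x => f x ^+ 2) -> L2 f.
Proof.
move=> mf /L1_integrable/integrableP[_ foo].
rewrite /L2 inE; apply/andP; split; rewrite inE//= /finite_norm.
rewrite unlock poweR_lty// (le_lt_trans _ foo)//.
apply: ge0_le_integral => //.
- by move=> x _; rewrite poweR_ge0.
- by apply: (measurableT_comp (measurable_poweR _)); apply: measurableT_comp => //; exact/measurable_EFinP.
- by do 2 apply: measurableT_comp => //; exact: measurable_funX.
- move=> x _ /=; rewrite lee_fin.
  by rewrite powR_mulrn// normrX.
Qed.

Lemma L2_bounded_mul (M : R) h f : measurable_fun setT h -> (forall x, `|h x| <= M) ->
  L2 f -> L2 (fun x => h x * f x).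
Proof.
move=> mh hM lf; have mf := L2_measurable lf.
apply: L2P; first exact: measurable_funM.
apply: (@le_L1 _ (fun x => M ^+ 2 * f x ^+ 2)); last exact/L1Z/L2_sqr.
  by apply: measurable_funX; exact: measurable_funM.
move=> x; rewrite exprMn [leLHS]normrM [leRHS]normrM ler_wpM2r// !normrX lerXn2r ?nnegrE//.
by rewrite (le_trans (hM x))// ler_norm.
Qed.

Lemma L1_bounded_mul (M : R) h f : measurable_fun setT h -> (forall x, `|h x| <= M) ->
  L1 f -> L1 (fun x => h x * f x).
Proof.
move=> mh hM lf; have mf := L1_measurable lf.
apply: (@le_L1 _ (fun x => M * f x)); last exact/L1Z.
  exact: measurable_funM.
move=> x; rewrite !normrM ler_wpM2r//.
by rewrite (le_trans (hM x))// ler_norm.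
Qed.

Lemma RintD f g : L1 f -> L1 g ->
  \int[mu]_x (f x + g x) = \int[mu]_x f x + \int[mu]_x g x.
Proof. by move=> /L1_integrable ? /L1_integrable ?; rewrite RintegralD. Qed.

Lemma RintB f g : L1 f -> L1 g ->
  \int[mu]_x (f x - g x) = \int[mu]_x f x - \int[mu]_x g x.
Proof. by move=> /L1_integrable ? /L1_integrable ?; rewrite RintegralB. Qed.

Lemma RintZ a f : L1 f -> \int[mu]_x (a * f x) = a * \int[mu]_x f x.
Proof. by move=> /L1_integrable ?; rewrite RintegralZl. Qed.

Lemma RintN f : L1 f -> \int[mu]_x (- f x) = - \int[mu]_x f x.
Proof.
move=> lf; rewrite -mulN1r -RintZ//; apply: eq_Rintegral => x _.
by rewrite mulN1r.
Qed.

Lemma Rint0 : \int[mu]_x (0 : R) = 0.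
Proof. by rewrite /Rintegral integral0. Qed.

Lemma Rint_sum (I : Type) (r : seq I) (P : pred I) (F : I -> T -> R) :
  (forall i, P i -> L1 (F i)) ->
  \int[mu]_x (\sum_(i <- r | P i) F i x) = \sum_(i <- r | P i) \int[mu]_x F i x.
Proof.
move=> h; elim: r => [|i r ih].
  by rewrite big_nil; under eq_Rintegral do rewrite big_nil; exact: Rint0.
rewrite big_cons; under eq_Rintegral do rewrite big_cons.
by case: ifPn => // Pi; rewrite RintD ?ih//; [exact: h|exact: L1_sum].
Qed.

Lemma le_Rint f g : L1 f -> L1 g -> (forall x, f x <= g x) ->
  \int[mu]_x f x <= \int[mu]_x g x.
Proof. by move=> /L1_integrable ? /L1_integrable ? h; apply: le_Rintegral. Qed.

Lemma eq_Rint_ae f g : measurable_fun setT f -> measurable_fun setT g ->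
  {ae mu, forall x, f x = g x} -> \int[mu]_x f x = \int[mu]_x g x.
Proof.
move=> mf mg fg; rewrite /Rintegral; congr fine.
apply: ae_eq_integral => //; [exact/measurable_EFinP|exact/measurable_EFinP|].
by apply: filterS fg => x /= ->.
Qed.

Lemma Rint_ge0_ae f : measurable_fun setT f -> {ae mu, forall x, 0 <= f x} ->
  0 <= \int[mu]_x f x.
Proof.
move=> mf f0; rewrite (@eq_Rint_ae _ (fun x => `|f x|))//.
- exact: Rintegral_ge0.
- exact: measurableT_comp.
- by apply: filterS f0 => x /= h; rewrite ger0_norm.
Qed.

Lemma le_Rint_ae f g : L1 f -> L1 g -> {ae mu, forall x, f x <= g x} ->
  \int[mu]_x f x <= \int[mu]_x g x.
Proof.
move=> lf lg fg; rewrite -subr_ge0 -RintB//; apply: Rint_ge0_ae.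
  exact: (L1_measurable (L1B lg lf)).
by apply: filterS fg => x /=; rewrite subr_ge0.
Qed.

Lemma EFin_Rint f : L1 f -> (\int[mu]_x (f x)%:E = (\int[mu]_x f x)%:E)%E.
Proof. by move=> lf; rewrite /Rintegral fineK//; exact: integrable_fin_num (L1_integrable lf). Qed.

Lemma le_L1_ae f g : measurable_fun setT f -> L1 g ->
  {ae mu, forall z, `|f z| <= `|g z|} -> L1 f.
Proof.
move=> mf lg fg; apply/Lfun1_integrable/integrableP; split; first exact/measurable_EFinP.
have /L1_integrable/integrableP[mg goo] := lg.
apply: le_lt_trans goo; apply: ae_ge0_le_integral => //.
- by apply: measurableT_comp => //; exact/measurable_EFinP.
- by apply: measurableT_comp.
- by apply: filterS fg => z h _; rewrite /= lee_fin.
Qed.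

Lemma Rint_eq0_ae f : L1 f -> (forall x, 0 <= f x) -> \int[mu]_x f x = 0 ->
  {ae mu, forall x, f x = 0}.
Proof.
move=> lf f0 h; have mf := L1_measurable lf.
have /(ae_eq_integral_abs mu measurableT) : measurable_fun setT (EFin \o f).
  exact/measurable_EFinP.
case=> + _; have -> : (\int[mu]_x `|(EFin \o f) x|)%E = 0%E.
  rewrite (eq_integral (EFin \o f)); last by move=> x _ /=; rewrite ger0_norm.
  rewrite -[LHS]fineK; first by rewrite [fine _]h.
  exact: integrable_fin_num (L1_integrable lf).
by move=> /(_ erefl); apply: filterS => x /(_ I) [].
Qed.

Lemma Rint_gt0 f : L1 f -> (forall x, 0 <= f x) ->
  ~ {ae mu, forall x, f x = 0} -> 0 < \int[mu]_x f x.
Proof.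
move=> lf f0 h; rewrite lt_neqAle Rintegral_ge0// andbT; apply/eqP => h0.
by apply: h; apply: Rint_eq0_ae.
Qed.

(** The discriminant of the nonnegative polynomial [t |-> \int (f - t g)^2]. *)
Lemma Cauchy_Schwarz f g : L2 f -> L2 g ->
  (\int[mu]_x (f x * g x)) ^+ 2 <=
  (\int[mu]_x (f x ^+ 2)) * \int[mu]_x (g x ^+ 2).
Proof.
move=> lf lg; set b := \int[mu]_x _; set a := Rintegral _ _ _; set c := Rintegral _ _ _.
have key t : 0 <= a - 2 * t * b + t ^+ 2 * c.
  have <- : \int[mu]_x ((f x - t * g x) ^+ 2) = a - 2 * t * b + t ^+ 2 * c.
    rewrite /a /b /c -!RintZ -?RintB -?RintD; [|by rewrite ?L2_sqr ?L1B ?L1Z ?L2M ?L2_sqr..].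
    by apply: eq_Rintegral => x _; clear; lra.
  by apply: Rintegral_ge0 => x _; exact: sqr_ge0.
have a0 : 0 <= a by apply: Rintegral_ge0 => x _; exact: sqr_ge0.
have c0 : 0 <= c by apply: Rintegral_ge0 => x _; exact: sqr_ge0.
have [c00|cn0] := eqVneq c 0.
  rewrite c00 mulr0; have [->|b0] := eqVneq b 0; first by rewrite expr0n.
  have := key ((a + 1) / (2 * b)); rewrite c00 mulr0 addr0.
  rewrite (_ : 2 * _ * b = a + 1); first by lra.
  by rewrite mulrAC mulrCA mulfV ?mulr1// mulf_neq0// pnatr_eq0.
have c1 : 0 < c by rewrite lt_neqAle eq_sym cn0.
have := key (b / c).
have -> : a - 2 * (b / c) * b + (b / c) ^+ 2 * c = a - b ^+ 2 / c.
  have -> : (b / c) ^+ 2 * c = b ^+ 2 / c.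
    by rewrite exprMn expr2 -(expr2 b) -!mulrA mulVf// mulr1.
  by clear; lra.
by rewrite subr_ge0 ler_pdivrMr.
Qed.

(** Strong convergence to 0 against a sequence that is only bounded: the
    form in which compactness is used below. *)
Lemma L2_cvg0_bounded (u v : nat -> T -> R) (A : R) :
  (forall n, L2 (u n)) -> (forall n, L2 (v n)) ->
  (\int[mu]_x (u n x ^+ 2)) @[n --> \oo] --> (0 : R) ->
  (forall n, \int[mu]_x (v n x ^+ 2) <= A) ->
  (\int[mu]_x (u n x * v n x)) @[n --> \oo] --> (0 : R).
Proof.
move=> lu lv cu vA; apply/norm_cvg0P.
have : Num.sqrt ((\int[mu]_x (u n x ^+ 2)) * A) @[n --> \oo] --> (0 : R).
  rewrite -[X in _ --> X]sqrtr0 -[in X in _ --> X](mul0r A).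
  apply: continuous_cvg; first exact: sqrt_continuous.
  by apply: cvgM => //; exact: cvg_cst.
apply: (squeeze_cvgr _ (cvg_cst 0)).
near=> n; rewrite normr_ge0/= -sqrtr_sqr ler_wsqrtr//.
apply: (le_trans (Cauchy_Schwarz (lu n) (lv n))).
by rewrite ler_wpM2l//; apply: Rintegral_ge0 => x _; exact: sqr_ge0.
Unshelve. all: by end_near. Qed.

Definition L2_cvg (f_ : nat -> T -> R) f :=
  (\int[mu]_x ((f_ n x - f x) ^+ 2)) @[n --> \oo] --> (0 : R).

Lemma L2_cvgM (f_ g_ : nat -> T -> R) f g :
  (forall n, L2 (f_ n)) -> (forall n, L2 (g_ n)) -> L2 f -> L2 g ->
  L2_cvg f_ f -> L2_cvg g_ g ->
  (\int[mu]_x (f_ n x * g_ n x)) @[n --> \oo] --> \int[mu]_x (f x * g x).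
Proof.
move=> lf_ lg_ lf lg cf cg.
have [M Mb] : exists M, forall n, \int[mu]_x ((g_ n x - g x) ^+ 2) <= M.
  have [M [_ hM]] := cvg_seq_bounded (cvgP _ cg).
  exists (M + 1) => n; apply: (le_trans (ler_norm _)).
  by apply: (hM (M + 1)) => //; rewrite ltrDl.
have -> : (fun n => \int[mu]_x (f_ n x * g_ n x)) =
  (fun n => \int[mu]_x ((f_ n x - f x) * (g_ n x - g x)) +
     (\int[mu]_x ((f_ n x - f x) * g x) + \int[mu]_x ((g_ n x - g x) * f x)) +
     \int[mu]_x (f x * g x)).
  apply/funext => n; rewrite -!RintD; do ?[apply: L1D]; do ?[apply: L2M => //; do ?[apply: L2B => //]] => //.
  by apply: eq_Rintegral => x _; lra.
rewrite -[X in _ --> X]add0r; apply: cvgD; last exact: cvg_cst.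
rewrite -[X in _ --> X]addr0; apply: cvgD.
  exact: (L2_cvg0_bounded (fun n => L2B (lf_ n) lf) (fun n => L2B (lg_ n) lg) cf Mb).
rewrite -[X in _ --> X]addr0; apply: cvgD.
  exact: (L2_cvg0_bounded (fun n => L2B (lf_ n) lf) (fun=> lg) cf (fun=> lexx _)).
exact: (L2_cvg0_bounded (fun n => L2B (lg_ n) lg) (fun=> lf) cg (fun=> lexx _)).
Qed.

Lemma L2_cvg_cst f : L2_cvg (fun=> f) f.
Proof.
rewrite /L2_cvg (_ : (fun=> _) = cst 0); first exact: cvg_cst.
apply/funext => n /=; rewrite -[RHS]Rint0; apply: eq_Rintegral => x _.
by rewrite subrr expr0n.
Qed.

End lebesgue_spaces.

(** * Iterated integrals on Euclidean space *)

(** The functions integrated on the whole space below are bounded and vanish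
    outside a cube, so that all integrability conditions reduce to this
    case. *)
Lemma L1_bounded_support d (T : measurableType d) (R : realType)
    (mu : {measure set T -> \bar R}) (A : set T) (M : R) (f : T -> R) :
  measurable A -> (mu A < +oo)%E -> measurable_fun setT f ->
  (forall x, `|f x| <= M) -> (forall x, ~ A x -> f x = 0) -> L1 mu f.
Proof.
move=> mA Aoo mf fM f0.
have i1 : L1 mu (\1_A : T -> R).
  apply/Lfun1_integrable/integrableP; split; first exact/measurable_EFinP.
  under eq_integral do rewrite /= ger0_norm//.
  by rewrite integral_indic// setIT.
apply: (@le_L1 _ _ _ _ _ (fun x => M * \1_A x)) => //; last exact: L1Z.
move=> x; rewrite normrM indicE; have [xA|/negP xA] := boolP (x \in A).
  by rewrite normr1 mulr1 (le_trans (fM x))// ler_norm.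
by rewrite f0 ?normr0 ?mulr0//; move: xA; rewrite inE.
Qed.

Section lebesgue_rV_theory.
Context {R : realType}.
Local Notation leb := (@lebesgue_measure R).

Definition cube n (L : R) : set 'rV[R]_n := [set x | forall i, `|x 0 i| <= L].

Lemma consrV0 n a (y : 'rV[R]_n) : consrV (a, y) 0 ord0 = a.
Proof. by rewrite /consrV mxE unlift_none. Qed.

Lemma consrV_lift n a (y : 'rV[R]_n) j : consrV (a, y) 0 (lift ord0 j) = y 0 j.
Proof. by rewrite /consrV mxE liftK. Qed.

Lemma measurable_coord_set n (P : 'I_n -> set R) :
  (forall i, measurable (P i)) -> measurable [set x : 'rV[R]_n | forall i, P i (x 0 i)].
Proof.
move=> mP; rewrite (_ : [set _ | _] = \bigcap_(i in [set: 'I_n])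
    ((fun x : 'rV[R]_n => x 0 i) @^-1` P i)); last first.
  by apply/seteqP; split => [x /= h i _|x h i]; [exact: h|exact: h].
apply: fin_bigcap_measurable => // i _; rewrite -[X in measurable X]setTI.
exact: measurable_coord.
Qed.

(** The measure on R^n is defined by iterated products, so that boxes are
    handled by induction on the dimension. *)
Lemma lebesgue_rV_box n (P : 'I_n -> set R) : (forall i, measurable (P i)) ->
  lebesgue_rV n [set x : 'rV[R]_n | forall i, P i (x 0 i)] =
  (\prod_i leb (P i))%E.
Proof.
elim: n P => [|n ih] P mP.
  rewrite big_ord0 /= diracE mem_set//= => -[]//.
rewrite /= /vol_step /pushforward.
rewrite (_ : _ @^-1` _ = P ord0 `*` [set y : 'rV[R]_n | forall i, P (lift ord0 i) (y 0 i)]); last first.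
  apply/seteqP; split => [[a y]/= h|[a y]/= [h1 h2] i].
    split; first by have := h ord0; rewrite consrV0.
    by move=> i; have := h (lift ord0 i); rewrite consrV_lift.
  have [j ->|->] := unliftP ord0 i; first by rewrite consrV_lift.
  by rewrite consrV0.
rewrite product_measure1E; [|exact: mP|]; last first.
  exact: (@measurable_coord_set n (fun i => P (lift ord0 i))).
by rewrite (ih (fun i => P (lift ord0 i)))// big_ord_recl.
Qed.

Lemma measurable_cube n L : measurable (@cube n L).
Proof.
apply: (@measurable_coord_set n (fun=> [set a | `|a| <= L])) => _.
rewrite (_ : [set _ | _] = [set` `[(- L), L]%R])//.
by apply/seteqP; split => x /=; rewrite in_itv/= ler_norml.
Qed.

Lemma lebesgue_rV_cube_fin n L : (lebesgue_rV n (@cube n L) < +oo)%E.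
Proof.
have -> : @cube n L = [set x : 'rV[R]_n | forall i, [set` `[(- L), L]%R] (x 0 i)].
  by apply/seteqP; split => x /= h i; have := h i; rewrite in_itv/= ler_norml.
rewrite (@lebesgue_rV_box n (fun=> [set` `[(- L), L]%R]))//.
rewrite ltey_eq; apply/orP; left; elim/big_ind : _ => //= [x y|i _].
  exact: fin_numM.
by rewrite lebesgue_measure_itv; case: ifP.
Qed.

(** Every nonempty open set contains a box, hence has positive measure. *)
Lemma lebesgue_rV_open_gt0 n (U : set 'rV[R]_n) x : open U -> U x ->
  (0 < lebesgue_rV n U)%E.
Proof.
move=> oU Ux; have /nbhs_ballP[e /= e0 eU] : nbhs x U by exact: open_nbhs_nbhs.
pose P (i : 'I_n) : set R := [set` `](x 0 i - e), (x 0 i + e)[%R].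
have mP i : measurable (P i) by exact: measurable_itv.
have mB : measurable [set y : 'rV[R]_n | forall i, P i (y 0 i)].
  exact: measurable_coord_set.
apply: (@lt_le_trans _ _ (lebesgue_rV n [set y : 'rV[R]_n | forall i, P i (y 0 i)])).
  rewrite lebesgue_rV_box//; elim/big_ind : _ => //= [a b|i _].
    exact: mule_gt0.
  rewrite lebesgue_measure_itv/= lte_fin ifT; first by rewrite -EFinB lte_fin; lra.
  by lra.
apply: le_measure; rewrite ?inE//; first exact: open_measurable_rV.
move=> y /= h; apply: eU; split => // i j; rewrite (ord1 i) /ball /=.
have := h j; rewrite /P/= in_itv/= => /andP[h1 h2].
by rewrite ltr_norml; apply/andP; split; move: h1 h2; lra.
Qed.

(** Bounded (by [M]) functions with support in the cube of half-width [L].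
    The class is stable under slicing and partial integration, which makes
    Fubini's theorem applicable throughout. *)
Definition bcs n (f : 'rV[R]_n -> R) (L M : R) :=
  [/\ measurable_fun setT f, (forall x, `|f x| <= M) &
      forall x, ~ cube L x -> f x = 0].

Lemma bcs_L1 n (f : 'rV[R]_n -> R) L M : bcs f L M -> L1 (lebesgue_rV n) f.
Proof.
move=> [mf fM f0]; apply: (L1_bounded_support _ _ mf fM f0).
  exact: measurable_cube.
exact: lebesgue_rV_cube_fin.
Qed.

(** The analogue of [bcs] on the line, kept apart from [bcs] with [n = 1]
    since the recursion on the dimension peels off coordinates in [R]. *)
Definition bcs1 (f : R -> R) (L M : R) :=
  [/\ measurable_fun setT f, (forall x, `|f x| <= M) &
      forall x, ~ `|x| <= L -> f x = 0].

Lemma bcs1_L1 (f : R -> R) L M : bcs1 f L M -> L1 leb f.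
Proof.
move=> [mf fM f0]; apply: (@L1_bounded_support _ (measurableTypeR R) R leb [set` `[(- L), L]%R] M) => //.
  by rewrite [X in (X < _)%E]lebesgue_measure_itv/=; case: ifP; rewrite ?ltry.
by move=> x h; apply: f0 => h1; apply: h; rewrite /= in_itv/= -ler_norml.
Qed.

Lemma cube_consrV n L a (y : 'rV[R]_n) :
  cube L (consrV (a, y)) <-> `|a| <= L /\ cube L y.
Proof.
split=> [h|[h1 h2] i].
  split; first by have := h ord0; rewrite consrV0.
  by move=> i; have := h (lift ord0 i); rewrite consrV_lift.
have [j ->|->] := unliftP ord0 i; first by rewrite consrV_lift.
by rewrite consrV0.
Qed.

Lemma bcs_slice n (f : 'rV[R]_n.+1 -> R) L M a : bcs f L M ->
  bcs (fun y => f (consrV (a, y))) L M.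
Proof.
move=> [mf fM f0]; split => //.
  apply: (measurableT_comp mf); apply: (measurableT_comp (@measurable_consrV R n)).
  exact: measurable_pair1.
by move=> y h; apply: f0 => /cube_consrV[].
Qed.

Lemma bcs_line n (f : 'rV[R]_n.+1 -> R) L M y : bcs f L M ->
  bcs1 (fun a => f (consrV (a, y))) L M.
Proof.
move=> [mf fM f0]; split => //.
  apply: (measurableT_comp mf); apply: (measurableT_comp (@measurable_consrV R n)).
  exact: measurable_pair2.
by move=> a h; apply: f0 => /cube_consrV[].
Qed.

Lemma bcs_prod_integrable n (f : 'rV[R]_n.+1 -> R) L M : bcs f L M ->
  (leb \x lebesgue_rV n)%E.-integrable setT (EFin \o (f \o @consrV R n)).
Proof.
move=> [mf fM f0]; apply: L1_integrable.
apply: (@L1_bounded_support _ (measurableTypeR R * 'rV[R]_n)%type R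
  (leb \x lebesgue_rV n)%E ([set` `[(- L), L]%R] `*` @cube n L) M).
- by apply: measurableX => //; exact: measurable_cube.
- have mI : measurable ([set` `[(- L), L]%R] : set (measurableTypeR R)) by [].
  have E := product_measure1E leb (lebesgue_rV n) mI (@measurable_cube n L).
  apply: (@le_lt_trans _ _ (leb [set` `[(- L), L]%R] * lebesgue_rV n (@cube n L))%E).
    by rewrite le_eqVlt; apply/orP; left; apply/eqP; exact: E.
  rewrite lte_mul_pinfty//; last exact: lebesgue_rV_cube_fin.
  by rewrite lebesgue_measure_itv/=; case: ifP.
- exact: (measurableT_comp mf (@measurable_consrV R n)).
- by move=> x; exact: fM.
- move=> [a y] h; apply: f0 => /cube_consrV[h1 h2]; apply: h; split => //=.
  by rewrite in_itv/= -ler_norml.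
Qed.

Lemma integral_consrV n (f : 'rV[R]_n.+1 -> R) L M : bcs f L M ->
  (\int[lebesgue_rV n.+1]_x (f x)%:E =
   \int[leb \x lebesgue_rV n]_p (f (consrV p))%:E)%E.
Proof.
move=> bf; have [mf _ _] := bf.
have mf' : measurable_fun setT (EFin \o f) by exact/measurable_EFinP.
have := integral_pushforward (@measurable_consrV R n) mf'
  (bcs_prod_integrable bf) measurableT.
rewrite preimage_setT => h; rewrite -[RHS]h.
by apply: eq_measure_integral => [|? A mA _]; first exact: measurable_consrV.
Qed.

Lemma Rint_Fubini1 n (f : 'rV[R]_n.+1 -> R) L M : bcs f L M ->
  \int[lebesgue_rV n.+1]_x f x =
  \int[leb]_a \int[lebesgue_rV n]_y f (consrV (a, y)).
Proof.
move=> bf; rewrite {1}/Rintegral (integral_consrV bf).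
rewrite -(integral12_prod_meas1 (bcs_prod_integrable bf)) /fubini_F.
congr fine; apply: eq_integral => a _ /=.
by rewrite /Rintegral fineK//; exact: integrable_fin_num (L1_integrable (bcs_L1 (bcs_slice a bf))).
Qed.

Lemma Rint_Fubini2 n (f : 'rV[R]_n.+1 -> R) L M : bcs f L M ->
  \int[lebesgue_rV n.+1]_x f x =
  \int[lebesgue_rV n]_y \int[leb]_a f (consrV (a, y)).
Proof.
move=> bf; rewrite {1}/Rintegral (integral_consrV bf).
rewrite -(integral21_prod_meas1 (bcs_prod_integrable bf)) /fubini_G.
congr fine; apply: eq_integral => a _ /=.
by rewrite /Rintegral fineK//; exact: integrable_fin_num (L1_integrable (bcs1_L1 (bcs_line a bf))).
Qed.

Lemma bcs1_slice_int n (f : 'rV[R]_n.+1 -> R) L M : bcs f L M ->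
  exists M', bcs1 (fun a => \int[lebesgue_rV n]_y f (consrV (a, y))) L M'.
Proof.
move=> bf; have [mf fM f0] := bf.
have bM (a : R) : bcs (fun y : 'rV[R]_n => M * \1_(cube L) y) L (`|M|).
  split => [|x|x]; first by apply: measurable_funM => //; apply: measurable_indic; exact: measurable_cube.
  - by rewrite indicE normrM; case: (_ \in _); rewrite ?normr1 ?mulr1// normr0 mulr0.
  - by move=> h; rewrite indicE memNset// mulr0.
exists (\int[lebesgue_rV n]_y (M * \1_(cube L) y)); split.
- have /measurable_fubini_F mF := bcs_prod_integrable bf.
  rewrite (_ : (fun a => _) = fine \o fubini_F (lebesgue_rV n) (EFin \o (f \o @consrV R n)))//.
  exact: measurableT_comp.
- move=> a; apply: (le_trans (le_normr_Rintegral _ _)) => //.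
    exact: L1_integrable (bcs_L1 (bcs_slice a bf)).
  apply: le_Rint; [|exact: bcs_L1 (bM 0)|].
    have [h1 h2 h3] := bcs_slice a bf.
    apply: (@bcs_L1 _ _ L M); split => [||y h]; [exact: measurableT_comp|by move=> y; rewrite normr_id|].
    by rewrite h3// normr0.
  move=> y; rewrite indicE; have [xA|/negP xA] := boolP (y \in cube L).
    by rewrite mulr1.
  rewrite f0 ?normr0 ?mulr0// => /cube_consrV[_ h]; apply: xA.
  by rewrite inE.
- move=> a h; rewrite -[RHS](Rint0 (lebesgue_rV n)); apply: eq_Rintegral => y _.
  by rewrite f0// => /cube_consrV[].
Qed.

End lebesgue_rV_theory.

(** * Integrals of partial derivatives *)

Section coordinate_calculus.
Context {R : realType}.
Implicit Types n : nat.

Definition C1 n (f : 'rV[R]_n -> R) := continuous f /\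
  forall i, (forall x, derivable f x (delta_mx 0 i)) /\ continuous (partial i f).

Lemma continuous_measurable_rV n (f : 'rV[R]_n -> R) : continuous f ->
  measurable_fun setT f.
Proof.
move=> cf; apply: (measurability _ (RGenOpens.measurableE R)) => //.
move=> _ [_ [a [b ->]] <-]; rewrite setTI; apply: open_measurable_rV.
by apply: open_comp; [move=> x _; exact: cf|exact: interval_open].
Qed.

Lemma line_derivable (V : normedModType R) (f : V -> R) (x v : V) (t : R) :
  derivable f (x + t *: v) v ->
  is_derive t 1 (fun s : R => f (x + s *: v)) ('D_v f (x + t *: v)).
Proof.
have E : (fun h : R => h^-1 *: ((f \o shift (x + t *: v)) (h *: v) - f (x + t *: v))) =
    (fun h : R => h^-1 *: (((fun s : R => f (x + s *: v)) \o shift t) (h *: (1 : R)) - f (x + t *: v))).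
  apply/funext => h /=; congr (_ *: (f _ - _)).
  by rewrite [h *: 1]mulr1 scalerDl addrCA.
by move=> df; split; rewrite /derivable /derive -E.
Qed.

Lemma line_continuous (V : normedModType R) (f : V -> R) (x v : V) :
  continuous f -> continuous (fun s : R => f (x + s *: v)).
Proof.
move=> cf s; apply: (@continuous_comp _ _ _ (fun s : R => x + s *: v) f).
  by apply: cvgD; [exact: cvg_cst|apply: cvgZr_tmp; exact: cvg_id].
exact: cf.
Qed.

Lemma line_FTC (V : normedModType R) (f : V -> R) (x v : V) (a b : R) :
  (forall y, derivable f y v) -> continuous ('D_v f) -> continuous f -> a <= b ->
  f (x + b *: v) - f (x + a *: v) =
  \int[lebesgue_measure]_(s in [set` `[a, b]]) 'D_v f (x + s *: v).
Proof.
move=> df cdf cf; rewrite le_eqVlt => /predU1P[->|ab].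
  by rewrite subrr set_itv1 Rintegral_set1.
have cl := @line_continuous V f x v cf.
have cD : continuous (fun s : R => 'D_v f (x + s *: v)).
  exact: (@line_continuous V (fun y => 'D_v f y : R) x v cdf).
have cDab : {within `[a, b], continuous (fun s : R => 'D_v f (x + s *: v))}.
  exact: continuous_subspaceT.
have dab : derivable_oo_LRcontinuous (fun s : R => f (x + s *: v)) a b.
  split; [|exact: cvg_at_right_filter (cl a)|exact: cvg_at_left_filter (cl b)].
  by move=> s _; have [] := line_derivable (df (x + s *: v)).
have fab : {in `]a, b[, (fun s : R => f (x + s *: v))^`()%classic =1
    (fun s : R => 'D_v f (x + s *: v))}.
  move=> s _; rewrite derive1E.
  by have [_ ->] := line_derivable (df (x + s *: v)).
by have := continuous_FTC2 ab cDab dab fab => /(congr1 fine) /= <-.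
Qed.

Lemma derive_line_eq0 (V : normedModType R) (f : V -> R) (U : set V) (x v : V) :
  open U -> (forall y, U y -> f y = 0) -> U x -> 'D_v f x = 0.
Proof.
move=> oU f0 Ux; rewrite -(derive_cst (0 : R) x v); apply: near_eq_derive.
have : nbhs x U by exact: open_nbhs_nbhs.
by apply: filterS => y /f0 ->.
Qed.

Lemma open_setC_cube n L : open (~` @cube R n L).
Proof.
rewrite openC; rewrite (_ : cube L = \bigcap_(i in [set: 'I_n])
    ((fun x : 'rV[R]_n => x 0 i) @^-1` [set a | `|a| <= L])); last first.
  by apply/seteqP; split => [x h i _|x h i]; [exact: h|exact: h].
apply: closed_bigI => i _; apply: closed_comp.
  by move=> x _; exact: coord_continuous.
rewrite (_ : [set _ | _] = [set` `[(- L), L]%R]); first exact: interval_closed.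
by apply/seteqP; split => a /=; rewrite in_itv/= ler_norml.
Qed.

Lemma partial_cube0 n (f : 'rV[R]_n -> R) L i : (forall x, ~ cube L x -> f x = 0) ->
  forall x, ~ cube L x -> partial i f x = 0.
Proof.
move=> f0 x; rewrite /partial.
have h := @derive_line_eq0 _ f (~` cube L) x (delta_mx 0 i) (@open_setC_cube n L) f0.
exact: h.
Qed.

Lemma compact_cube n L : compact (@cube R n L).
Proof.
apply: bounded_closed_compact; last by rewrite -openC; exact: open_setC_cube.
exists `|L|; split; first exact: num_real.
move=> M LM x xL /=; rewrite [`|x|]mx_normrE.
apply: bigmax_le => [|[i j] _ /=].
  by rewrite (le_trans _ (ltW LM)).
by rewrite (ord1 i) (le_trans (xL j))// (le_trans (ler_norm _))// ltW.
Qed.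

Lemma continuous_bcs n (f : 'rV[R]_n -> R) L : continuous f ->
  (forall x, ~ cube L x -> f x = 0) -> exists2 M, 0 <= M & bcs f L M.
Proof.
move=> cf f0.
have : compact (f @` cube L).
  by apply: continuous_compact; [exact: continuous_subspaceT|exact: compact_cube].
move=> /compact_bounded[M [Mr hM]].
have M0 : 0 <= `|M| + 1 by rewrite addr_ge0.
exists (`|M| + 1) => //; split=> //; first exact: continuous_measurable_rV.
move=> x; have [xL|xL] := pselect (cube L x); last by rewrite f0// normr0.
apply: (hM (`|M| + 1)); last by exists x.
by rewrite (le_lt_trans (ler_norm _))// ltrDl.
Qed.

Lemma consrV_addl n (a h : R) (y : 'rV[R]_n) :
  consrV (a + h, y) = consrV (a, y) + h *: delta_mx 0 ord0.
Proof.
apply/rowP => i; rewrite !mxE; have [j ->|->] := unliftP ord0 i => /=.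
  by rewrite mulr0 addr0.
by rewrite mulr1.
Qed.

Lemma consrV_addr n (a h : R) (y : 'rV[R]_n) j :
  consrV (a, y + h *: delta_mx 0 j) = consrV (a, y) + h *: delta_mx 0 (lift ord0 j).
Proof.
apply/rowP => i; rewrite !mxE; have [k ->|->] := unliftP ord0 i => /=.
  by rewrite !mxE (inj_eq lift_inj).
by rewrite mulr0 addr0.
Qed.

Lemma consrV_continuous n a : continuous (fun y : 'rV[R]_n => consrV (a, y)).
Proof.
move=> y A /nbhs_ballP[e /= e0 eA]; apply/nbhs_ballP; exists e => // z [_ yz].
apply: eA; split => // i j; rewrite (ord1 i).
have [k ->|->] := unliftP ord0 j; last first.
  by rewrite !consrV0; exact: ballxx.
by rewrite !consrV_lift.
Qed.

Let slice_quotient n (f : 'rV[R]_n.+1 -> R) a y j :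
  (fun h : R => h^-1 *: (((fun z => f (consrV (a, z))) \o shift y) (h *: delta_mx 0 j) -
     f (consrV (a, y)))) =
  (fun h : R => h^-1 *: ((f \o shift (consrV (a, y))) (h *: delta_mx 0 (lift ord0 j)) -
     f (consrV (a, y)))).
Proof.
apply/funext => h /=; congr (_ *: (f _ - _)).
by rewrite addrC consrV_addr addrC.
Qed.

Lemma slice_derivable n (f : 'rV[R]_n.+1 -> R) a y j :
  derivable f (consrV (a, y)) (delta_mx 0 (lift ord0 j)) ->
  derivable (fun z => f (consrV (a, z))) y (delta_mx 0 j).
Proof.
by rewrite /derivable -slice_quotient.
Qed.

Lemma slice_partial n (f : 'rV[R]_n.+1 -> R) a y j :
  partial j (fun z => f (consrV (a, z))) y = partial (lift ord0 j) f (consrV (a, y)).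
Proof.
by rewrite /partial /derive slice_quotient.
Qed.

Lemma slice_C1 n (f : 'rV[R]_n.+1 -> R) a : C1 f ->
  C1 (fun y => f (consrV (a, y))).
Proof.
move=> [cf df]; split=> [y|i].
  by apply: (continuous_comp (@consrV_continuous n a y)); exact: cf.
have [d1 c1] := df (lift ord0 i); split=> [y|].
  by apply: slice_derivable.
rewrite (_ : partial i _ = fun y => partial (lift ord0 i) f (consrV (a, y))).
  by move=> y; apply: (continuous_comp (@consrV_continuous n a y)); exact: c1.
by apply/funext => y; rewrite slice_partial.
Qed.

Lemma head_FTC n (f : 'rV[R]_n.+1 -> R) y a b : C1 f -> a <= b ->
  f (consrV (b, y)) - f (consrV (a, y)) =
  \int[lebesgue_measure]_(s in [set` `[a, b]]) partial ord0 f (consrV (s, y)).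
Proof.
move=> [cf df] ab; have [d1 c1] := df ord0.
have E s : consrV (s, y) = consrV (0, y) + s *: delta_mx 0 ord0.
  by rewrite -consrV_addl add0r.
rewrite (E b) (E a) (line_FTC _ d1 c1 cf ab); apply: eq_Rintegral => s _.
by rewrite (E s).
Qed.

(** Integrate first along the line of the derivative, where the fundamental
    theorem of calculus applies; the other coordinates are handled by
    induction on the dimension. *)
Lemma Rint_partial0 n (f : 'rV[R]_n -> R) L j : C1 f ->
  (forall x, ~ cube L x -> f x = 0) ->
  \int[lebesgue_rV n]_x partial j f x = 0.
Proof.
elim: n f j => [|n ih] f j Cf f0; first by case: j.
have [cf df] := Cf; have [d1 c1] := df j.
have [M _ bf] := continuous_bcs c1 (partial_cube0 j f0).
have [k jk|j0] := unliftP ord0 j.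
  rewrite (Rint_Fubini1 bf) -[RHS](Rint0 lebesgue_measure).
  apply: eq_Rintegral => a _; rewrite jk.
  rewrite -[RHS](ih (fun y => f (consrV (a, y))) k); first by apply: eq_Rintegral => y _; rewrite slice_partial.
    exact: slice_C1.
  by move=> y h; apply: f0 => /cube_consrV[].
rewrite (Rint_Fubini2 bf) -[RHS](Rint0 (lebesgue_rV n)).
apply: eq_Rintegral => y _; rewrite j0.
pose K := `|L| + 1; have LK : L < K by rewrite (le_lt_trans (ler_norm _))// ltrDl.
have K0 : 0 < K by rewrite ltr_wpDl.
have vanish s : ~ `|s| <= L -> f (consrV (s, y)) = 0.
  by move=> h; apply: f0 => /cube_consrV[].
have := @head_FTC n f y (- K) K Cf; rewrite !vanish ?subrr; last 2 first.
- by rewrite normrN gtr0_norm// => /(lt_le_trans LK); rewrite ltxx.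
- by rewrite gtr0_norm// => /(lt_le_trans LK); rewrite ltxx.
move=> ->; last by rewrite ge0_cp// ltW.
rewrite [RHS]Rintegral_mkcond; apply: eq_Rintegral => s _.
rewrite patchE; case: ifPn => //; rewrite notin_setE/= in_itv/= -ler_norml => sK.
apply: (partial_cube0 ord0 f0) => /cube_consrV[h _]; apply: sK.
by rewrite (le_trans h)// ltW.
Qed.

End coordinate_calculus.

(** * Rellich's estimate *)

Section oscillation_estimate.
Context {R : realType}.
Local Notation leb := (@lebesgue_measure R).

Definition bmeas d (T : measurableType d) (f : T -> R) :=
  measurable_fun setT f /\ exists K : R, forall x, `|f x| <= K.

Lemma bcs1M (b f : R -> R) L M : bmeas b -> bcs1 f L M ->
  exists M', bcs1 (fun x => b x * f x) L M'.
Proof.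
move=> [mb [K bK]] [mf fM f0]; exists (K * M); split => [|x|x xL].
- exact: measurable_funM.
- by rewrite normrM ler_pM.
- by rewrite f0// mulr0.
Qed.

Lemma bcs1_L2 (f : R -> R) L M : bcs1 f L M -> L2 leb f.
Proof.
move=> bf; have [mf fM _] := bf; apply: L2P => //.
have [M' b2] : exists M', bcs1 (fun x => f x * f x) L M'.
  by apply: bcs1M bf; split => //; exists M.
exact: bcs1_L1 b2.
Qed.

Lemma bcsM n (b f : 'rV[R]_n -> R) L M : bmeas b -> bcs f L M ->
  exists M', bcs (fun x => b x * f x) L M'.
Proof.
move=> [mb [K bK]] [mf fM f0]; exists (K * M); split => [|x|x xL].
- exact: measurable_funM.
- by rewrite normrM ler_pM.
- by rewrite f0// mulr0.
Qed.

Lemma bcs_L2 n (f : 'rV[R]_n -> R) L M : bcs f L M -> L2 (lebesgue_rV n) f.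
Proof.
move=> bf; have [mf fM _] := bf; apply: L2P => //.
have [M' b2] : exists M', bcs (fun x => f x * f x) L M'.
  by apply: bcsM bf; split => //; exists M.
exact: bcs_L1 b2.
Qed.

Lemma bcs_sqr n (f : 'rV[R]_n -> R) L M : bcs f L M ->
  exists M', bcs (fun x => f x ^+ 2) L M'.
Proof.
by move=> bf; have [mf fM _] := bf; apply: bcsM bf; split => //; exists M.
Qed.

Definition cell (a h : R) : R -> R := \1_([set` `[a, (a + h)[%R]).

Lemma cellE a h x : cell a h x = (a <= x < a + h)%R%:R.
Proof. by rewrite /cell indicE mem_setE in_itv. Qed.

Lemma bmeas_cell a h : bmeas (cell a h : measurableTypeR R -> R).
Proof.
split; first by apply: measurable_indic.
by exists 1 => x; rewrite cellE; case: (_ <= _ < _); rewrite ?normr1 ?normr0.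
Qed.

Lemma bcs1_cell a h : exists L, bcs1 (cell a h) L 1.
Proof.
exists (`|a| + `|h|); have [mc _] := bmeas_cell a h; split => // x.
  by rewrite cellE; case: (_ <= _ < _); rewrite ?normr1 ?normr0.
rewrite cellE; case: (boolP (_ <= _ < _)) => // /andP[h1 h2] []; rewrite ler_norml.
have := ler_norm a; have := ler_norm h; have := ler_norm (- a); rewrite normrN.
have := normr_ge0 h; have := normr_ge0 a.
by move=> *; apply/andP; split; lra.
Qed.

Lemma Rint_cell a h : 0 <= h -> \int[leb]_x cell a h x = h.
Proof.
move=> h0; rewrite /Rintegral /cell integral_indic// setIT.
apply: (@congr1 _ _ fine _ h%:E); apply: (eq_trans (lebesgue_measure_itv _)).
rewrite /= lte_fin; case: ltP => [_|]; first by rewrite -EFinB /= addrAC subrr add0r.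
by rewrite gerDl => h1; congr EFin; apply/eqP; rewrite eq_le h0 h1.
Qed.

Lemma sum_cell a h (M : nat) x : 0 < h ->
  \sum_(i < M) cell (a + i%:R * h) h x = cell a (M%:R * h) x.
Proof.
move=> h0; elim: M => [|M ih].
  by rewrite big_ord0 cellE mul0r addr0; case: (leP a x).
rewrite big_ord_recr/= ih !cellE -natr1 mulrDl mul1r addrA.
have M0 : 0 <= M%:R * h by rewrite mulr_ge0// ltW.
case: (leP a x) => ax; case: (ltP x (a + M%:R * h)) => axM; case: (ltP x (a + M%:R * h + h)) => axM1 //=; rewrite ?addr0 ?add0r//.
- by exfalso; lra.
- by exfalso; lra.
Qed.

(** For x in the cell, h * g x differs from the integral of g over the cell
    by at most h * A, where A is the integral of |g'| over the cell, and A^2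
    <= h * int g'^2 by the Cauchy--Schwarz inequality. Then square, using (p
    + q)^2 <= 2 p^2 + 2 q^2. *)
Lemma cell_estimate (g g' : R -> R) L M M' a h : 0 < h ->
  bcs1 g L M -> bcs1 g' L M' ->
  (forall x y, x <= y -> g y - g x = \int[leb]_(s in [set` `[x, y]]) g' s) ->
  \int[leb]_x (cell a h x * g x ^+ 2) <=
  2 / h * (\int[leb]_x (cell a h x * g x)) ^+ 2 +
  2 * h ^+ 2 * \int[leb]_x (cell a h x * g' x ^+ 2).
Proof.
move=> h0 bg bg' ftc; have bc := bmeas_cell a h; have [mc _] := bc.
have [Lc bc1] := bcs1_cell a h.
have c01 x : 0 <= cell a h x <= 1 by rewrite cellE; case: (_ <= _ < _); rewrite ?lexx ?ler01.
have lc : L1 leb (cell a h) by exact: bcs1_L1 bc1.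
have ba : bcs1 (fun x => `|g' x|) L M'.
  have [m1 b1 z1] := bg'; split => [|x|x /z1 ->]; last by rewrite normr0.
    exact: measurableT_comp.
  by rewrite normr_id.
have [Ma bca] := bcs1M bc ba.
have [Mg bcg] := bcs1M bc bg.
pose A := \int[leb]_x (cell a h x * `|g' x|).
pose I := \int[leb]_x (cell a h x * g x).
have A2 : A ^+ 2 <= h * \int[leb]_x (cell a h x * g' x ^+ 2).
  have := Cauchy_Schwarz (bcs1_L2 bc1) (bcs1_L2 bca).
  rewrite (_ : \int[leb]_x (cell a h x * _) = A); last first.
    apply: eq_Rintegral => x _; rewrite mulrA; congr (_ * _).
    by rewrite cellE; case: (_ <= _ < _); rewrite ?mulr1 ?mulr0.
  rewrite (_ : \int[leb]_x (cell a h x ^+ 2) = h); last first.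
    rewrite -[RHS](Rint_cell a (ltW h0)); apply: eq_Rintegral => x _.
    by rewrite cellE; case: (_ <= _ < _); rewrite ?expr1n ?expr0n.
  rewrite (_ : \int[leb]_x ((_ * _) ^+ 2) = \int[leb]_x (cell a h x * g' x ^+ 2))//.
  apply: eq_Rintegral => x _; rewrite exprMn real_normK ?num_real//; congr (_ * _).
  by rewrite cellE; case: (_ <= _ < _); rewrite ?expr1n ?expr0n.
have osc0 x y : x <= y -> a <= x -> y < a + h -> `|g y - g x| <= A.
  move=> xy ax yh; rewrite ftc//.
  have ig' : leb.-integrable [set` `[x, y]] (EFin \o g').
    by apply: integrableS (L1_integrable (bcs1_L1 bg')).
  rewrite (le_trans (le_normr_Rintegral _ ig'))// Rintegral_mkcond.
  have la : L1 leb ((fun s => `|g' s|) \_ [set` `[x, y]]).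
    have [m1 b1 z1] := ba.
    apply: (@bcs1_L1 _ _ L M'); split => [|s|s sL].
    - by apply/(measurable_restrictT _ _).1 => //; exact: measurable_funS m1.
    - rewrite patchE; case: ifP => // _; rewrite normr0.
      by rewrite (le_trans _ (b1 s)).
    - by rewrite patchE; case: ifP => // _; exact: z1.
  apply: le_Rint => //; first exact: bcs1_L1 bca.
  move=> s; rewrite patchE cellE; case: ifPn => [|_]; last by rewrite mulr_ge0.
  rewrite inE/= in_itv/= => /andP[xs sy].
  by rewrite (le_trans ax xs) (le_lt_trans sy yh) mul1r.
have osc x y : a <= x < a + h -> a <= y < a + h -> `|g x - g y| <= A.
  move=> /andP[x1 x2] /andP[y1 y2]; have [xy|/ltW yx] := leP x y.
    by rewrite distrC osc0.
  by rewrite osc0.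
have A0 : 0 <= A by apply: Rintegral_ge0 => x _; rewrite mulr_ge0//; case/andP: (c01 x).
have mean x : a <= x < a + h -> `|h * g x - I| <= h * A.
  move=> xI; rewrite -[in h * g x](Rint_cell a (ltW h0)).
  rewrite mulrC -RintZ// -RintB; [|exact: L1Z|exact: bcs1_L1 bcg].
  have l1 : L1 leb (fun y => g x * cell a h y - cell a h y * g y).
    by apply: L1B; [exact: L1Z|exact: bcs1_L1 bcg].
  rewrite (le_trans (le_normr_Rintegral _ (L1_integrable l1)))//.
  rewrite -[in h * A](Rint_cell a (ltW h0)) mulrC -RintZ//.
  apply: le_Rint; [exact: Lfun_norm|exact: L1Z|].
  move=> y; rewrite (mulrC (g x)) -mulrBr normrM ger0_norm; last by case/andP: (c01 y).
  rewrite mulrC cellE; case: (boolP (a <= y < a + h)) => yI; last by rewrite !mulr0.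
  by rewrite !mulr1; exact: osc.
have [Mgg bcgg] : exists M0, bcs1 (fun x => cell a h x * g x ^+ 2) L M0.
  have bm : bmeas (fun x : measurableTypeR R => cell a h x * g x).
    by have [m1 b1 _] := bcg; split => //; exists Mg.
  have [M1 b1] := bcs1M bm bg.
  by exists M1; rewrite (_ : (fun _ => _) = (fun x => cell a h x * g x * g x))//; apply/funext => x; rewrite expr2 mulrA.
have key : h ^+ 2 * \int[leb]_x (cell a h x * g x ^+ 2) <=
    h * (2 * I ^+ 2 + 2 * (h * A) ^+ 2).
  rewrite -RintZ; last exact: bcs1_L1 bcgg.
  rewrite -[in X in _ <= X * _](Rint_cell a (ltW h0)) mulrC -RintZ//.
  apply: le_Rint; [by apply: L1Z; exact: bcs1_L1 bcgg|exact: L1Z|].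
  move=> x; rewrite cellE; case: (boolP (a <= x < a + h)) => xI; last by rewrite !(mul0r, mulr0).
  rewrite mul1r mulr1; have := mean x xI.
  rewrite ler_norml -subr_ge0 -[X in _ && X]subr_ge0 => /andP[d1 d2].
  by have := mulr_ge0 d1 d2; have := sqr_ge0 (h * g x - 2 * I); clear; lra.
have hn : h != 0 by rewrite gt_eqF.
rewrite -(ler_pM2l (exprn_gt0 2 h0)) (le_trans key)//.
rewrite -[\int[leb]_x (cell a h x * g x)]/I.
have -> : h ^+ 2 * (2 / h * I ^+ 2 + 2 * h ^+ 2 * \int[leb]_x (cell a h x * g' x ^+ 2)) =
   2 * h * I ^+ 2 + 2 * h ^+ 3 * (h * \int[leb]_x (cell a h x * g' x ^+ 2)).
  rewrite mulrDr; congr (_ + _); last by lra.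
  have -> : h ^+ 2 * (2 / h * I ^+ 2) = 2 * h * (h * h^-1) * I ^+ 2.
    by clear; set i := h^-1; lra.
  by rewrite divff// mulr1.
have h3 : 0 <= 2 * h ^+ 3 by rewrite mulr_ge0// exprn_ge0// ltW.
by have := ler_wpM2l h3 A2; clear; lra.
Qed.

(** Sum the cell estimates over a grid of cells that covers the support and
    is fine enough for [2 * h ^+ 2 <= delta]; the factor [2 / h] in front of
    the squared means is absorbed into the weights [c]. *)
Lemma grid_estimate (L delta : R) : 0 < delta ->
  exists (T : finType) (c : T -> R -> R),
    (forall k, bmeas (c k : measurableTypeR R -> R)) /\
    forall g g' M M', bcs1 g L M -> bcs1 g' L M' ->
      (forall x y, x <= y -> g y - g x = \int[leb]_(s in [set` `[x, y]]) g' s) ->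
      \int[leb]_x (g x ^+ 2) <= delta * \int[leb]_x (g' x ^+ 2) +
      \sum_k (\int[leb]_x (c k x * g x)) ^+ 2.
Proof.
move=> delta0; pose K : R := `|L| + 1; have K0 : 0 < K by rewrite ltr_wpDl.
(* with m cells of width h = 2 K / m, this makes 2 h^2 <= delta *)
pose m := (Num.bound (8 * K ^+ 2 / delta)).+1.
have m1 : 1 <= m%:R :> R by rewrite ler1n.
have mge : 8 * K ^+ 2 / delta <= m%:R.
  have x0 : 0 <= 8 * K ^+ 2 / delta by rewrite divr_ge0 ?mulr_ge0 ?sqr_ge0// ltW.
  by rewrite (le_trans (ltW (archi_boundP x0)))// ler_nat.
pose h := 2 * K / m%:R; have m0 : 0 < m%:R :> R by rewrite ltr0n.
have h0 : 0 < h by rewrite divr_gt0// mulr_gt0.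
have hm : m%:R * h = 2 * K by rewrite /h mulrC divfK// gt_eqF.
have hd : 2 * h ^+ 2 <= delta.
  have E : 2 * h ^+ 2 = (8 * K ^+ 2) / m%:R / m%:R.
    by rewrite /h expr2; clear; set i := _^-1; lra.
  rewrite E ler_pdivrMr// (le_trans _ (_ : delta <= _))//; last by rewrite ler_peMr// ltW.
  by rewrite ler_pdivrMr// [delta * _]mulrC -ler_pdivrMr.
exists 'I_m, (fun (k : 'I_m) x => Num.sqrt (2 / h) * cell (- K + k%:R * h) h x); split.
  move=> k; have [mc [b bb]] := bmeas_cell (- K + k%:R * h) h.
  split; first exact: measurable_funM.
  by exists (Num.sqrt (2 / h) * b) => x; rewrite normrM ger0_norm ?sqrtr_ge0// ler_wpM2l// sqrtr_ge0.
move=> g g' M M' bg bg' ftc.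
have [mg gM g0] := bg; have [mg' gM' g0'] := bg'.
have [N bgg] := bcs1M (conj mg (ex_intro _ M gM)) bg.
have [N' bgg'] := bcs1M (conj mg' (ex_intro _ M' gM')) bg'.
have cover (u : R -> R) : (forall x, ~ `|x| <= L -> u x = 0) ->
    forall x, u x ^+ 2 = \sum_(i < m) (cell (- K + i%:R * h) h x * u x ^+ 2).
  move=> u0 x; rewrite -mulr_suml sum_cell// hm cellE.
  have [xL|/u0 ->] := pselect (`|x| <= L); last by rewrite expr0n mulr0.
  (* K = |L| + 1 > L, so the half-open cells cover the support *)
  suff -> : - K <= x < - K + 2 * K by rewrite mul1r.
  move: xL; rewrite ler_norml /K => /andP[]; have := ler_norm L.
  by clear; move=> *; apply/andP; split; lra.
have lcell (u : R -> R) U i : bcs1 (fun x => u x * u x) L U ->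
    L1 leb (fun x => cell (- K + i%:R * h) h x * u x ^+ 2).
  by move=> bu; have [U' /bcs1_L1] := bcs1M (bmeas_cell (- K + i%:R * h) h) bu.
have split_cells (u : R -> R) U : (forall x, ~ `|x| <= L -> u x = 0) ->
    bcs1 (fun x => u x * u x) L U -> \int[leb]_x (u x ^+ 2) =
    \sum_(i < m) \int[leb]_x (cell (- K + i%:R * h) h x * u x ^+ 2).
  move=> u0 bu; rewrite -Rint_sum; last by move=> i _; exact: lcell bu.
  by apply: eq_Rintegral => x _; exact: cover.
rewrite (split_cells _ _ g0 bgg) (split_cells _ _ g0' bgg') mulr_sumr -big_split/=; apply: ler_sum => i _.
rewrite (le_trans (cell_estimate _ h0 bg bg' ftc))// addrC lerD//; last first.
  rewrite ler_wpM2r//; apply: Rintegral_ge0 => x _.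
  by rewrite mulr_ge0 ?sqr_ge0// cellE ler0n.
have lc : L1 leb (fun x => cell (- K + i%:R * h) h x * g x).
  by have [U' /bcs1_L1] := bcs1M (bmeas_cell (- K + i%:R * h) h) bg.
under [in leRHS]eq_Rintegral do rewrite -mulrA.
by rewrite RintZ// exprMn sqr_sqrtr// divr_ge0// ltW.
Qed.

Definition tail n (x : 'rV[R]_n.+1) : 'rV[R]_n := \row_j x 0 (lift ord0 j).

Lemma tail_consrV n a (y : 'rV[R]_n) : tail (consrV (a, y)) = y.
Proof. by apply/rowP => j; rewrite mxE consrV_lift. Qed.

Lemma measurable_tail n : measurable_fun setT (@tail n).
Proof.
apply: measurable_fun_rV => i; under eq_fun do rewrite mxE.
exact: measurable_coord.
Qed.

Lemma bmeas_tensor n (c : R -> R) (b : 'rV[R]_n -> R) :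
  bmeas (c : measurableTypeR R -> R) -> bmeas b ->
  bmeas (fun x : 'rV[R]_n.+1 => c (x 0 ord0) * b (tail x)).
Proof.
move=> [mc [C cC]] [mb [B bB]]; split.
  apply: measurable_funM.
    exact: (measurableT_comp mc (measurable_coord ord0)).
  exact: (measurableT_comp mb (@measurable_tail n)).
by exists (C * B) => x; rewrite normrM ler_pM.
Qed.

Lemma C1_bcs n (f : 'rV[R]_n -> R) L : C1 f -> (forall x, ~ cube L x -> f x = 0) ->
  exists M, bcs f L M /\ forall i, bcs (partial i f) L M.
Proof.
move=> [cf df] f0; have [M0 M00 b0] := continuous_bcs cf f0.
have /choice[M_ bM] i : exists M, 0 <= M /\ bcs (partial i f) L M.
  have [M p0 pM] := continuous_bcs (df i).2 (partial_cube0 i f0).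
  by exists M.
have weak g M M' : M <= M' -> bcs g L M -> @bcs R n g L M'.
  by move=> MM [mg gM g0]; split => // x; rewrite (le_trans (gM x)).
exists (M0 + \sum_i M_ i); split.
  by apply: weak b0; rewrite lerDl sumr_ge0// => i _; case: (bM i).
move=> i; have [_] := bM i; apply: weak.
rewrite (bigD1 i)//= addrCA lerDl addr_ge0// sumr_ge0// => j _.
by case: (bM j).
Qed.

(** By induction on the dimension: apply the estimate to the slices of [f]
    at constant first coordinate, then the one-dimensional one to the
    moments [g j a] of these slices, whose derivatives are moments of the
    first partial derivative of [f]. The weights are products of
    one-dimensional ones. Without a compactness argument, this yields the
    compact embedding of H^1_0 in L^2. *)
Lemma rellich_estimate n (L delta : R) : 0 < delta ->
  exists (T : finType) (b : T -> 'rV[R]_n -> R), (forall k, bmeas (b k)) /\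
    forall f, C1 f -> (forall x, ~ cube L x -> f x = 0) ->
      \int[lebesgue_rV n]_x (f x ^+ 2) <=
      delta * \sum_i \int[lebesgue_rV n]_x (partial i f x ^+ 2) +
      \sum_k (\int[lebesgue_rV n]_x (b k x * f x)) ^+ 2.
Proof.
move=> delta0; elim: n => [|n [T [b [mb hb]]]].
  (* in dimension 0 the measure is a unit mass: f^2 is the square of one moment *)
  exists unit, (fun _ _ => 1); split.
    by move=> _; split => //; exists 1 => x; rewrite normr1.
  move=> f _ _; rewrite big_ord0 mulr0 add0r (bigD1 tt)//= big1 ?addr0; last by case.
  have E (g : 'rV[R]_0 -> R) : \int[dirac (0 : 'rV[R]_0)]_x g x = g 0.
    rewrite (_ : g = cst (g 0)); last first.
      by apply/funext => x; rewrite (thinmx0 x).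
    rewrite Rintegral_cst// (_ : fine _ = 1) ?mulr1//.
    by rewrite -[LHS]/(fine (dirac (0 : 'rV[R]_0) setT)) diracE in_setT.
  by rewrite !E mul1r.
(* squared norms of the weights on the cube: d' compensates for the loss in the Cauchy--Schwarz inequality *)
pose B j := \int[lebesgue_rV n]_y ((b j y * \1_(cube L) y) ^+ 2).
have lB j : exists M, bcs (fun y => b j y * \1_(cube L) y) L M.
  apply: (@bcsM _ _ _ _ 1); first exact: mb.
  split => [|x|x h]; first by apply: measurable_indic; exact: measurable_cube.
    by rewrite indicE; case: (_ \in _); rewrite ?normr1 ?normr0.
  by rewrite indicE memNset.
have B0 j : 0 <= B j by apply: Rintegral_ge0 => x _; exact: sqr_ge0.
pose d' := delta / (1 + \sum_j B j).
have S0 : 0 < 1 + \sum_j B j by rewrite ltr_pwDl// sumr_ge0.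
have d'0 : 0 < d' by rewrite divr_gt0.
have [K [c [mc hc]]] := grid_estimate L d'0.
exists (K * T)%type, (fun p (x : 'rV[R]_n.+1) => c p.1 (x 0 ord0) * b p.2 (tail x)); split.
  by move=> p; exact: bmeas_tensor.
move=> f Cf f0; have [M [bf bdf]] := C1_bcs Cf f0.
have [cf df] := Cf.
pose g j a := \int[lebesgue_rV n]_y (b j y * f (consrV (a, y))).
pose g' j a := \int[lebesgue_rV n]_y (b j y * partial ord0 f (consrV (a, y))).
have btail j : bmeas (fun x : 'rV[R]_n.+1 => b j (tail x)).
  have [m1 [k1 h1]] := mb j; split; last by exists k1.
  exact: (measurableT_comp m1 (@measurable_tail n)).
have bfj j u M0 : bcs u L M0 -> exists M', bcs1 (fun a => \int[lebesgue_rV n]_y (b j y * u (consrV (a, y)))) L M'.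
  move=> bu; have [M1 h1] := bcsM (btail j) bu.
  have [M2 [h2 h3 h4]] := bcs1_slice_int h1; exists M2; split.
  - by move: h2; under eq_fun do under eq_Rintegral do rewrite tail_consrV.
  - by move=> a; have := h3 a; under eq_Rintegral do rewrite tail_consrV.
  - by move=> a h; have := h4 a h; under eq_Rintegral do rewrite tail_consrV.
have bg j := bfj j _ _ bf.
have bg' j := bfj j _ _ (bdf ord0).
(* the derivative of a moment is the moment of the derivative *)
have ftc j x z : x <= z ->
    g j z - g j x = \int[lebesgue_measure]_(s in [set` `[x, z]]) g' j s.
  move=> xz; rewrite /g -RintB; last 2 first.
  - have [M1 h1] := bcsM (btail j) bf.
    by have := bcs_L1 (bcs_slice z h1); under eq_fun do rewrite tail_consrV.
  - have [M1 h1] := bcsM (btail j) bf.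
    by have := bcs_L1 (bcs_slice x h1); under eq_fun do rewrite tail_consrV.
  have mI : bmeas (\1_([set` `[x, z]]) : measurableTypeR R -> R).
    split; first by apply: measurable_indic.
    by exists 1 => s; rewrite indicE; case: (_ \in _); rewrite ?normr1 ?normr0.
  have [M1 h1] := bcsM (bmeas_tensor mI (mb j)) (bdf ord0).
  rewrite [RHS]Rintegral_mkcond.
  transitivity (\int[lebesgue_rV n.+1]_w ((\1_([set` `[x, z]]) (w 0 ord0) * b j (tail w)) * partial ord0 f w)).
    rewrite (Rint_Fubini2 h1); apply: eq_Rintegral => y _.
    rewrite -mulrBr (head_FTC y Cf xz) Rintegral_mkcond.
    under [RHS]eq_Rintegral do rewrite consrV0 tail_consrV mulrAC mulrC.
    rewrite RintZ; last first.
      have [M2 h2] := bcs1M mI (bcs_line y (bdf ord0)).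
      exact: bcs1_L1 h2.
    congr (_ * _); apply: eq_Rintegral => s _.
    by rewrite patchE indicE; case: ifP => _; rewrite ?mul1r ?mul0r.
  rewrite (Rint_Fubini1 h1); apply: eq_Rintegral => s _.
  rewrite patchE; under eq_Rintegral do rewrite consrV0 tail_consrV -mulrA.
  rewrite RintZ; last first.
    have [M2 h2] := bcsM (btail j) (bdf ord0).
    by have := bcs_L1 (bcs_slice s h2); under eq_fun do rewrite tail_consrV.
  by rewrite indicE; case: ifP => _; rewrite ?mul1r ?mul0r.
have hgj j := bg j; have {}hgj j : \int[leb]_a (g j a ^+ 2) <=
    d' * (B j * \int[lebesgue_rV n.+1]_x (partial ord0 f x ^+ 2)) +
    \sum_k (\int[lebesgue_rV n.+1]_x (c k (x 0 ord0) * b j (tail x) * f x)) ^+ 2.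
  have [M1 h1] := bg j; have [M2 h2] := bg' j.
  rewrite (le_trans (hc _ _ _ _ h1 h2 (ftc j)))// lerD//.
    rewrite ler_pM2l//.
    have [Ms hs] := bcs_sqr (bdf ord0).
    rewrite (Rint_Fubini1 hs) -RintZ; last first.
      by have [M3 /bcs1_L1] := bcs1_slice_int hs.
    apply: le_Rint.
    - by apply: L2_sqr; exact: bcs1_L2 h2.
    - by apply: L1Z; have [M3 /bcs1_L1] := bcs1_slice_int hs.
    move=> a; have [MB hB] := lB j.
    have := Cauchy_Schwarz (bcs_L2 hB) (bcs_L2 (bcs_slice a (bdf ord0))).
    congr (_ <= _); congr (_ ^+ 2); apply: eq_Rintegral => y _.
    have [_ _ z] := bdf ord0.
    have [yL|yL] := pselect (cube L y); first by rewrite indicE mem_set// mulr1.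
    by rewrite z ?mulr0// => /cube_consrV[].
  apply: ler_sum => k _; rewrite le_eqVlt; apply/orP; left; apply/eqP.
  congr (_ ^+ 2).
  have [M3 h3] := bcsM (bmeas_tensor (mc k) (mb j)) bf.
  rewrite (Rint_Fubini1 h3); apply: eq_Rintegral => a _.
  under [RHS]eq_Rintegral do rewrite consrV0 tail_consrV -mulrA.
  rewrite RintZ//.
  have [M4 h4] := bcsM (btail j) bf.
  by have := bcs_L1 (bcs_slice a h4); under eq_fun do rewrite tail_consrV.
have [Mf hf] := bcs_sqr bf.
have lsl : L1 leb (fun a => \int[lebesgue_rV n]_y (f (consrV (a, y)) ^+ 2)).
  by have [M3 /bcs1_L1] := bcs1_slice_int hf.
have lpart i : L1 leb (fun a => \int[lebesgue_rV n]_y (partial i f (consrV (a, y)) ^+ 2)).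
  by have [Mi hi] := bcs_sqr (bdf i); have [M3 /bcs1_L1] := bcs1_slice_int hi.
have step : \int[lebesgue_rV n.+1]_x (f x ^+ 2) <=
   delta * \sum_(i < n) \int[lebesgue_rV n.+1]_x (partial (lift ord0 i) f x ^+ 2) +
   \sum_j \int[leb]_a (g j a ^+ 2).
  rewrite (Rint_Fubini1 hf).
  rewrite (eq_bigr (fun i => \int[leb]_a \int[lebesgue_rV n]_y (partial (lift ord0 i) f (consrV (a, y)) ^+ 2))); last first.
    by move=> i _; have [Mi hi] := bcs_sqr (bdf (lift ord0 i)); rewrite (Rint_Fubini1 hi).
  have l1 : L1 leb (fun a => delta * \sum_(i < n) \int[lebesgue_rV n]_y (partial (lift ord0 i) f (consrV (a, y)) ^+ 2)).
    by apply: L1Z; apply: L1_sum => i _; exact: lpart.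
  have l2 : L1 leb (fun a => \sum_j g j a ^+ 2).
    by apply: L1_sum => j _; have [M1 h1] := bg j; apply: L2_sqr; exact: bcs1_L2 h1.
  have E1 : \int[leb]_a (delta * \sum_(i < n) \int[lebesgue_rV n]_y (partial (lift ord0 i) f (consrV (a, y)) ^+ 2)) =
      delta * \sum_(i < n) \int[leb]_a \int[lebesgue_rV n]_y (partial (lift ord0 i) f (consrV (a, y)) ^+ 2).
    rewrite RintZ; last by apply: L1_sum => i _; exact: lpart.
    by rewrite Rint_sum// => i _; exact: lpart.
  have E2 : \int[leb]_a (\sum_j g j a ^+ 2) = \sum_j \int[leb]_a (g j a ^+ 2).
    rewrite Rint_sum// => j _; have [M1 h1] := bg j; apply: L2_sqr.
    exact: bcs1_L2 h1.
  rewrite -E1 -E2 -RintD//; apply: le_Rint => //; first exact: L1D.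
  move=> a.
  have sl0 y : ~ cube L y -> f (consrV (a, y)) = 0.
    by move=> h; apply: f0 => /cube_consrV[].
  have H := hb _ (slice_C1 a Cf) sl0.
  have E3 i : \int[lebesgue_rV n]_y (partial i (fun z => f (consrV (a, z))) y ^+ 2) =
      \int[lebesgue_rV n]_y (partial (lift ord0 i) f (consrV (a, y)) ^+ 2).
    by apply: eq_Rintegral => y _; rewrite slice_partial.
  rewrite (eq_bigr _ (fun i _ => E3 i)) in H.
  exact: H.
pose D0 := \int[lebesgue_rV n.+1]_x (partial ord0 f x ^+ 2).
have D00 : 0 <= D0 by apply: Rintegral_ge0 => x _; exact: sqr_ge0.
pose S k j := (\int[lebesgue_rV n.+1]_x (c k (x 0 ord0) * b j (tail x) * f x)) ^+ 2.
have fin : \sum_j \int[leb]_a (g j a ^+ 2) <= delta * D0 + \sum_p S p.1 p.2.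
  apply: (le_trans (ler_sum _ (fun j _ => hgj j))).
  rewrite big_split/= [X in _ + X <= _]exchange_big/= (pair_bigA _ S) lerD2r.
  rewrite -mulr_sumr -mulr_suml mulrA ler_wpM2r//.
  by rewrite /d' mulrAC ler_pdivrMr// ler_pM2l// lerDr.
apply: (le_trans step); apply: (le_trans (lerD (lexx _) fin)).
by rewrite big_ord_recl mulrDr addrCA addrA.
Qed.

End oscillation_estimate.

(** * Smooth functions *)

Section smooth_functions.
Context {R : realType}.

Lemma continuous_add (T : topologicalType) (f g : T -> R) :
  continuous f -> continuous g -> continuous (fun x => f x + g x).
Proof. by move=> cf cg x; apply: cvgD; [exact: cf|exact: cg]. Qed.

Lemma continuous_mul (T : topologicalType) (f g : T -> R) :
  continuous f -> continuous g -> continuous (fun x => f x * g x).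
Proof. by move=> cf cg x; apply: cvgM; [exact: cf|exact: cg]. Qed.

Section closure.
Variable n : nat.
Implicit Types f g : 'rV[R]_n -> R.

(** Smoothness is quantified over all sequences of partial derivatives;
    closure under products needs an induction on their length, hence this
    bounded version. *)
Definition smooth_upto m f := forall s : seq 'I_n, (size s <= m)%N ->
  continuous (foldr partial f s) /\
  forall i x, derivable (foldr partial f s) x (delta_mx 0 i).

Lemma smooth_uptoP f : smooth f <-> forall m, smooth_upto m f.
Proof. by split=> [h m s _|h s]; [exact: h|exact: (h (size s))]. Qed.

Lemma smooth_uptoW m m' f : (m <= m')%N -> smooth_upto m' f -> smooth_upto m f.
Proof. by move=> mm h s sm; apply: h; exact: leq_trans mm. Qed.

Lemma smooth_upto0 m f : smooth_upto m f ->
  continuous f /\ forall i x, derivable f x (delta_mx 0 i).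
Proof. by move=> /(_ [::]); exact. Qed.

Lemma smooth_upto_order0 f : continuous f ->
  (forall i x, derivable f x (delta_mx 0 i)) -> smooth_upto 0 f.
Proof. by move=> cf df [|//] _. Qed.

Lemma smooth_upto_partial m f i : smooth_upto m.+1 f -> smooth_upto m (partial i f).
Proof.
move=> h s sm; have := h (rcons s i); rewrite size_rcons ltnS foldr_rcons.
exact.
Qed.

(** The last element of the sequence is the derivative taken first. *)
Lemma smooth_uptoS m f : continuous f ->
  (forall i x, derivable f x (delta_mx 0 i)) ->
  (forall i, smooth_upto m (partial i f)) -> smooth_upto m.+1 f.
Proof.
move=> cf df h s; elim/last_ind: s => [//|s i _].
by rewrite size_rcons ltnS foldr_rcons; exact: h.
Qed.

Lemma partialD f g i x : derivable f x (delta_mx 0 i) ->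
  derivable g x (delta_mx 0 i) ->
  partial i (fun y => f y + g y) x = partial i f x + partial i g x.
Proof. by move=> df dg; exact: (deriveD df dg). Qed.

Lemma partialM f g i x : derivable f x (delta_mx 0 i) ->
  derivable g x (delta_mx 0 i) ->
  partial i (fun y => f y * g y) x = f x * partial i g x + g x * partial i f x.
Proof. by move=> df dg; exact: (deriveM df dg). Qed.

Lemma smooth_upto_cst m (a : R) : smooth_upto m (fun=> a).
Proof.
elim: m a => [|m ih] a.
  by case=> // _; split; [exact: cst_continuous|move=> i x; exact: derivable_cst].
apply: smooth_uptoS => [|i x|i]; [exact: cst_continuous|exact: derivable_cst|].
rewrite (_ : partial i _ = fun=> 0); first exact: ih.
by apply/funext => x; exact: derive_cst.
Qed.

Lemma smooth_uptoD m f g : smooth_upto m f -> smooth_upto m g ->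
  smooth_upto m (fun x => f x + g x).
Proof.
elim: m f g => [|m ih] f g hf hg; have [cf df] := smooth_upto0 hf; have [cg dg] := smooth_upto0 hg.
  apply: smooth_upto_order0 => [|i x]; first exact: continuous_add.
  exact: (derivableD (df i x) (dg i x)).
apply: smooth_uptoS => [|i x|i].
- exact: continuous_add.
- exact: (derivableD (df i x) (dg i x)).
- rewrite (_ : partial i _ = fun x => partial i f x + partial i g x).
    by apply: ih; exact: smooth_upto_partial.
  by apply/funext => x; exact: partialD.
Qed.

Lemma smooth_uptoM m f g : smooth_upto m f -> smooth_upto m g ->
  smooth_upto m (fun x => f x * g x).
Proof.
elim: m f g => [|m ih] f g hf hg; have [cf df] := smooth_upto0 hf; have [cg dg] := smooth_upto0 hg.
  apply: smooth_upto_order0 => [|i x]; first exact: continuous_mul.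
  exact: (derivableM (df i x) (dg i x)).
apply: smooth_uptoS => [|i x|i].
- exact: continuous_mul.
- exact: (derivableM (df i x) (dg i x)).
- rewrite (_ : partial i _ = fun x => f x * partial i g x + g x * partial i f x).
    apply: smooth_uptoD; apply: ih; do ?exact: smooth_upto_partial.
      exact: smooth_uptoW hf.
    exact: smooth_uptoW hg.
  by apply/funext => x; exact: partialM.
Qed.

Lemma smooth_cst (a : R) : smooth (fun _ : 'rV[R]_n => a).
Proof. by apply/smooth_uptoP => m; exact: smooth_upto_cst. Qed.

Lemma smoothD f g : smooth f -> smooth g -> smooth (fun x => f x + g x).
Proof.
move=> /smooth_uptoP hf /smooth_uptoP hg; apply/smooth_uptoP => m.
exact: smooth_uptoD.
Qed.

Lemma smoothM f g : smooth f -> smooth g -> smooth (fun x => f x * g x).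
Proof.
move=> /smooth_uptoP hf /smooth_uptoP hg; apply/smooth_uptoP => m.
exact: smooth_uptoM.
Qed.

Lemma smooth_prod (I : Type) (r : seq I) (F : I -> 'rV[R]_n -> R) :
  (forall i, smooth (F i)) -> smooth (fun x => \prod_(i <- r) F i x).
Proof.
move=> h; elim: r => [|i r ih].
  by under eq_fun do rewrite big_nil; exact: smooth_cst.
rewrite (_ : (fun x => _) = fun x => F i x * \prod_(i <- r) F i x).
  exact: (smoothM (h i) ih).
by apply/funext => x; rewrite big_cons.
Qed.

Lemma smooth_sum (I : Type) (r : seq I) (F : I -> 'rV[R]_n -> R) :
  (forall i, smooth (F i)) -> smooth (fun x => \sum_(i <- r) F i x).
Proof.
move=> h; elim: r => [|i r ih].
  by under eq_fun do rewrite big_nil; exact: smooth_cst.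
rewrite (_ : (fun x => _) = fun x => F i x + \sum_(i <- r) F i x).
  exact: (smoothD (h i) ih).
by apply/funext => x; rewrite big_cons.
Qed.

Lemma smooth_partial f i : smooth f -> smooth (partial i f).
Proof. by move=> h s; have := h (rcons s i); rewrite foldr_rcons. Qed.

Lemma smooth_continuous f : smooth f -> continuous f.
Proof. by move=> /(_ [::])[]. Qed.

Lemma smooth_derivable f i x : smooth f -> derivable f x (delta_mx 0 i).
Proof. by move=> /(_ [::])[_]; exact. Qed.

Lemma smooth_partialD f g i x : smooth f -> smooth g ->
  partial i (fun y => f y + g y) x = partial i f x + partial i g x.
Proof. by move=> sf sg; apply: partialD; exact: smooth_derivable. Qed.

Lemma smooth_partialM f g i x : smooth f -> smooth g ->
  partial i (fun y => f y * g y) x = f x * partial i g x + g x * partial i f x.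
Proof. by move=> sf sg; apply: partialM; exact: smooth_derivable. Qed.

Lemma smooth_C1 f : smooth f -> C1 f.
Proof.
move=> sf; split=> [|i]; first exact: smooth_continuous.
split=> [x|]; first exact: smooth_derivable.
exact: (smooth_continuous (smooth_partial i sf)).
Qed.

Lemma coord_is_derive (g : R -> R) i j (x : 'rV[R]_n) (dg : R) :
  is_derive (x 0 j) 1 g dg ->
  is_derive x (delta_mx 0 i) (fun y : 'rV[R]_n => g (y 0 j)) ((i == j)%:R * dg).
Proof.
move=> [dgx dgE].
have E : (fun h : R => h^-1 *: (((fun y : 'rV[R]_n => g (y 0 j)) \o shift x) (h *: delta_mx 0 i) - g (x 0 j))) =
    (fun h : R => (i == j)%:R * (h^-1 *: ((g \o shift (x 0 j)) (h *: (1 : R)) - g (x 0 j)))).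
  apply/funext => h /=; rewrite !mxE eqxx/= eq_sym.
  by case: eqP => _; rewrite ?mul1r// mulr0 add0r subrr scaler0 mul0r.
split; rewrite /derivable /derive /= E.
  by apply: is_cvgM; [exact: is_cvg_cst|exact: dgx].
rewrite -dgE; apply: cvg_lim => //.
by apply: cvgM; [exact: cvg_cst|exact: dgx].
Qed.

Lemma smooth_coord j : smooth (fun x : 'rV[R]_n => x 0 j).
Proof.
apply/smooth_uptoP => -[|m].
  apply: smooth_upto_order0; first exact: coord_continuous.
  by move=> i x; have [] := coord_is_derive i (is_derive_id (x 0 j) 1).
apply: smooth_uptoS => [|i x|i].
- exact: coord_continuous.
- by have [] := coord_is_derive i (is_derive_id (x 0 j) 1).
rewrite (_ : partial i _ = fun=> (i == j)%:R); first exact: smooth_upto_cst.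
apply/funext => x; rewrite /partial.
by have [_ ->] := coord_is_derive i (is_derive_id (x 0 j) 1); rewrite mulr1.
Qed.

Lemma partial_coord i j x : partial i (fun y : 'rV[R]_n => y 0 j) x = (i == j)%:R.
Proof.
rewrite /partial.
by have [_ ->] := coord_is_derive i (is_derive_id (x 0 j) 1); rewrite mulr1.
Qed.

Lemma partial_cst i (a : R) x : partial i (fun _ : 'rV[R]_n => a) x = 0.
Proof. exact: derive_cst. Qed.

Lemma partial_sum (I : Type) (r : seq I) (F : I -> 'rV[R]_n -> R) i x :
  (forall k, smooth (F k)) ->
  partial i (fun y => \sum_(k <- r) F k y) x = \sum_(k <- r) partial i (F k) x.
Proof.
move=> sF; elim: r => [|k r ih].
  rewrite big_nil (_ : (fun y => _) = fun=> 0) ?partial_cst//.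
  by apply/funext => y; rewrite big_nil.
rewrite big_cons -ih -(smooth_partialD _ _ (sF k) (smooth_sum r sF)).
by congr (partial _ _ _); apply/funext => y; rewrite big_cons.
Qed.

End closure.

(** The functions t^-k exp(-1/t), extended by 0 to t <= 0. The derivative of
    each is a combination of two others of the family, so that all of them
    are smooth once all are shown to be differentiable. *)
Definition flat (k : nat) (t : R) : R :=
  if 0 < t then t^-1 ^+ k * expR (- t^-1) else 0.

Lemma flat_ge0 k t : 0 <= flat k t.
Proof.
rewrite /flat; case: ifP => // t0.
by rewrite mulr_ge0 ?expR_ge0// exprn_ge0// invr_ge0 ltW.
Qed.

Lemma flat_gt0 k t : 0 < t -> 0 < flat k t.
Proof.
move=> t0; rewrite /flat t0 mulr_gt0 ?expR_gt0//.
by rewrite exprn_gt0// invr_gt0.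
Qed.

(** The Taylor bound y^(k+1) / (k+1)! <= exp y at y = 1/t: the
    differentiability at 0 only requires decay at a linear rate, for all
    [k]. *)
Lemma flat_le k t : `|flat k t| <= (k.+1)`!%:R * `|t|.
Proof.
rewrite ger0_norm ?flat_ge0// /flat; case: ifPn => [t0|_]; last first.
  by rewrite mulr_ge0.
rewrite gtr0_norm//; set y := t^-1; have y0 : 0 < y by rewrite invr_gt0.
have f0 : 0 < (k.+1)`!%:R :> R by rewrite ltr0n fact_gt0.
have : y ^+ k.+1 <= (k.+1)`!%:R * expR y.
  have := expR_ge1Dxn k (ltW y0); rewrite -ler_pdivrMl// mulrC => h.
  by rewrite (le_trans _ h)// lerDr.
rewrite -[t]invrK -/y expRN => h; have e0 := expR_gt0 y.
by rewrite ler_pdivrMr// mulrAC ler_pdivlMr// -exprSr.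
Qed.

Lemma flat_cvg0 k : flat k t @[t --> (0 : R)^'] --> (0 : R).
Proof.
apply/norm_cvg0P; apply: (@squeeze_cvgr _ _ _ _ (fun=> 0) (fun t => (k.+1)`!%:R * `|t|)).
- by near=> t; rewrite normr_ge0/=; exact: flat_le.
- exact: cvg_cst.
- rewrite -[X in _ --> X](mulr0 (k.+1)`!%:R); apply: cvgM; first exact: cvg_cst.
  rewrite -[X in _ --> X](@normr0 _ R); apply: cvg_norm.
  exact: nbhs_dnbhs.
Unshelve. all: by end_near. Qed.

Lemma is_derive_flat k (t : R) : is_derive t 1 (flat k)
  (flat k.+2 t - k%:R * flat k.+1 t).
Proof.
have [t0|t0|->] := ltgtP t 0.
- rewrite /flat !ltNge (ltW t0)/= mulr0 subrr.
  have d0 : is_derive t 1 (cst (0 : R)) (0 : R) by exact: is_derive_cst.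
  apply: near_eq_is_derive d0.
  near=> s; rewrite /= ltNge ifF//; apply/negbTE; rewrite negbK.
  by apply: ltW; near: s; exact: lt_nbhsl.
- suff d4 : is_derive t 1 (fun s => s^-1 ^+ k * expR (- s^-1)) (flat k.+2 t - k%:R * flat k.+1 t).
    apply: near_eq_is_derive d4.
    by near=> s; rewrite /flat ifT//; near: s; exact: lt_nbhsr.
  have tn0 : t != 0 by rewrite gt_eqF.
  have d1 : is_derive t 1 (fun s : R => s^-1) (- t^-1 ^+ 2).
    by apply: is_derive_eq (is_deriveV tn0 (is_derive_id t 1)) _; rewrite [_ *: _]mulr1 exprVn.
  have d2 : is_derive t 1 (fun s : R => s^-1 ^+ k) ((k%:R * t^-1 ^+ k.-1) *: - t^-1 ^+ 2).
    rewrite (_ : (fun s => _) = (fun s : R => s^-1) ^+ k); first exact: is_deriveX.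
    apply/funext => s; elim: (k) => [//|m ih]; rewrite !exprS.
    by rewrite [RHS]/GRing.mul/= -ih.
  have d3 : is_derive t 1 (fun s : R => expR (- s^-1)) (expR (- t^-1) * t^-1 ^+ 2).
    apply: is_derive1_comp.
    by apply: is_derive_eq (is_deriveN d1) _; rewrite opprK.
  apply: is_derive_eq (is_deriveM d2 d3) _.
  rewrite /flat t0 /= -![_ *: _]/(_ * _).
  by case: k {d2} => [|k]; rewrite ?mul0r ?expr0 !exprS; clear; lra.
- rewrite /flat ltxx mulr0 subrr.
  (* at 0 the difference quotient is the next function of the family *)
  have E : (fun h : R => h^-1 *: ((flat k \o shift 0) (h *: (1 : R)) - flat k 0)) = flat k.+1.
    apply/funext => h /=; rewrite [h *: 1]mulr1 addr0 /flat ltxx subr0.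
    by case: ifP => _; rewrite ?scaler0// exprS -mulrA.
  have c0 := @flat_cvg0 k.+1.
  split; rewrite /derivable /derive -/(flat k) E; first exact: cvgP c0.
  exact: cvg_lim c0.
Unshelve. all: by end_near. Qed.

Lemma flat_continuous k : continuous (flat k).
Proof.
move=> t; apply: differentiable_continuous; apply/derivable1_diffP.
by have [] := is_derive_flat k t.
Qed.

Lemma smooth_flat n j (s c : R) k : smooth (fun x : 'rV[R]_n => flat k (s * x 0 j + c)).
Proof.
have D i x k' : is_derive x (delta_mx 0 i) (fun x : 'rV[R]_n => flat k' (s * x 0 j + c))
    ((i == j)%:R * ((flat k'.+2 (s * x 0 j + c) - k'%:R * flat k'.+1 (s * x 0 j + c)) * s)).
  apply: (coord_is_derive i (g := fun t => flat k' (s * t + c))).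
  apply: (@is_derive1_comp _ (flat k') (fun t => s * t + c)); first exact: is_derive_flat.
  apply: is_derive_eq (is_deriveD (is_deriveZ s (is_derive_id _ _)) (is_derive_cst c _ _)) _.
  by rewrite addr0 [_ *: _]mulr1.
have C k' : continuous (fun x : 'rV[R]_n => flat k' (s * x 0 j + c)).
  move=> x; apply: (@continuous_comp _ _ _ (fun x : 'rV[R]_n => s * x 0 j + c) (flat k')).
    apply: (@continuous_add _ (fun x : 'rV[R]_n => s * x 0 j) (fun=> c)).
      apply: (@continuous_mul _ (fun=> s) (fun x : 'rV[R]_n => x 0 j)).
        exact: cst_continuous.
      exact: coord_continuous.
    exact: cst_continuous.
  exact: flat_continuous.
apply/smooth_uptoP => m; elim: m k => [|m ih] k.
  by apply: smooth_upto_order0; [exact: C|move=> i x; have [] := D i x k].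
apply: smooth_uptoS => [|i x|i]; [exact: C|by have [] := D i x k|].
rewrite (_ : partial i _ = fun x => ((i == j)%:R * s) *
  (flat k.+2 (s * x 0 j + c) + (- k%:R) * flat k.+1 (s * x 0 j + c))).
  apply: smooth_uptoM; first exact: smooth_upto_cst.
  apply: smooth_uptoD; first exact: ih.
  by apply: smooth_uptoM; [exact: smooth_upto_cst|exact: ih].
apply/funext => x; rewrite /partial; have [_ ->] := D i x k.
by clear; lra.
Qed.

(** A product of one flat function for each face of the box of centre [a]
    and half-width [r], written with affine arguments so that [smooth_flat]
    applies. *)
Definition bump n (a : 'rV[R]_n) (r : R) (x : 'rV[R]_n) : R :=
  \prod_j (flat 0 (1 * x 0 j + (r - a 0 j)) * flat 0 (-1 * x 0 j + (r + a 0 j))).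

Lemma smooth_bump n (a : 'rV[R]_n) r : smooth (bump a r).
Proof.
apply: smooth_prod => j; apply: smoothM; exact: smooth_flat.
Qed.

Lemma bump_ge0 n (a : 'rV[R]_n) r x : 0 <= bump a r x.
Proof. by apply: prodr_ge0 => j _; rewrite mulr_ge0// flat_ge0. Qed.

Lemma bump_gt0 n (a : 'rV[R]_n) r : 0 < r -> 0 < bump a r a.
Proof.
move=> r0; apply: prodr_gt0 => j _; rewrite mulr_gt0// flat_gt0//; lra.
Qed.

Lemma bump_eq0 n (a : 'rV[R]_n) (r : R) (x : 'rV[R]_n) : ~ (forall j, `|x 0 j - a 0 j| <= r) ->
  bump a r x = 0.
Proof.
move=> /existsNP[j /negP]; rewrite -ltNge => h.
rewrite /bump (bigD1 j)//= /flat.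
case: ifPn => [h1|_]; last by rewrite !mul0r.
case: ifPn => [h2|_]; last by rewrite mulr0 mul0r.
by exfalso; move: h; rewrite ltNge => /negP; apply; rewrite ler_norml; apply/andP; split; lra.
Qed.

Lemma compact_box n (a : 'rV[R]_n) (r : R) :
  compact [set x : 'rV[R]_n | forall j, `|x 0 j - a 0 j| <= r].
Proof.
have -> : [set x : 'rV[R]_n | forall j, `|x 0 j - a 0 j| <= r] = (fun y => y + a) @` cube r.
  apply/seteqP; split=> [x h|_ [y h <-] j].
    by exists (x - a); [move=> j; rewrite !mxE; exact: h|rewrite subrK].
  by rewrite mxE addrK.
apply: continuous_compact; last exact: compact_cube.
apply: continuous_subspaceT => y A /nbhs_ballP[e /= e0 eA].
apply/nbhs_ballP; exists e => // z [_ yz]; apply: eA; split => // p q.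
by have := yz p q; rewrite /ball/= !mxE [in X in _ -> X]opprD [in X in _ -> X]addrACA subrr addr0.
Qed.

(** The tool for localizing integral inequalities at a point. *)
Lemma exists_bump n (U : set 'rV[R]_n) (a : 'rV[R]_n) : open U -> U a ->
  exists f, [/\ smooth f, forall x, 0 <= f x, 0 < f a &
    exists K, [/\ compact K, K `<=` U & forall x, ~ K x -> f x = 0]].
Proof.
move=> oU Ua; have /nbhs_ballP[e /= e0 eU] : nbhs a U by exact: open_nbhs_nbhs.
have e20 : 0 < e / 2 by rewrite divr_gt0.
exists (bump a (e / 2)); split.
- exact: smooth_bump.
- exact: bump_ge0.
- exact: bump_gt0.
- exists [set x : 'rV[R]_n | forall j, `|x 0 j - a 0 j| <= e / 2]; split.
  + exact: compact_box.
  + move=> x h; apply: eU; split => // i j; rewrite (ord1 i) /ball/= distrC.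
    by rewrite (le_lt_trans (h j))// ltr_pdivrMr// ltr_pMr// ltr1n.
  + by move=> x; exact: bump_eq0.
Qed.

Lemma dist_le_half (p q r e : R) : `|p - r| < e / 2 -> `|q - r| < e / 2 ->
  `|p - q| <= e.
Proof.
move=> pr qr; have -> : p - q = (p - r) - (q - r) by lra.
by rewrite (le_trans (ler_normB _ _))// (splitr e) lerD// ltW.
Qed.

(** The mean value theorem, applied to a difference of [f] in the direction
    [i] and then to its derivative in the direction [j]. The left-hand side
    being symmetric in [i] and [j], so are the second derivatives in the
    limit. *)
Lemma second_difference n (f : 'rV[R]_n -> R) i j (x : 'rV[R]_n) (h : R) :
  smooth f -> 0 < h -> exists c d : R, [/\ 0 < c < h, 0 < d < h &
   f (x + h *: delta_mx 0 i + h *: delta_mx 0 j) - f (x + h *: delta_mx 0 i) -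
   (f (x + h *: delta_mx 0 j) - f x) =
   h ^+ 2 * partial j (partial i f) (x + c *: delta_mx 0 i + d *: delta_mx 0 j)].
Proof.
move=> sf h0.
pose F (s : R) := f (x + h *: delta_mx 0 j + s *: delta_mx 0 i) - f (x + s *: delta_mx 0 i).
have dF (s : R) : is_derive s 1 F (partial i f (x + h *: delta_mx 0 j + s *: delta_mx 0 i) -
    partial i f (x + s *: delta_mx 0 i)).
  by apply: is_deriveB; apply: line_derivable; exact: smooth_derivable.
have cF : {within [set` `[0, h]], continuous F}.
  apply: continuous_subspaceT => s; apply: cvgB.
    by apply: line_continuous; exact: smooth_continuous.
  by apply: line_continuous; exact: smooth_continuous.
have [c] := MVT h0 (fun s _ => dF s) cF.
rewrite in_itv/= subr0 /F !scale0r !addr0 => cI Fc.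
pose G (s : R) := partial i f (x + c *: delta_mx 0 i + s *: delta_mx 0 j).
have dG (s : R) : is_derive s 1 G (partial j (partial i f) (x + c *: delta_mx 0 i + s *: delta_mx 0 j)).
  by apply: line_derivable; apply: smooth_derivable; exact: smooth_partial.
have cG : {within [set` `[0, h]], continuous G}.
  apply: continuous_subspaceT => s; apply: line_continuous.
  by apply: smooth_continuous; exact: smooth_partial.
have [d] := MVT h0 (fun s _ => dG s) cG.
rewrite in_itv/= subr0 /G !scale0r !addr0 => dI Gd.
exists c, d; split => //.
have -> : x + h *: delta_mx 0 i + h *: delta_mx 0 j = x + h *: delta_mx 0 j + h *: delta_mx 0 i by rewrite addrAC.
have := Fc; rewrite (addrAC x (h *: delta_mx 0 j) (c *: _)) Gd => E.
by rewrite E; clear; lra.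
Qed.

(** Second derivatives at two points close to [x] agree by
    [second_difference] in either order, and they are continuous. *)
Lemma partialC n (f : 'rV[R]_n -> R) i j x : smooth f ->
  partial i (partial j f) x = partial j (partial i f) x.
Proof.
move=> sf; apply/eqP; rewrite -subr_eq0 -normr_le0; apply/ler_addgt0Pr => e e0.
rewrite add0r.
have e20 : 0 < e / 2 by rewrite divr_gt0.
have cij : continuous (partial i (partial j f)).
  by apply: smooth_continuous; do 2 apply: smooth_partial.
have cji : continuous (partial j (partial i f)).
  by apply: smooth_continuous; do 2 apply: smooth_partial.
move/cvgrPdist_lt/(_ _ e20): (cij x) => /nbhs_ballP[d1 /= d10 h1].
move/cvgrPdist_lt/(_ _ e20): (cji x) => /nbhs_ballP[d2 /= d20 h2].
pose h := Num.min d1 d2 / 2.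
have m0 : 0 < Num.min d1 d2 by rewrite lt_min d10.
have h0 : 0 < h by rewrite divr_gt0.
have near_x (c d : R) k l : 0 < c < h -> 0 < d < h -> forall d', Num.min d1 d2 <= d' ->
    ball x d' (x + c *: delta_mx 0 k + d *: delta_mx 0 l).
  move=> /andP[c0 ch] /andP[d0 dh] d' hd'.
  have d'0 : 0 < d' by exact: lt_le_trans hd'.
  split => // p q; rewrite (ord1 p) /ball /= !mxE -addrA opprD addrA subrr sub0r normrN.
  rewrite (le_lt_trans (ler_normD _ _))// !eqxx/=.
  have u (b : bool) (t : R) : 0 < t -> `|t * b%:R| <= t.
    by move=> t0; case: b; rewrite ?mulr1 ?mulr0 ?normr0 ?gtr0_norm// ltW.
  apply: (@lt_le_trans _ _ (h + h)); last by rewrite -splitr.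
  by rewrite (@le_lt_trans _ _ (c + d))// ?lerD ?u// ltrD.
have [c [d [cI dI E1]]] := second_difference i j x sf h0.
have [c' [d' [c'I d'I E2]]] := second_difference j i x sf h0.
have hh : h ^+ 2 != 0 by rewrite expf_neq0// gt_eqF.
have E : partial j (partial i f) (x + c *: delta_mx 0 i + d *: delta_mx 0 j) =
    partial i (partial j f) (x + c' *: delta_mx 0 j + d' *: delta_mx 0 i).
  have cancel_h (A B u v : R) : u = h ^+ 2 * A -> v = h ^+ 2 * B -> u = v -> A = B.
    by move=> -> -> /(mulfI hh).
  apply: (cancel_h _ _ _ _ E1 E2).
  by rewrite (addrAC x (h *: delta_mx 0 j) (h *: delta_mx 0 i)); clear; lra.
have m1 : Num.min d1 d2 <= d1 by rewrite ge_min lexx.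
have m2 : Num.min d1 d2 <= d2 by rewrite ge_min lexx orbT.
have b1 := h1 _ (near_x c' d' j i c'I d'I d1 m1).
have b2 := h2 _ (near_x c d i j cI dI d2 m2).
rewrite E in b2; exact: (dist_le_half b1 b2).
Qed.

End smooth_functions.

(** * Sobolev fields: Korn's inequality and compactness *)

Lemma cvg_sum {R : realType} (I : Type) (r : seq I) (u : I -> nat -> R) (l : I -> R) :
  (forall i, u i @ \oo --> l i) ->
  (\sum_(i <- r) u i k) @[k --> \oo] --> \sum_(i <- r) l i.
Proof.
move=> h; elim: r => [|i r ih].
  rewrite big_nil (_ : (fun k => _) = cst 0); first exact: cvg_cst.
  by apply/funext => k; rewrite big_nil.
rewrite big_cons (_ : (fun k => _) = (fun k => u i k + \sum_(j <- r) u j k)).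
  by apply: cvgD; [exact: h|exact: ih].
by apply/funext => k; rewrite big_cons.
Qed.

Lemma cvg_sum0 {R : realType} (I : Type) (r : seq I) (u : I -> nat -> R) :
  (forall i, u i @ \oo --> (0 : R)) ->
  (\sum_(i <- r) u i k) @[k --> \oo] --> (0 : R).
Proof. by move=> h; have := @cvg_sum R I r u (fun=> 0) h; rewrite big1_eq. Qed.

Section matrix_inner_product.
Context {R : realType} {N : nat}.
Implicit Types (A B C : 'M[R]_N) (x y z : 'rV[R]_N).

Lemma ddotE A B : ddot A B = \sum_i \sum_j A i j * B i j.
Proof.
rewrite /ddot /mxtrace exchange_big/=; apply: eq_bigr => j _.
by rewrite mxE; apply: eq_bigr => i _; rewrite mxE.
Qed.

Lemma ddotC A B : ddot A B = ddot B A.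
Proof. by rewrite /ddot -mxtrace_tr trmx_mul trmxK. Qed.

Lemma ddotDl A B C : ddot (A + B) C = ddot A C + ddot B C.
Proof. by rewrite /ddot linearD/= mulmxDl mxtraceD. Qed.

Lemma ddotZl a A B : ddot (a *: A) B = a * ddot A B.
Proof. by rewrite /ddot linearZ/= -scalemxAl mxtraceZ. Qed.

Lemma ddotDr A B C : ddot C (A + B) = ddot C A + ddot C B.
Proof. by rewrite ![ddot C _]ddotC ddotDl. Qed.

Lemma ddotZr a A B : ddot B (a *: A) = a * ddot B A.
Proof. by rewrite ![ddot B _]ddotC ddotZl. Qed.

Lemma ddotBl A B C : ddot (A - B) C = ddot A C - ddot B C.
Proof. by rewrite -scaleN1r ddotDl ddotZl mulN1r. Qed.

Lemma ddotBr A B C : ddot C (A - B) = ddot C A - ddot C B.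
Proof. by rewrite ![ddot C _]ddotC ddotBl. Qed.

Lemma ddot0l A : ddot 0 A = 0.
Proof. by rewrite -(scale0r 0) ddotZl mul0r. Qed.

Lemma ddot_tr A B : ddot A^T B^T = ddot A B.
Proof. by rewrite /ddot trmxK -mxtrace_tr trmx_mul trmxK mxtrace_mulC. Qed.

Lemma ddot_ge0 A : 0 <= ddot A A.
Proof. by rewrite ddotE sumr_ge0// => i _; rewrite sumr_ge0// => j _; rewrite -expr2 sqr_ge0. Qed.

Lemma sym_partT A : (sym_part A)^T = sym_part A.
Proof. by rewrite /sym_part linearZ/= linearD/= trmxK addrC. Qed.

Lemma sym_part_id A : A^T = A -> sym_part A = A.
Proof. by move=> AT; rewrite /sym_part AT; apply/matrixP => i j; rewrite !mxE; lra. Qed.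

Lemma sym_partD A B : sym_part (A + B) = sym_part A + sym_part B.
Proof. by apply/matrixP => i j; rewrite !mxE; lra. Qed.

Lemma sym_partZ a A : sym_part (a *: A) = a *: sym_part A.
Proof. by rewrite /sym_part linearZ/= -scalerDr !scalerA mulrC. Qed.

Lemma sym_partB A B : sym_part (A - B) = sym_part A - sym_part B.
Proof. by rewrite -scaleN1r sym_partD sym_partZ scaleN1r. Qed.

Lemma ddot_sym_part A : 2 * ddot (sym_part A) (sym_part A) = ddot A A + ddot A A^T.
Proof.
rewrite /sym_part ddotZl ddotZr !ddotDl !ddotDr.
by have := ddot_tr A A; have := ddotC A A^T; move=> -> ->; lra.
Qed.

(** Antisymmetric matrices are orthogonal to symmetric ones. *)
Lemma ddot_sym_partr A B : A^T = A -> ddot A (sym_part B) = ddot A B.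
Proof.
move=> AT; rewrite /sym_part ddotZr ddotDr.
by have := ddot_tr A B; rewrite AT => ->; lra.
Qed.

Lemma edot0l x : edot 0 x = 0.
Proof. by rewrite /edot big1// => i _; rewrite mxE mul0r. Qed.

Lemma edot_ge0 x : 0 <= edot x x.
Proof. by rewrite sumr_ge0// => i _; rewrite -expr2 sqr_ge0. Qed.

Lemma edot_eq0 x : edot x x = 0 -> x = 0.
Proof.
move=> /eqP; rewrite /edot psumr_eq0 => [/allP h|i _]; last by rewrite -expr2 sqr_ge0.
apply/rowP => i; rewrite mxE; apply/eqP; rewrite -sqrf_eq0 expr2.
by have := h i; rewrite mem_index_enum => /(_ isT).
Qed.

End matrix_inner_product.

Section L2_cvg_operations.
Context d (T : measurableType d) (R : realType).
Variable mu : {measure set T -> \bar R}.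
Implicit Types f g h : T -> R.

Lemma eq_L2_cvg (f_ g_ : nat -> T -> R) f g : (forall n, f_ n =1 g_ n) -> f =1 g ->
  L2_cvg mu f_ f -> L2_cvg mu g_ g.
Proof.
move=> h /funext ->; rewrite (_ : f_ = g_)//.
by apply/funext => n; apply/funext => x; exact: h.
Qed.

Lemma L2_cvg_le (f_ : nat -> T -> R) f (u : nat -> R) : (forall n, \int[mu]_x ((f_ n x - f x) ^+ 2) <= u n) ->
  u @ \oo --> (0 : R) -> L2_cvg mu f_ f.
Proof.
move=> fu u0; apply: (squeeze_cvgr _ (cvg_cst 0) u0).
near=> n; rewrite fu andbT.
by apply: Rintegral_ge0 => x _; exact: sqr_ge0.
Unshelve. all: by end_near. Qed.

Lemma L2_cvgD (f_ g_ : nat -> T -> R) f g : (forall n, L2 mu (f_ n)) -> (forall n, L2 mu (g_ n)) ->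
  L2 mu f -> L2 mu g -> L2_cvg mu f_ f -> L2_cvg mu g_ g ->
  L2_cvg mu (fun n x => f_ n x + g_ n x) (fun x => f x + g x).
Proof.
move=> lf_ lg_ lf lg cf cg.
apply: (@L2_cvg_le _ _ (fun n => 2 * (\int[mu]_x ((f_ n x - f x) ^+ 2) +
   \int[mu]_x ((g_ n x - g x) ^+ 2)))).
  move=> n; have l1 := L2_sqr (L2B (lf_ n) lf); have l2 := L2_sqr (L2B (lg_ n) lg).
  rewrite -RintD// -RintZ; last exact: L1D.
  apply: le_Rint; [|by apply: L1Z; exact: L1D|].
    by apply: L2_sqr; apply: L2B; exact: L2D.
  move=> x; rewrite -subr_ge0.
  by have := sqr_ge0 ((f_ n x - f x) - (g_ n x - g x)); clear; lra.
rewrite -[X in _ --> X](mulr0 2); apply: cvgM; first exact: cvg_cst.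
by rewrite -[X in _ --> X]addr0; exact: cvgD.
Qed.

Lemma L2_cvg_bounded_mul (M : R) h (f_ : nat -> T -> R) f : measurable_fun setT h ->
  (forall x, `|h x| <= M) -> (forall n, L2 mu (f_ n)) -> L2 mu f ->
  L2_cvg mu f_ f -> L2_cvg mu (fun n x => h x * f_ n x) (fun x => h x * f x).
Proof.
move=> mh hM lf_ lf cf.
apply: (@L2_cvg_le _ _ (fun n => M ^+ 2 * \int[mu]_x ((f_ n x - f x) ^+ 2))).
  move=> n; have l1 := L2_sqr (L2B (lf_ n) lf).
  rewrite -RintZ//; apply: le_Rint; [|exact: L1Z|].
    apply: L2_sqr; apply: L2B; exact: L2_bounded_mul hM _.
  move=> x; rewrite -mulrBr exprMn ler_wpM2r ?sqr_ge0//.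
  rewrite -[h x ^+ 2]real_normK ?num_real// lerXn2r ?nnegrE//.
  exact: le_trans (hM x).
rewrite -[X in _ --> X](mulr0 (M ^+ 2)); apply: cvgM; first exact: cvg_cst.
exact: cf.
Qed.

Lemma L2_cvgZ (a : R) (f_ : nat -> T -> R) f : (forall n, L2 mu (f_ n)) -> L2 mu f ->
  L2_cvg mu f_ f -> L2_cvg mu (fun n x => a * f_ n x) (fun x => a * f x).
Proof.
move=> lf_ lf cf; apply: (@L2_cvg_bounded_mul `|a| (fun=> a)) => //.
Qed.

End L2_cvg_operations.

Section restriction.
Context {R : realType} {N : nat}.
Local Notation E := 'rV[R]_N.
Local Notation M := 'M[R]_N.
Local Notation field := ((E -> E) * (E -> M))%type.
Variables (Om : set E) (oOm : open Om) (L : R).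
Hypothesis OmL : Om `<=` cube L.
Local Notation m := (leb_on oOm).
Local Notation leb := (@lebesgue_rV R N).

(** The measure on the domain and the Lebesgue measure only differ outside
    the domain, where the function vanishes. *)
Lemma leb_on_ge0 (f : E -> \bar R) : measurable_fun setT f -> (forall x, 0 <= f x)%E ->
  (forall x, ~ Om x -> f x = 0)%E ->
  (\int[m]_x f x = \int[leb]_x f x)%E.
Proof.
move=> mf f0 fOm.
have mO := open_measurable_rV oOm.
have mC : measurable (~` Om) by exact: measurableC.
have E1 : (\int[leb]_x f x = \int[measure_add (mrestr leb mO) (mrestr leb mC)]_x f x)%E.
  apply: eq_measure_integral => A mA _.
  apply: (eq_trans _ (esym (measure_addE _ _ _))); rewrite /mrestr.
  by rewrite [LHS](measureDI _ mA mO) addeC setDE.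
rewrite E1 ge0_integral_measure_add//.
rewrite [X in (_ + X)%E](_ : _ = 0%E); last first.
  transitivity (\int[mrestr leb mC]_(x in [set: E]) (cst 0%E x))%E; last exact: integral0.
  apply: ge0_ae_eq_integral => //.
  exists Om; split => //.
    by rewrite -[LHS]/(leb (Om `&` ~` Om)) setICr measure0.
  by move=> x /= h; apply: contrapT => /fOm h'; apply: h => _.
by rewrite adde0; apply: eq_measure_integral.
Qed.

Lemma leb_on_setT : m setT = leb Om.
Proof. by rewrite /leb_on /mrestr setTI. Qed.

Lemma leb_on_fin : (m setT < +oo)%E.
Proof.
rewrite leb_on_setT (le_lt_trans _ (@lebesgue_rV_cube_fin R N L))//.
apply: le_measure; rewrite ?inE//; [exact: open_measurable_rV|exact: measurable_cube].
Qed.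

Lemma L1_leb_on (f : E -> R) : L1 leb f -> (forall x, ~ Om x -> f x = 0) -> L1 m f.
Proof.
move=> lf f0; apply/Lfun1_integrable/integrableP.
have /L1_integrable/integrableP[mf foo] := lf; split => //.
rewrite leb_on_ge0//; first exact: measurableT_comp.
by move=> x /f0 /= ->; rewrite normr0.
Qed.

(** A signed function is treated through [|f| + f] and [|f| - f]. *)
Lemma Rint_leb_on (f : E -> R) : L1 leb f -> (forall x, ~ Om x -> f x = 0) ->
  \int[m]_x f x = \int[leb]_x f x.
Proof.
move=> lf f0.
have la : L1 leb (fun x => `|f x|) by exact: Lfun_norm.
have ge0 (g : E -> R) : L1 leb g -> (forall x, 0 <= g x) ->
    (forall x, ~ Om x -> g x = 0) -> \int[m]_x g x = \int[leb]_x g x.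
  move=> lg g0 gO; congr fine; apply: leb_on_ge0.
  - by apply/measurable_EFinP; exact: L1_measurable lg.
  - by move=> x; rewrite lee_fin.
  - by move=> x /gO ->.
have l1 : L1 leb (fun x => `|f x| + f x) by exact: L1D.
have l2 : L1 leb (fun x => `|f x| - f x) by exact: L1B.
have O1 x : ~ Om x -> `|f x| + f x = 0 by move=> /f0 ->; rewrite normr0 addr0.
have O2 x : ~ Om x -> `|f x| - f x = 0 by move=> /f0 ->; rewrite normr0 subr0.
have E1 := ge0 _ l1 _ O1; have E2 := ge0 _ l2 _ O2.
have lmf : L1 m f by exact: L1_leb_on.
have lma : L1 m (fun x => `|f x|) by exact: Lfun_norm.
rewrite RintD// RintD// in E1; rewrite RintB// RintB// in E2.
have {}E1 : \int[m]_x `|f x| + \int[m]_x f x = \int[leb]_x `|f x| + \int[leb]_x f x.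
  by apply: E1 => x; have := ler_norm (- f x); rewrite normrN; lra.
have {}E2 : \int[m]_x `|f x| - \int[m]_x f x = \int[leb]_x `|f x| - \int[leb]_x f x.
  by apply: E2 => x; have := ler_norm (f x); lra.
by lra.
Qed.

Lemma bounded_L1 (b : R) (f : E -> R) : measurable_fun setT f -> (forall x, `|f x| <= b) -> L1 m f.
Proof.
move=> mf fb; apply: (L1_bounded_support measurableT leb_on_fin mf fb).
by move=> x /(_ I).
Qed.

Lemma bounded_L2 (b : R) (f : E -> R) : measurable_fun setT f -> (forall x, `|f x| <= b) -> L2 m f.
Proof.
move=> mf fb; apply: L2P => //.
apply: (@bounded_L1 (b ^+ 2)) => [|x]; first exact: measurable_funX.
rewrite normrX lerXn2r ?nnegrE//; exact: le_trans (fb x).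
Qed.

Lemma test_function_cube0 f : test_function Om f -> forall x, ~ cube L x -> f x = 0.
Proof.
by move=> [_ [K [_ KO f0]]] x xL; apply: f0 => /KO/OmL.
Qed.

Lemma test_function_Om0 f : test_function Om f -> forall x, ~ Om x -> f x = 0.
Proof. by move=> [_ [K [_ KO f0]]] x xL; apply: f0 => /KO. Qed.

Lemma test_function_bcs f : test_function Om f -> exists b, bcs f L b.
Proof.
move=> tf; have [sf _] := tf.
have [b _ h] := continuous_bcs (smooth_continuous sf) (test_function_cube0 tf).
by exists b.
Qed.

Lemma test_function_bmeas f : test_function Om f ->
  measurable_fun setT f /\ exists b : R, forall x, `|f x| <= b.
Proof. by move=> /test_function_bcs[b [mf fb _]]; split => //; exists b. Qed.

Lemma test_function_L2 f : test_function Om f -> L2 m f.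
Proof. by move=> /test_function_bmeas[mf [b fb]]; exact: bounded_L2 fb. Qed.

Lemma test_function_partial f i : test_function Om f -> test_function Om (partial i f).
Proof.
move=> [sf [K [cK KO f0]]]; split; first exact: smooth_partial.
exists K; split => // x Kx; rewrite /partial.
have oK : open (~` K) by rewrite openC; apply: compact_closed => //; exact: norm_hausdorff.
have h := @derive_line_eq0 _ _ f (~` K) x (delta_mx 0 i) oK f0.
exact: h.
Qed.

Lemma test_functionM f g : test_function Om f -> smooth g ->
  test_function Om (fun x => f x * g x).
Proof.
move=> [sf [K [cK KO f0]]] sg; split; first exact: smoothM.
by exists K; split => // x /f0 ->; rewrite mul0r.
Qed.

Lemma test_functionD f g : test_function Om f -> test_function Om g ->
  test_function Om (fun x => f x + g x).
Proof.
move=> [sf [K [cK KO f0]]] [sg [K' [cK' KO' g0]]]; split; first exact: smoothD.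
exists (K `|` K'); split.
- have := @bigsetU_compact _ bool (fun b => if b then K else K') [:: true; false] xpredT.
  by rewrite !big_cons big_nil setU0; apply => -[].
- by move=> x [/KO|/KO'].
- by move=> x h; rewrite f0 ?g0 ?addr0// => h'; apply: h; [right|left].
Qed.

Lemma test_functionZ a f : test_function Om f -> test_function Om (fun x => a * f x).
Proof.
move=> tf; have := test_functionM tf (@smooth_cst R N a).
by under eq_fun do rewrite mulrC.
Qed.

(** The product of the two functions has compact support, so that the
    integral of its partial derivative vanishes. *)
Lemma test_by_parts f g j : test_function Om f -> smooth g ->
  \int[m]_x (f x * partial j g x) = - \int[m]_x (partial j f x * g x).
Proof.
move=> tf sg; have tfg := test_functionM tf sg.
have t1 := test_functionM tf (smooth_partial j sg).
have t2 := test_functionM (test_function_partial j tf) sg.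
have lL1 h : test_function Om h -> L1 leb h.
  by move=> /test_function_bcs[b /bcs_L1].
rewrite !Rint_leb_on//; [|exact: lL1|exact: test_function_Om0|exact: lL1|exact: test_function_Om0].
apply/eqP; rewrite -subr_eq0 opprK -RintD//; [|exact: lL1|exact: lL1].
rewrite -(Rint_partial0 j (smooth_C1 tfg.1) (test_function_cube0 tfg)).
apply/eqP; apply: eq_Rintegral => x _.
rewrite partialM//; first by rewrite [_ * g x]mulrC.
  exact: smooth_derivable tf.1.
exact: smooth_derivable.
Qed.

Lemma L2_ddot (F G : E -> M) : L2_matrix oOm F -> L2_matrix oOm G ->
  L1 m (fun x => ddot (F x) (G x)).
Proof.
move=> hF hG; under eq_fun do rewrite ddotE.
by apply: L1_sum => i _; apply: L1_sum => j _; exact: (L2M (hF i j) (hG i j)).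
Qed.

Lemma Rint_ddot (F G : E -> M) : L2_matrix oOm F -> L2_matrix oOm G ->
  \int[m]_x ddot (F x) (G x) = \sum_i \sum_j \int[m]_x (F x i j * G x i j).
Proof.
move=> hF hG; under eq_Rintegral do rewrite ddotE.
have l i j := L2M (hF i j) (hG i j).
rewrite Rint_sum => [|i _]; last by apply: L1_sum => j _; exact: l.
by apply: eq_bigr => i _; rewrite Rint_sum// => j _; exact: l.
Qed.

Lemma L2_edot (f g : E -> E) : L2_field oOm f -> L2_field oOm g ->
  L1 m (fun x => edot (f x) (g x)).
Proof. by move=> hf hg; apply: L1_sum => i _; exact: (L2M (hf i) (hg i)). Qed.

Lemma Rint_edot (f g : E -> E) : L2_field oOm f -> L2_field oOm g ->
  \int[m]_x edot (f x) (g x) = \sum_i \int[m]_x (f x 0 i * g x 0 i).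
Proof.
by move=> hf hg; rewrite Rint_sum// => i _; exact: (L2M (hf i) (hg i)).
Qed.

(** The squared H^1 norm split into its components, in which convergence is
    easier to establish. *)
Definition sqn (v : field) : R := \sum_i \int[m]_x (v.1 x 0 i ^+ 2) +
  \sum_i \sum_j \int[m]_x (v.2 x i j ^+ 2).

Lemma H1_sqnormE (v : field) : L2_field oOm v.1 -> L2_matrix oOm v.2 ->
  H1_sqnorm oOm v = (sqn v)%:E.
Proof.
move=> h1 h2; have l1 := L2_edot h1 h1; have l2 := L2_ddot h2 h2.
have E0 : \int[m]_x (edot (v.1 x) (v.1 x) + ddot (v.2 x) (v.2 x)) = sqn v.
  by rewrite RintD// Rint_edot// Rint_ddot.
rewrite -E0 /Rintegral fineK//.
exact: integrable_fin_num (L1_integrable (L1D l1 l2)).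
Qed.

Lemma sqn_ge_field (v : field) i : \int[m]_x (v.1 x 0 i ^+ 2) <= sqn v.
Proof.
have p f : 0 <= \int[m]_x (f x ^+ 2) by apply: Rintegral_ge0 => x _; exact: sqr_ge0.
rewrite /sqn (bigD1 i)//= -addrA lerDl addr_ge0// sumr_ge0// => k _.
by rewrite sumr_ge0.
Qed.

Lemma sqn_ge_grad (v : field) i j : \int[m]_x (v.2 x i j ^+ 2) <= sqn v.
Proof.
have p f : 0 <= \int[m]_x (f x ^+ 2) by apply: Rintegral_ge0 => x _; exact: sqr_ge0.
rewrite /sqn; apply: ler_wpDl; first by rewrite sumr_ge0.
rewrite (bigD1 i)//=; apply: ler_wpDr; first by rewrite sumr_ge0// => k _; rewrite sumr_ge0.
by rewrite (bigD1 j)//=; apply: ler_wpDr; first by rewrite sumr_ge0.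
Qed.

Lemma test_field_L2 (phi : E -> E) : test_field Om phi -> L2_field oOm phi.
Proof. by move=> h i; exact: test_function_L2. Qed.

Lemma test_field_L2_grad (phi : E -> E) : test_field Om phi ->
  L2_matrix oOm (jacobian_field phi).
Proof.
move=> h i j; rewrite (_ : (fun x => _) = partial j (fun y => phi y 0 i)).
  by apply: test_function_L2; exact: test_function_partial.
by apply/funext => x; rewrite mxE.
Qed.

Lemma jacobianE (phi : E -> E) x i j :
  jacobian_field phi x i j = partial j (fun y => phi y 0 i) x.
Proof. by rewrite mxE. Qed.

Lemma weak_gradient_test (phi : E -> E) : test_field Om phi ->
  weak_gradient oOm phi (jacobian_field phi).
Proof.
move=> h i j psi tpsi; under [in RHS]eq_Rintegral do rewrite jacobianE.
exact: (test_by_parts j (h i) tpsi.1).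
Qed.

Lemma H1_test (phi : E -> E) : test_field Om phi -> H1 oOm (classical_field phi).
Proof.
move=> h; split => /=; [exact: test_field_L2|exact: test_field_L2_grad|].
exact: weak_gradient_test.
Qed.

Lemma H1_lin a (v w : field) : H1 oOm v -> H1 oOm w -> H1 oOm (a *: v + w).
Proof.
move=> [v1 v2 v3] [w1 w2 w3]; split => /=.
- move=> i; have := L2D (L2Z a (v1 i)) (w1 i).
  by congr (_ \in Lfun _ _); apply/funext => x; rewrite !mxE.
- move=> i j; have := L2D (L2Z a (v2 i j)) (w2 i j).
  by congr (_ \in Lfun _ _); apply/funext => x; rewrite !mxE.
- move=> i j psi tpsi; have lp := test_function_L2 tpsi.
  have lp' := test_function_L2 (test_function_partial j tpsi).
  have q1 := L2M (v1 i) lp'; have q2 := L2M (w1 i) lp'.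
  have q3 := L2M (v2 i j) lp; have q4 := L2M (w2 i j) lp.
  transitivity (a * \int[m]_x (v.1 x 0 i * partial j psi x) + \int[m]_x (w.1 x 0 i * partial j psi x)).
    rewrite -RintZ// -RintD//; last exact: L1Z.
    by apply: eq_Rintegral => x _; rewrite !mxE mulrDl mulrA.
  rewrite (v3 i j psi tpsi) (w3 i j psi tpsi) mulrN -opprD; congr (- _).
  rewrite -RintZ// -RintD//; last exact: L1Z.
  by apply: eq_Rintegral => x _; rewrite !mxE mulrDl mulrA.
Qed.

(** H^1_0 convergence of test fields, stated for each component of the field
    and of its gradient. *)
Definition test_approx (v : field) (phi : nat -> E -> E) :=
  [/\ forall k, test_field Om (phi k),
      forall i, L2_cvg m (fun k x => phi k x 0 i) (fun x => v.1 x 0 i) &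
      forall i j, L2_cvg m (fun k x => partial j (fun y => phi k y 0 i) x)
                           (fun x => v.2 x i j)].

Lemma H10P v : H10 oOm v <-> H1 oOm v /\ exists phi, test_approx v phi.
Proof.
have sqnB phi : test_field Om phi -> H1 oOm v ->
    H1_sqnorm oOm (classical_field phi - v) = (sqn (classical_field phi - v))%:E.
  move=> h [v1 v2 v3]; apply: H1_sqnormE => /= [i|i j].
    have := L2B (test_field_L2 h i) (v1 i).
    by congr (_ \in Lfun _ _); apply/funext => x; rewrite !mxE.
  have := L2B (test_field_L2_grad h i j) (v2 i j).
  by congr (_ \in Lfun _ _); apply/funext => x; rewrite !mxE.
have E1 (phi : E -> E) i : \int[m]_x ((phi x 0 i - v.1 x 0 i) ^+ 2) =
    \int[m]_x ((classical_field phi - v).1 x 0 i ^+ 2).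
  by apply: eq_Rintegral => x _ /=; rewrite !mxE.
have E2 (phi : E -> E) i j : \int[m]_x ((partial j (fun y => phi y 0 i) x - v.2 x i j) ^+ 2) =
    \int[m]_x ((classical_field phi - v).2 x i j ^+ 2).
  by apply: eq_Rintegral => x _ /=; rewrite !mxE.
split => [[Hv [phi [tphi cphi]]]|[Hv [phi [tphi c1 c2]]]]; split => //; exists phi.
  have c0 : sqn (classical_field (phi k) - v) @[k --> \oo] --> (0 : R).
    move/fine_cvg : cphi; apply: cvg_trans.
    apply: near_eq_cvg; near=> k.
    by rewrite /= sqnB.
  split => // [i|i j].
    apply: (L2_cvg_le _ c0) => k.
    by rewrite E1; exact: sqn_ge_field.
  apply: (L2_cvg_le _ c0) => k.
  by rewrite E2; exact: sqn_ge_grad.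
split => //.
rewrite (_ : (fun k => _) = (fun k => (sqn (classical_field (phi k) - v))%:E)); last first.
  by apply/funext => k; exact: sqnB.
apply: cvg_EFin; first by near=> k.
rewrite (_ : _ \o _ = fun k => \sum_i \int[m]_x ((phi k x 0 i - v.1 x 0 i) ^+ 2) +
  \sum_i \sum_j \int[m]_x ((partial j (fun y => phi k y 0 i) x - v.2 x i j) ^+ 2)).
  rewrite -[X in _ --> X]addr0; apply: cvgD; first by apply: cvg_sum0 => i; exact: c1.
  by apply: cvg_sum0 => i; apply: cvg_sum0 => j; exact: c2.
apply/funext => k /=; congr (_ + _); first by apply: eq_bigr => i _; rewrite E1.
by apply: eq_bigr => i _; apply: eq_bigr => j _; rewrite E2.
Unshelve. all: by end_near. Qed.

Lemma test_field_lin a (phi psi : E -> E) : test_field Om phi -> test_field Om psi ->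
  test_field Om (fun x => a *: phi x + psi x).
Proof.
move=> h1 h2 i; rewrite (_ : (fun x => _) = (fun x => a * phi x 0 i + psi x 0 i)).
  by apply: test_functionD => //; exact: test_functionZ.
by apply/funext => x; rewrite !mxE.
Qed.

Lemma H10_test (phi : E -> E) : test_field Om phi -> H10 oOm (classical_field phi).
Proof.
move=> h; apply/H10P; split; first exact: H1_test.
exists (fun=> phi); split => // [i|i j]; first exact: L2_cvg_cst.
rewrite (_ : (fun x => (classical_field phi).2 x i j) = partial j (fun y => phi y 0 i)).
  exact: L2_cvg_cst.
by apply/funext => x; rewrite jacobianE.
Qed.

Lemma test_partial_L2 (phi : E -> E) i j : test_field Om phi ->
  L2 m (partial j (fun y => phi y 0 i)).
Proof. by move=> h; apply: test_function_L2; exact: test_function_partial. Qed.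

Lemma H10_lin a (v w : field) : H10 oOm v -> H10 oOm w -> H10 oOm (a *: v + w).
Proof.
move=> /H10P[Hv [phi [t1 c1 d1]]] /H10P[Hw [psi [t2 c2 d2]]]; apply/H10P.
have [v1 v2 v3] := Hv; have [w1 w2 w3] := Hw.
split; first exact: H1_lin.
exists (fun k x => a *: phi k x + psi k x); split => [k|i|i j].
- exact: test_field_lin.
- apply: (eq_L2_cvg _ _ (L2_cvgD (fun k => L2Z a (test_field_L2 (t1 k) i))
    (fun k => test_field_L2 (t2 k) i) (L2Z a (v1 i)) (w1 i)
    (L2_cvgZ a (fun k => test_field_L2 (t1 k) i) (v1 i) (c1 i)) (c2 i))).
    by move=> k x; rewrite !mxE.
  by move=> x; rewrite !mxE.
- have lp k := test_partial_L2 i j (t1 k); have lp' k := test_partial_L2 i j (t2 k).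
  apply: (eq_L2_cvg _ _ (L2_cvgD (fun k => L2Z a (lp k)) lp' (L2Z a (v2 i j)) (w2 i j)
    (L2_cvgZ a lp (v2 i j) (d1 i j)) (d2 i j))); last by move=> x; rewrite !mxE.
  move=> k x.
  have E0 : (fun y => (a *: phi k y + psi k y) 0 i) = (fun y => (fun=> a) y * phi k y 0 i + psi k y 0 i).
    by apply/funext => y; rewrite !mxE.
  have s1 := (t1 k i).1; have s2 := (t2 k i).1.
  have s3 := smoothM (@smooth_cst R N a) s1.
  rewrite E0 (smooth_partialD _ _ s3 s2) (smooth_partialM _ _ (@smooth_cst R N a) s1).
  by rewrite partial_cst mulr0 addr0.
Qed.

Lemma H10B (v w : field) : H10 oOm v -> H10 oOm w -> H10 oOm (v - w).
Proof. by move=> hv hw; rewrite -scaleN1r addrC; exact: H10_lin. Qed.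

(** The second component is the gradient given by the product rule. *)
Definition mulf (f : E -> R) (v : field) : field :=
  (fun x => f x *: v.1 x,
   fun x => f x *: v.2 x + \matrix_(i, j) (v.1 x 0 i * partial j f x)).

(** Test the weak gradient of [v] with [f * psi] instead of [psi]. *)
Lemma H1_mulf f v : test_function Om f -> H1 oOm v -> H1 oOm (mulf f v).
Proof.
move=> tf [v1 v2 v3]; have [mf [b fb]] := test_function_bmeas tf.
split => /= [i|i j|i j psi tpsi].
- have := L2_bounded_mul mf fb (v1 i).
  by congr (_ \in Lfun _ _); apply/funext => x; rewrite !mxE.
- have [mf' [b' fb']] := test_function_bmeas (test_function_partial j tf).
  have := L2D (L2_bounded_mul mf fb (v2 i j)) (L2_bounded_mul mf' fb' (v1 i)).
  by congr (_ \in Lfun _ _); apply/funext => x; rewrite !mxE (mulrC (v.1 x 0 i)).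
- have tfpsi := test_functionM tf tpsi.1.
  have tfp := test_functionM (test_function_partial j tf) tpsi.1.
  have l1 := L2M (v2 i j) (test_function_L2 tfpsi).
  have l2 := L2M (v1 i) (test_function_L2 (test_function_partial j tfpsi)).
  have l3 := L2M (v1 i) (test_function_L2 tfp).
  have w3 := v3 i j _ tfpsi.
  transitivity (\int[m]_x (v.1 x 0 i * partial j (fun y => f y * psi y) x) -
    \int[m]_x (v.1 x 0 i * (partial j f x * psi x))).
    rewrite -RintB//; apply: eq_Rintegral => x _; rewrite mxE.
    rewrite (smooth_partialM _ _ tf.1 tpsi.1).
    by move: (partial j f x) (partial j psi x) => p q; clear; lra.
  rewrite w3 -opprD -RintD//; congr (- _); apply: eq_Rintegral => x _.
  by rewrite !mxE; move: (partial j f x) => p; clear; lra.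
Qed.

Lemma H10_mulf f v : test_function Om f -> H10 oOm v -> H10 oOm (mulf f v).
Proof.
move=> tf /H10P[Hv [phi [t1 c1 d1]]]; apply/H10P; split; first exact: H1_mulf.
have [v1 v2 v3] := Hv; have [mf [b fb]] := test_function_bmeas tf.
exists (fun k x => f x *: phi k x); split => [k i|i|i j].
- rewrite (_ : (fun x => _) = (fun x => f x * phi k x 0 i)).
    by apply: test_functionM => //; exact: (t1 k i).1.
  by apply/funext => x; rewrite mxE.
- apply: (eq_L2_cvg _ _ (L2_cvg_bounded_mul mf fb (fun k => test_field_L2 (t1 k) i) (v1 i) (c1 i))).
    by move=> k x; rewrite mxE.
  by move=> x; rewrite mxE.
- have [mf' [b' fb']] := test_function_bmeas (test_function_partial j tf).
  have lp k := test_partial_L2 i j (t1 k).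
  have lq k := test_field_L2 (t1 k) i.
  apply: (eq_L2_cvg _ _ (L2_cvgD (fun k => L2_bounded_mul mf fb (lp k))
    (fun k => L2_bounded_mul mf' fb' (lq k))
    (L2_bounded_mul mf fb (v2 i j)) (L2_bounded_mul mf' fb' (v1 i))
    (L2_cvg_bounded_mul mf fb lp (v2 i j) (d1 i j))
    (L2_cvg_bounded_mul mf' fb' lq (v1 i) (c1 i)))); last first.
    by move=> x; rewrite !mxE (mulrC (v.1 x 0 i)).
  move=> k x.
  have E0 : (fun y => (f y *: phi k y) 0 i) = (fun y => f y * phi k y 0 i).
    by apply/funext => y; rewrite mxE.
  rewrite E0 (smooth_partialM _ _ tf.1 (t1 k i).1).
  by congr (_ + _); exact: mulrC.
Qed.

Definition lin_form (b : E -> E) (T : E -> M) (v : field) : R :=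
  \int[m]_x edot (b x) (v.1 x) + \int[m]_x ddot (T x) (v.2 x).

Lemma Rint_CS (f g : E -> R) : L2 m f -> L2 m g ->
  `|\int[m]_x (f x * g x)| <=
  Num.sqrt (\int[m]_x (f x ^+ 2)) * Num.sqrt (\int[m]_x (g x ^+ 2)).
Proof.
move=> lf lg; rewrite -sqrtr_sqr -sqrtrM; last by apply: Rintegral_ge0 => x _; exact: sqr_ge0.
by rewrite ler_wsqrtr//; exact: Cauchy_Schwarz.
Qed.

(** Densities in L^2 define elements of H^-1; they supply the loads and the
    test functionals to which H-convergence is applied. *)
Lemma Hm1_lin_form b T f : L2_field oOm b -> L2_matrix oOm T ->
  (forall v, H10 oOm v -> f v = lin_form b T v) -> Hm1 oOm f.
Proof.
move=> lb lT fE; split.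
  move=> a v w hv hw; rewrite (fE _ (H10_lin a hv hw)) (fE _ hv) (fE _ hw) /lin_form.
  have [[v1 v2 _] _] := hv; have [[w1 w2 _] _] := hw.
  have e1 := L2_edot lb v1; have e2 := L2_edot lb w1.
  have d1 := L2_ddot lT v2; have d2 := L2_ddot lT w2.
  have -> : \int[m]_x edot (b x) ((a *: v + w).1 x) =
      a * \int[m]_x edot (b x) (v.1 x) + \int[m]_x edot (b x) (w.1 x).
    rewrite -RintZ// -RintD//; last exact: L1Z.
    apply: eq_Rintegral => x _; rewrite /edot mulr_sumr -big_split/=.
    by apply: eq_bigr => i _; rewrite !mxE; clear; lra.
  have -> : \int[m]_x ddot (T x) ((a *: v + w).2 x) =
      a * \int[m]_x ddot (T x) (v.2 x) + \int[m]_x ddot (T x) (w.2 x).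
    rewrite -RintZ// -RintD//; last exact: L1Z.
    apply: eq_Rintegral => x _; rewrite !ddotE mulr_sumr -big_split/=.
    apply: eq_bigr => i _; rewrite mulr_sumr -big_split/=.
    by apply: eq_bigr => j _; rewrite !mxE; clear; lra.
  by lra.
exists (\sum_i Num.sqrt (\int[m]_x (b x 0 i ^+ 2)) +
  \sum_i \sum_j Num.sqrt (\int[m]_x (T x i j ^+ 2))) => v hv.
have [[v1 v2 _] _] := hv; rewrite fE// /H1_norm H1_sqnormE//=.
rewrite /lin_form Rint_edot// Rint_ddot// (le_trans (ler_normD _ _))// mulrDl lerD//.
  rewrite (le_trans (ler_norm_sum _ _ _))// mulr_suml; apply: ler_sum => i _.
  apply: (le_trans (Rint_CS (lb i) (v1 i))).
  by rewrite ler_wpM2l ?sqrtr_ge0// ler_wsqrtr// sqn_ge_field.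
rewrite (le_trans (ler_norm_sum _ _ _))// mulr_suml; apply: ler_sum => i _.
rewrite (le_trans (ler_norm_sum _ _ _))// mulr_suml; apply: ler_sum => j _.
apply: (le_trans (Rint_CS (lT i j) (v2 i j))).
by rewrite ler_wpM2l ?sqrtr_ge0// ler_wsqrtr// sqn_ge_grad.
Qed.

Lemma L2_field0 : L2_field oOm (fun=> 0).
Proof. by move=> i; have := L2_0 m; congr (_ \in Lfun _ _); apply/funext => x; rewrite mxE. Qed.

Lemma L2_matrix0 : L2_matrix oOm (fun=> 0).
Proof. by move=> i j; have := L2_0 m; congr (_ \in Lfun _ _); apply/funext => x; rewrite mxE. Qed.

(** Integrate by parts twice and use the symmetry of second derivatives. *)
Lemma test_partial_swap f g i j : test_function Om f -> test_function Om g ->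
  \int[m]_x (partial j f x * partial i g x) = \int[m]_x (partial i f x * partial j g x).
Proof.
move=> tf tg.
rewrite (test_by_parts i (test_function_partial j tf) tg.1).
rewrite (test_by_parts j (test_function_partial i tf) tg.1).
have -> : partial i (partial j f) = partial j (partial i f).
  by apply/funext => x; exact: partialC tf.1.
by [].
Qed.

Lemma L2_strain v : L2_matrix oOm v.2 -> L2_matrix oOm (strain v).
Proof.
move=> h i j; have := L2Z 2^-1 (L2D (h i j) (h j i)).
by congr (_ \in Lfun _ _); apply/funext => x; rewrite !mxE.
Qed.

(** The cross terms integrate to the square of the divergence, by
    [test_partial_swap], and are thus nonnegative; pass to the limit from
    test fields. *)
Lemma Korn v : H10 oOm v ->
  \int[m]_x ddot (v.2 x) (v.2 x) <= 2 * \int[m]_x ddot (strain v x) (strain v x).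
Proof.
move=> /H10P[[v1 v2 _] [phi [t1 _ d1]]].
have vT : L2_matrix oOm (fun x => (v.2 x)^T).
  by move=> i j; have := v2 j i; congr (_ \in Lfun _ _); apply/funext => x; rewrite mxE.
have ls := L2_strain v2.
have E1 : 2 * \int[m]_x ddot (strain v x) (strain v x) =
    \int[m]_x ddot (v.2 x) (v.2 x) + \int[m]_x ddot (v.2 x) ((v.2 x)^T).
  rewrite -RintZ; last exact: L2_ddot.
  rewrite -RintD; [|exact: L2_ddot|exact: L2_ddot].
  by apply: eq_Rintegral => x _; exact: ddot_sym_part.
rewrite E1 lerDl Rint_ddot//.
have lp k i j := test_partial_L2 i j (t1 k).
have C i j : (\int[m]_x (partial j (fun y => phi k y 0 i) x * partial i (fun y => phi k y 0 j) x)) @[k --> \oo] -->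
    \int[m]_x (v.2 x i j * (v.2 x)^T i j).
  rewrite (_ : \int[m]_x (v.2 x i j * (v.2 x)^T i j) = \int[m]_x (v.2 x i j * v.2 x j i)).
    exact: (L2_cvgM (fun k => lp k i j) (fun k => lp k j i) (v2 i j) (v2 j i) (d1 i j) (d1 j i)).
  by apply: eq_Rintegral => x _; rewrite mxE.
have CC : (\sum_i \sum_j \int[m]_x (partial j (fun y => phi k y 0 i) x * partial i (fun y => phi k y 0 j) x)) @[k --> \oo] -->
    \sum_i \sum_j \int[m]_x (v.2 x i j * (v.2 x)^T i j).
  by apply: cvg_sum => i; apply: cvg_sum => j.
apply: (ler_cvg_to (cvg_cst 0) CC); near=> k.
have ldiv : L2 m (fun x => \sum_i partial i (fun y => phi k y 0 i) x).
  by apply: L2_sum => i _; exact: lp.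
suff -> : \sum_i \sum_j \int[m]_x (partial j (fun y => phi k y 0 i) x * partial i (fun y => phi k y 0 j) x) =
    \int[m]_x ((\sum_i partial i (fun y => phi k y 0 i) x) ^+ 2).
  by apply: Rintegral_ge0 => x _; exact: sqr_ge0.
have l2 i j := L2M (lp k i i) (lp k j j).
transitivity (\int[m]_x (\sum_i \sum_j (partial i (fun y => phi k y 0 i) x * partial j (fun y => phi k y 0 j) x))).
  rewrite Rint_sum => [|i _]; last by apply: L1_sum => j _; exact: l2.
  apply: eq_bigr => i _; rewrite Rint_sum => [|j _]; last exact: l2.
  by apply: eq_bigr => j _; exact: test_partial_swap (t1 k i) (t1 k j).
apply: eq_Rintegral => x _; rewrite expr2 mulr_suml.
by apply: eq_bigr => i _; rewrite mulr_sumr.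
Unshelve. all: by end_near. Qed.

Lemma smooth_test_L1 f : test_function Om f -> L1 leb f.
Proof. by move=> /test_function_bcs[b /bcs_L1]. Qed.

(** The estimate [rellich_estimate] is preserved by H^1_0 limits, as its
    weights are bounded. *)
Lemma H10_rellich_estimate delta : 0 < delta ->
  exists (T : finType) (b : T -> E -> R), (forall k, bmeas (b k)) /\
  forall v, H10 oOm v -> forall i, \int[m]_x (v.1 x 0 i ^+ 2) <=
    delta * \sum_j \int[m]_x (v.2 x i j ^+ 2) +
    \sum_k (\int[m]_x (b k x * v.1 x 0 i)) ^+ 2.
Proof.
move=> delta0; have [T [b [bb est]]] := rellich_estimate N L delta0.
exists T, b; split => // v /H10P[[v1 v2 _] [phi [t1 c1 d1]]] i.
have lp k := test_field_L2 (t1 k) i.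
have lq k j := test_partial_L2 i j (t1 k).
have lb k : L2 m (b k) by have [mb [B bB]] := bb k; exact: bounded_L2 mb bB.
have C1 : \int[m]_x (phi k x 0 i * phi k x 0 i) @[k --> \oo] --> \int[m]_x (v.1 x 0 i * v.1 x 0 i).
  exact: (L2_cvgM lp lp (v1 i) (v1 i) (c1 i) (c1 i)).
have C2 : delta * \sum_j \int[m]_x (partial j (fun y => phi k y 0 i) x * partial j (fun y => phi k y 0 i) x) +
    \sum_t (\int[m]_x (b t x * phi k x 0 i)) ^+ 2 @[k --> \oo] -->
    delta * \sum_j \int[m]_x (v.2 x i j * v.2 x i j) + \sum_t (\int[m]_x (b t x * v.1 x 0 i)) ^+ 2.
  apply: cvgD.
    apply: cvgM; first exact: cvg_cst.
    apply: cvg_sum => j.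
    exact: (L2_cvgM (fun k => lq k j) (fun k => lq k j) (v2 i j) (v2 i j) (d1 i j) (d1 i j)).
  apply: cvg_sum => t.
  have C3 := L2_cvgM (fun=> lb t) lp (lb t) (v1 i) (L2_cvg_cst _ _) (c1 i).
  exact: (cvgM C3 C3).
apply: (ler_cvg_to C1 C2); near=> k.
have tk := t1 k i; have sk := tk.1.
have sq f : test_function Om f -> \int[m]_x (f x * f x) = \int[leb]_x (f x ^+ 2).
  move=> tf; apply: Rint_leb_on; first exact: (smooth_test_L1 (test_functionM tf tf.1)).
  exact: (test_function_Om0 (test_functionM tf tf.1)).
rewrite (sq _ tk).
have -> : \sum_j \int[m]_x (partial j (fun y => phi k y 0 i) x * partial j (fun y => phi k y 0 i) x) =
    \sum_j \int[leb]_x (partial j (fun y => phi k y 0 i) x ^+ 2).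
  by apply: eq_bigr => j _; exact: (sq _ (test_function_partial j tk)).
have -> : \sum_t (\int[m]_x (b t x * phi k x 0 i)) ^+ 2 =
    \sum_t (\int[leb]_x (b t x * phi k x 0 i)) ^+ 2.
  apply: eq_bigr => t _; congr (_ ^+ 2); apply: Rint_leb_on.
    by have [mb [B bB]] := bb t; exact: (L1_bounded_mul mb bB (smooth_test_L1 tk)).
  by move=> x /(test_function_Om0 tk) ->; rewrite mulr0.
exact: (est _ (smooth_C1 sk) (test_function_cube0 tk)).
Unshelve. all: by end_near. Qed.

(** The moments in [H10_rellich_estimate] are elements of H^-1, so that they
    tend to 0 along the sequence, while the gradient term is uniformly
    small. *)
Lemma rellich (w : nat -> field) C : (forall n, H10 oOm (w n)) ->
  (forall n, \int[m]_x ddot ((w n).2 x) ((w n).2 x) <= C) ->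
  (forall f, Hm1 oOm f -> f (w n) @[n --> \oo] --> (0 : R)) ->
  forall i, L2_cvg m (fun n x => (w n).1 x 0 i) (fun=> 0).
Proof.
move=> hw wC w0 i.
have C0 : 0 <= C.
  by apply: (le_trans _ (wC 0%N)); apply: Rintegral_ge0 => x _; exact: ddot_ge0.
apply/cvgrPdist_lt => e e0.
pose delta := e / 2 / (C + 1).
have delta0 : 0 < delta by rewrite divr_gt0 ?divr_gt0// ltr_wpDl.
have [T [b [bb est]]] := H10_rellich_estimate delta0.
have F t : \int[m]_x (b t x * (w n).1 x 0 i) @[n --> \oo] --> (0 : R).
  pose B x : E := b t x *: delta_mx 0 i.
  have lB : L2_field oOm B.
    move=> j; have [mb [K bK]] := bb t; have lb := bounded_L2 mb bK.
    have := L2Z ((j == i)%:R) lb.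
    by congr (_ \in Lfun _ _); apply/funext => x; rewrite !mxE eqxx mulrC.
  apply: (w0 (fun v => \int[m]_x (b t x * v.1 x 0 i))).
  apply: (Hm1_lin_form lB L2_matrix0) => v _.
  rewrite /lin_form [X in _ + X](_ : _ = 0) ?addr0.
    apply: eq_Rintegral => x _; rewrite /edot (bigD1 i)//= big1 ?addr0.
      by rewrite !mxE !eqxx mulr1.
    by move=> j ji; rewrite !mxE eqxx (negbTE ji) mulr0 mul0r.
  rewrite -[RHS](Rint0 m); apply: eq_Rintegral => x _; exact: ddot0l.
have S0 : \sum_t (\int[m]_x (b t x * (w n).1 x 0 i)) ^+ 2 @[n --> \oo] --> (0 : R).
  apply: cvg_sum0 => t; rewrite -(mulr0 0); exact: (cvgM (F t) (F t)).
near=> n.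
have Sn : `|0 - \sum_t (\int[m]_x (b t x * (w n).1 x 0 i)) ^+ 2| < e / 2.
  by near: n; move/cvgrPdist_lt: S0; apply; rewrite divr_gt0.
rewrite sub0r normrN in Sn; rewrite sub0r normrN.
have -> : \int[m]_x (((w n).1 x 0 i - 0) ^+ 2) = \int[m]_x ((w n).1 x 0 i ^+ 2).
  by apply: eq_Rintegral => x _; rewrite subr0.
rewrite ger0_norm; last by apply: Rintegral_ge0 => x _; exact: sqr_ge0.
apply: (le_lt_trans (est _ (hw n) i)).
have G : \sum_j \int[m]_x ((w n).2 x i j ^+ 2) <= C.
  apply: le_trans (wC n); have [[_ w2 _] _] := hw n.
  rewrite Rint_ddot// [leRHS](bigD1 i)//=; apply: ler_wpDr; last exact: lexx.
  rewrite sumr_ge0// => k _; rewrite sumr_ge0// => j _.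
  by apply: Rintegral_ge0 => x _; rewrite -expr2; exact: sqr_ge0.
have G2 : delta * \sum_j \int[m]_x ((w n).2 x i j ^+ 2) <= e / 2.
  apply: (le_trans (ler_wpM2l (ltW delta0) G)); rewrite /delta mulrAC ler_pdivrMr ?ltr_wpDl//.
  by rewrite ler_wpM2l ?lerDl// divr_ge0// ltW.
by move: G2 (le_lt_trans (ler_norm _) Sn) => G2 S2; lra.
Unshelve. all: by end_near. Qed.

End restriction.

(** * The arithmetic mean bound for homogenized tensors *)

Section linear_maps.
Context {R : realType} {N : nat}.
Local Notation M := 'M[R]_N.
Implicit Types (A B : M -> M) (xi eta : M).

Lemma lin_sumE A xi : linear A -> A xi = \sum_i \sum_j xi i j *: A (delta_mx i j).
Proof.
move=> lA.
have A0 : A 0 = 0 by have := lA (-1) 0 0; rewrite scaler0 addr0 scaleN1r addNr.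
have AD u v : A (u + v) = A u + A v by have := lA 1 u v; rewrite !scale1r.
have AZ a u : A (a *: u) = a *: A u by have := lA a u 0; rewrite !addr0 A0 addr0.
rewrite {1}(matrix_sum_delta xi) (big_morph A AD A0); apply: eq_bigr => i _.
by rewrite (big_morph A AD A0); apply: eq_bigr => j _; rewrite AZ.
Qed.

Lemma lin_entry A xi k l : linear A ->
  A xi k l = \sum_i \sum_j A (delta_mx i j) k l * xi i j.
Proof.
move=> lA; rewrite (lin_sumE _ lA) summxE; apply: eq_bigr => i _.
by rewrite summxE; apply: eq_bigr => j _; rewrite mxE mulrC.
Qed.

Lemma lin_sub A xi eta : linear A -> A (xi - eta) = A xi - A eta.
Proof. by move=> lA; have := lA (-1) eta xi; rewrite !scaleN1r [- eta + xi]addrC [- A eta + _]addrC. Qed.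

Lemma linear_mix_tensor A B tau : linear A -> linear B -> linear (mix_tensor A B tau).
Proof.
move=> lA lB a u v; rewrite /mix_tensor lA lB; apply/matrixP => i j; rewrite !mxE; lra.
Qed.

Lemma ddot_mix_tensor A B tau xi eta : ddot (mix_tensor A B tau xi) eta =
  ddot (A xi) eta + tau * (ddot (B xi) eta - ddot (A xi) eta).
Proof. by rewrite /mix_tensor ddotDl ddotZl ddotBl. Qed.

(** Nonnegativity of the quadratic form at [xi - A xi / be] bounds the
    stress by the strain. *)
Lemma elasticity_sqr_le al be A xi : 0 < be -> elasticity_tensor al be A ->
  xi^T = xi -> 0 <= al -> ddot (A xi) (A xi) <= be ^+ 2 * ddot xi xi.
Proof.
move=> be0 [lA sA yA bA] sxi al0.
pose t := be^-1; pose z := xi - t *: A xi.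
have tb : t * be = 1 by rewrite mulVf// gt_eqF.
have sAx := sA _ sxi.
have sz : z^T = z by rewrite /z linearB/= linearZ/= sAx sxi.
have /andP[z1 _] := bA _ sz; have /andP[_ x2] := bA _ sxi; have /andP[_ a2] := bA _ sAx.
have z0 : 0 <= ddot (A z) z by apply: le_trans z1; rewrite mulr_ge0// ddot_ge0.
have AZ a u : A (a *: u) = a *: A u.
  have A0 : A 0 = 0 by have := lA (-1) 0 0; rewrite scaler0 addr0 scaleN1r addNr.
  by have := lA a u 0; rewrite !addr0 A0 addr0.
have E1 : ddot (A z) z = ddot (A xi) xi - 2 * t * ddot (A xi) (A xi) +
    t ^+ 2 * ddot (A (A xi)) (A xi).
  rewrite /z (lin_sub _ _ lA) AZ ddotBl !ddotBr ddotZl ddotZl ddotZr.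
  rewrite (yA _ _ sAx sxi) ddotZr.
  by move: (ddot (A (A xi)) (A xi)) (ddot (A xi) (A xi)) (ddot (A xi) xi) => p q r; clear; lra.
rewrite E1 in z0.
have t0 : 0 < t by rewrite invr_gt0.
have h : t ^+ 2 * ddot (A (A xi)) (A xi) <= t * ddot (A xi) (A xi).
  apply: (le_trans (ler_wpM2l (sqr_ge0 t) a2)).
  by rewrite expr2 mulrA -(mulrA t) tb mulr1.
have h2 : t * ddot (A xi) (A xi) <= be * ddot xi xi by move: z0 h x2; clear; lra.
have := ler_wpM2l (ltW be0) h2.
by rewrite mulrA (mulrC be t) tb mul1r mulrA -expr2.
Qed.

Lemma continuous_sumR (T : topologicalType) (I : Type) (r : seq I) (F : I -> T -> R) :
  (forall i, continuous (F i)) -> continuous (fun x => \sum_(i <- r) F i x).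
Proof.
move=> cF; elim: r => [|i r ih].
  rewrite (_ : (fun x => _) = fun=> 0); first exact: cst_continuous.
  by apply/funext => x; rewrite big_nil.
rewrite (_ : (fun x => _) = fun x => F i x + \sum_(j <- r) F j x).
  exact: continuous_add.
by apply/funext => x; rewrite big_cons.
Qed.

Lemma continuous_quadratic (T : topologicalType) A (e : T -> M) : linear A ->
  (forall i j, continuous (fun x => e x i j)) -> continuous (fun x => ddot (A (e x)) (e x)).
Proof.
move=> lA ce; rewrite (_ : (fun x => _) = fun x => \sum_i \sum_j
   (\sum_k \sum_l A (delta_mx k l) i j * e x k l) * e x i j).
  apply: continuous_sumR => i; apply: continuous_sumR => j.
  apply: continuous_mul => //; apply: continuous_sumR => k; apply: continuous_sumR => l.
  by apply: continuous_mul => //; exact: cst_continuous.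
apply/funext => x; rewrite ddotE; apply: eq_bigr => i _; apply: eq_bigr => j _.
by rewrite (lin_entry _ _ _ lA).
Qed.

Lemma mix_tensor01 (A1 A2 : M -> M) (P : (M -> M) -> Prop) (t : R) :
  P A1 -> P A2 -> t = 0 \/ t = 1 -> P (mix_tensor A1 A2 t).
Proof.
move=> p1 p2 [->|->].
  rewrite (_ : mix_tensor _ _ _ = A1)//; apply/funext => x.
  by rewrite /mix_tensor scale0r addr0.
rewrite (_ : mix_tensor _ _ _ = A2)//; apply/funext => x.
by rewrite /mix_tensor scale1r subrKC.
Qed.

Lemma ddot_ge_entry (A : M) i j : A i j ^+ 2 <= ddot A A.
Proof.
rewrite ddotE (bigD1 i)//=; apply: ler_wpDr.
  by rewrite sumr_ge0// => k _; rewrite sumr_ge0// => l _; rewrite -expr2 sqr_ge0.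
rewrite (bigD1 j)//=; apply: ler_wpDr; last by rewrite expr2.
by rewrite sumr_ge0// => l _; rewrite -expr2 sqr_ge0.
Qed.

Lemma ddotB_le (A B : M) : ddot (A - B) (A - B) <= 2 * ddot A A + 2 * ddot B B.
Proof.
have := ddot_ge0 (A + B); rewrite (ddotDl A B) !(ddotDr A B) ddotBl !ddotBr.
by have := ddotC A B; lra.
Qed.

End linear_maps.

Section voigt.
Context {R : realType} {N : nat}.
Local Notation E := 'rV[R]_N.
Local Notation M := 'M[R]_N.
Local Notation field := ((E -> E) * (E -> M))%type.
Variables (Om : set E) (oOm : open Om) (L : R).
Hypothesis OmL : Om `<=` cube L.
Local Notation m := (leb_on oOm).

(** A nonempty open set is not negligible. *)
Lemma ae_cst (P : Prop) x0 : Om x0 -> {ae m, forall x : E, P} -> P.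
Proof.
move=> Ox0 [B [mB B0 h]]; apply: contrapT => nP.
have BT : B = setT by apply/seteqP; split => // x _; apply: h.
have := lebesgue_rV_open_gt0 oOm Ox0; rewrite -(leb_on_setT oOm) -BT B0 ltxx.
by [].
Qed.

Lemma L2_lin (A : M -> M) (F : E -> M) : linear A -> L2_matrix oOm F ->
  L2_matrix oOm (fun x => A (F x)).
Proof.
move=> lA lF k l; have := @L2_sum _ _ _ m _ (index_enum 'I_N) xpredT
   (fun i x => \sum_j A (delta_mx i j) k l * F x i j).
rewrite (_ : (fun x => A (F x) k l) = fun x => \sum_i \sum_j A (delta_mx i j) k l * F x i j).
  apply => i _; apply: L2_sum => j _; exact: (L2Z _ (lF i j)).
by apply/funext => x; exact: lin_entry.
Qed.

Lemma L2_matrixD F G : L2_matrix oOm F -> L2_matrix oOm G ->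
  L2_matrix oOm (fun x => F x + G x).
Proof.
move=> lF lG i j; have := L2D (lF i j) (lG i j).
by congr (_ \in Lfun _ _); apply/funext => x; rewrite mxE.
Qed.

Lemma L2_matrixB F G : L2_matrix oOm F -> L2_matrix oOm G ->
  L2_matrix oOm (fun x => F x - G x).
Proof.
move=> lF lG i j; have := L2B (lF i j) (lG i j).
by congr (_ \in Lfun _ _); apply/funext => x; rewrite !mxE.
Qed.

Lemma L2_matrix_bmul h F : bmeas h -> L2_matrix oOm F ->
  L2_matrix oOm (fun x => h x *: F x).
Proof.
move=> [mh [K hK]] lF i j; have := L2_bounded_mul mh hK (lF i j).
by congr (_ \in Lfun _ _); apply/funext => x; rewrite mxE.
Qed.

Lemma L2_mix (A1 A2 : M -> M) chi F : linear A1 -> linear A2 -> bmeas chi ->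
  L2_matrix oOm F -> L2_matrix oOm (fun x => mix_tensor A1 A2 (chi x) (F x)).
Proof.
move=> l1 l2 bchi lF; apply: L2_matrixD; first exact: L2_lin.
by apply: L2_matrix_bmul => //; apply: L2_matrixB; exact: L2_lin.
Qed.

Lemma strainB (v w : field) x : strain (v - w) x = strain v x - strain w x.
Proof. by rewrite /strain -sym_partB. Qed.

(** Both terms of the product converge only weakly. Since the stresses [s n]
    are all in equilibrium with [f], their integral against the strain of
    [phi w_n] is [f] of that field, which tends to 0; it differs from the
    integral in question by products of [s n], bounded in L^2, with [w_n]
    times derivatives of [phi], and [w_n] tends to 0 strongly. *)
Lemma div_curl (T : E -> M) (f : field -> R) (s : nat -> E -> M) (w : nat -> field) phi C :
  L2_matrix oOm T -> (forall v, H10 oOm v -> f v = lin_form oOm (fun=> 0) T v) ->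
  (forall n, L2_matrix oOm (s n)) -> (forall n x, (s n x)^T = s n x) ->
  (forall n i j, \int[m]_x (s n x i j ^+ 2) <= C) ->
  (forall n v, H10 oOm v -> \int[m]_x ddot (s n x) (strain v x) = f v) ->
  (forall n, H10 oOm (w n)) ->
  (forall g, Hm1 oOm g -> g (w n) @[n --> \oo] --> (0 : R)) ->
  (forall i, L2_cvg m (fun n x => (w n).1 x 0 i) (fun=> 0)) ->
  test_function Om phi ->
  (\int[m]_x (phi x * ddot (s n x) (strain (w n) x))) @[n --> \oo] --> (0 : R).
Proof.
move=> lT fE ls sT sC sf hw w0 c0 tphi.
have bphi := test_function_bmeas OmL tphi.
have bdphi j := test_function_bmeas OmL (test_function_partial j tphi).
pose D n x := \sum_i \sum_j s n x i j * ((w n).1 x 0 i * partial j phi x).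
have lw n i j : L2 m (fun x => (w n).1 x 0 i * partial j phi x).
  have [[w1 _ _] _] := hw n; have [mp [K pK]] := bdphi j.
  by have := L2_bounded_mul mp pK (w1 i); congr (_ \in Lfun _ _); apply/funext => x; rewrite mulrC.
have lsw n i j := L2M (ls n i j) (lw n i j).
have lD n : L1 m (D n) by apply: L1_sum => i _; apply: L1_sum => j _; exact: lsw.
have D0 : \int[m]_x D n x @[n --> \oo] --> (0 : R).
  rewrite (_ : (fun n => _) = fun n => \sum_i \sum_j \int[m]_x (s n x i j * ((w n).1 x 0 i * partial j phi x))).
    apply: cvg_sum0 => i; apply: cvg_sum0 => j.
    rewrite (_ : (fun n => _) = fun n => \int[m]_x (((w n).1 x 0 i * partial j phi x) * s n x i j)).
      apply: (L2_cvg0_bounded (fun n => lw n i j) (fun n => ls n i j) _ (fun n => sC n i j)).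
      have [mp [K pK]] := bdphi j.
      have lw1 n : L2 m (fun x => (w n).1 x 0 i) by have [[w1 _ _] _] := hw n; exact: w1.
      rewrite (_ : (fun n => _) = fun n =>
          \int[m]_x ((partial j phi x * (w n).1 x 0 i - partial j phi x * 0) ^+ 2)).
        exact: (L2_cvg_bounded_mul mp pK lw1 (L2_0 m) (c0 i)).
      by apply/funext => n; apply: eq_Rintegral => x _; rewrite mulr0 subr0 mulrC.
    by apply/funext => n; apply: eq_Rintegral => x _; rewrite mulrC.
  apply/funext => n; rewrite Rint_sum => [|i _].
    by apply: eq_bigr => i _; rewrite Rint_sum// => j _; exact: lsw.
  by apply: L1_sum => j _; exact: lsw.
have G0 : f (mulf phi (w n)) @[n --> \oo] --> (0 : R).
  apply: (w0 (fun v => f (mulf phi v))).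
  pose b x : E := \row_i \sum_j T x i j * partial j phi x.
  have lb : L2_field oOm b.
    move=> i; rewrite (_ : (fun x => _) = fun x => \sum_j partial j phi x * T x i j).
      by apply: L2_sum => j _; have [mp [K pK]] := bdphi j; exact: (L2_bounded_mul mp pK (lT i j)).
    by apply/funext => x; rewrite mxE; apply: eq_bigr => j _; rewrite mulrC.
  have lpT := L2_matrix_bmul bphi lT.
  apply: (Hm1_lin_form OmL lb lpT) => v hv; have hpv := H10_mulf OmL tphi hv.
  have [[v1 v2 _] _] := hv; have [[_ pv2 _] _] := hpv.
  rewrite (fE _ hpv) /lin_form.
  rewrite [X in X + _](_ : _ = 0) ?add0r; last first.
    by rewrite -[RHS](Rint0 m); apply: eq_Rintegral => x _; exact: edot0l.
  rewrite -RintD; [|exact: L2_edot|exact: L2_ddot].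
  apply: eq_Rintegral => x _; rewrite ddotDr addrC ddotZr ddotZl; congr (_ + _).
  rewrite ddotE /edot; apply: eq_bigr => i _; rewrite mxE mulr_suml; apply: eq_bigr => j _.
  by rewrite mxE mulrAC mulrA.
rewrite (_ : (fun n => _) = fun n => f (mulf phi (w n)) - \int[m]_x D n x).
  by rewrite -[X in _ --> X](subr0 0); apply: cvgB.
apply/funext => n; have hpw := H10_mulf OmL tphi (hw n).
have [[w1 w2 _] _] := hw n; have [[_ pw2 _] _] := hpw.
rewrite -(sf n _ hpw) -RintB//; last by apply: L2_ddot => //; exact: L2_strain.
apply: eq_Rintegral => x _; rewrite /strain !(ddot_sym_partr _ (sT n x)) /= ddotDr ddotZr.
rewrite [X in _ = _ + X - _](_ : _ = D n x) ?addrK//.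
by rewrite ddotE; apply: eq_bigr => i _; apply: eq_bigr => j _; rewrite mxE.
Qed.

(** Expand the nonnegative energy density of [u_ n - u] with the weight
    [phi]. The product of [A^n e(u_n)] with [e(u_n - u)] tends to 0 by
    [div_curl]; what remains is linear in the stresses or in the
    characteristic functions, and passes to the limit by weak convergence. *)
Lemma voigt_integral al be (A1 A2 : M -> M) (chi : nat -> E -> R) tau (Ast : M -> M)
    (T : E -> M) (f : field -> R) (u_ : nat -> field) (u : field) phi :
  0 < al -> 0 < be -> elasticity_tensor al be A1 -> elasticity_tensor al be A2 ->
  (forall n, measurable_fun setT (chi n)) -> (forall n x, chi n x = 0 \/ chi n x = 1) ->
  weak_star_cvg oOm chi (cst tau) -> linear Ast ->
  L2_matrix oOm T -> (forall v, H10 oOm v -> f v = lin_form oOm (fun=> 0) T v) ->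
  (forall n, solves oOm (fun x => mix_tensor A1 A2 (chi n x)) f (u_ n)) ->
  H10 oOm u -> weak_cvg_H10 oOm u_ u ->
  weak_cvg_L2 oOm (fun n x => mix_tensor A1 A2 (chi n x) (strain (u_ n) x))
    (fun x => Ast (strain u x)) ->
  test_function Om phi -> (forall x, 0 <= phi x) ->
  0 <= \int[m]_x (phi x * (ddot (mix_tensor A1 A2 tau (strain u x)) (strain u x) -
                           ddot (Ast (strain u x)) (strain u x))).
Proof.
move=> al0 be0 e1 e2 mchi chi01 cchi lAst lT fE sol hu cu cs tphi phi0.
have [l1 _ _ _] := e1; have [l2 _ _ _] := e2.
have Hf : Hm1 oOm f by apply: (Hm1_lin_form OmL (@L2_field0 _ _ _ oOm) lT).
have bphi := test_function_bmeas OmL tphi.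
have bchi n : bmeas (chi n).
  split => //; exists 1 => x.
  by case: (chi01 n x) => ->; rewrite ?normr0 ?normr1 ?ler01.
have elA n x : elasticity_tensor al be (mix_tensor A1 A2 (chi n x)).
  by apply: mix_tensor01.
pose e n := strain (u_ n); pose S := strain u.
pose s n x := mix_tensor A1 A2 (chi n x) (e n x).
have hu_ n : H10 oOm (u_ n) := (sol n).1.
have len n : L2_matrix oOm (e n).
  by apply: L2_strain; have [[_ h _] _] := hu_ n.
have lS : L2_matrix oOm S by apply: L2_strain; have [[_ h _] _] := hu.
have ls n : L2_matrix oOm (s n) by exact: L2_mix.
have sym (v : field) (x : E) : (strain v x)^T = strain v x by exact: sym_partT.
have sT n x : (s n x)^T = s n x.
  by have [_ sA _ _] := elA n x; apply: sA; exact: sym.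
have [K fK] : exists K, forall n, f (u_ n) <= K.
  have [K [_ hK]] := cvg_seq_bounded (cvgP _ (cu f Hf)).
  exists (K + 1) => n; apply: (le_trans (ler_norm _)).
  by apply: (hK (K + 1)) => //; rewrite ltrDl.
have lee n := L2_ddot (len n) (len n).
have lss n := L2_ddot (ls n) (ls n).
have eK n : \int[m]_x ddot (e n x) (e n x) <= K / al.
  rewrite ler_pdivlMr// mulrC; apply: le_trans (fK n).
  rewrite -((sol n).2 _ (hu_ n)) -RintZ//; apply: le_Rint; [exact: L1Z|exact: L2_ddot (ls n) (len n)|].
  by move=> x; have [_ _ _ bA] := elA n x; have /andP[] := bA _ (sym (u_ n) x).
have sK n i j : \int[m]_x (s n x i j ^+ 2) <= be ^+ 2 * (K / al).
  apply: (@le_trans _ _ (\int[m]_x ddot (s n x) (s n x))).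
    by apply: le_Rint => [||x]; [exact: L2_sqr (ls n i j)|exact: lss|exact: ddot_ge_entry].
  apply: (@le_trans _ _ (be ^+ 2 * \int[m]_x ddot (e n x) (e n x))); last first.
    by rewrite ler_wpM2l ?sqr_ge0.
  rewrite -RintZ//; apply: le_Rint => [||x]; [exact: lss|exact: L1Z|].
  exact: (elasticity_sqr_le be0 (elA n x) (sym (u_ n) x) (ltW al0)).
pose w n : field := u_ n - u.
have hw n : H10 oOm (w n) by exact: (H10B OmL (hu_ n) hu).
have lSS := L2_ddot lS lS.
have wK n : \int[m]_x ddot ((w n).2 x) ((w n).2 x) <=
    2 * (2 * (K / al) + 2 * \int[m]_x ddot (S x) (S x)).
  apply: (le_trans (Korn OmL (hw n))); rewrite ler_wpM2l//.
  apply: (@le_trans _ _ (2 * \int[m]_x ddot (e n x) (e n x) + 2 * \int[m]_x ddot (S x) (S x))); last first.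
    by rewrite lerD2r ler_wpM2l.
  rewrite -!RintZ// -RintD; [|exact: L1Z|exact: L1Z].
  have lw : L2_matrix oOm (strain (w n)) by apply: L2_strain; have [[_ h _] _] := hw n.
  apply: le_Rint => [||x]; [exact: L2_ddot|by apply: L1D; exact: L1Z|].
  by rewrite /w strainB; exact: ddotB_le.
have w0 g : Hm1 oOm g -> g (w n) @[n --> \oo] --> (0 : R).
  move=> hg; rewrite (_ : (fun n => _) = fun n => g (u_ n) - g u).
    by rewrite -(subrr (g u)); apply: cvgB; [exact: cu|exact: cvg_cst].
  apply/funext => n; have [lg _] := hg.
  have -> : w n = (-1) *: u + u_ n by rewrite scaleN1r addrC.
  by rewrite (lg _ _ _ hu (hu_ n)) mulN1r addrC.
have c0 := rellich OmL hw wK w0.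
have D0 := div_curl lT fE ls sT sK (fun n => (sol n).2) hw w0 c0 tphi.
have lpS := L2_matrix_bmul bphi lS.
have C2 := cs _ lpS.
(* the weight of the characteristic function in the energy of S *)
pose W x := phi x * (ddot (A2 (S x)) (S x) - ddot (A1 (S x)) (S x)).
have lphi F G : L2_matrix oOm F -> L2_matrix oOm G -> L1 m (fun x => phi x * ddot (F x) (G x)).
  by move=> lF lG; have [mp [b pb]] := bphi; exact: (L1_bounded_mul mp pb (L2_ddot lF lG)).
have lp1 := lphi _ _ (L2_lin l1 lS) lS; have lp2 := lphi _ _ (L2_lin l2 lS) lS.
have lW : L1 m W.
  by have := L1B lp2 lp1; congr (_ \in Lfun _ _); apply/funext => x; rewrite /W mulrBr.
have C3 := cchi _ lW.
have lchiW n : L1 m (fun x => chi n x * W x).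
  by have [mc [b cb]] := bchi n; exact: (L1_bounded_mul mc cb lW).
have lpA := lphi _ _ (L2_lin lAst lS) lS.
have ltauW : L1 m (fun x => tau * W x) by exact: L1Z.
have -> : \int[m]_x (phi x * (ddot (mix_tensor A1 A2 tau (S x)) (S x) - ddot (Ast (S x)) (S x))) =
   0 - \int[m]_x ddot (Ast (S x)) (phi x *: S x) +
   (\int[m]_x (phi x * ddot (A1 (S x)) (S x)) + \int[m]_x (cst tau x * W x)).
  have -> : \int[m]_x ddot (Ast (S x)) (phi x *: S x) = \int[m]_x (phi x * ddot (Ast (S x)) (S x)).
    by apply: eq_Rintegral => x _; rewrite ddotZr.
  rewrite sub0r addrC -RintD// -RintB//; last exact: L1D.
  apply: eq_Rintegral => x _; rewrite ddot_mix_tensor /W /=.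
  by move: (phi x) (ddot _ _) (ddot _ _) (ddot _ _) => p a b c; clear; lra.
have CC : \int[m]_x (phi x * ddot (s n x) (strain (w n) x)) -
    \int[m]_x ddot (s n x) (phi x *: S x) +
    (\int[m]_x (phi x * ddot (A1 (S x)) (S x)) + \int[m]_x (chi n x * W x)) @[n --> \oo] -->
    0 - \int[m]_x ddot (Ast (S x)) (phi x *: S x) +
    (\int[m]_x (phi x * ddot (A1 (S x)) (S x)) + \int[m]_x (cst tau x * W x)).
  apply: cvgD; first exact: (cvgB D0 C2).
  by apply: cvgD; [exact: cvg_cst|exact: C3].
apply: (ler_cvg_to (cvg_cst 0) CC); near=> n => /=.
have lw : L2_matrix oOm (strain (w n)) by apply: L2_strain; have [[_ h _] _] := hw n.
have lq := lphi _ _ (ls n) lw.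
have lr := L2_ddot (ls n) lpS.
have -> : \int[m]_x (phi x * ddot (s n x) (strain (w n) x)) -
    \int[m]_x ddot (s n x) (phi x *: S x) +
    (\int[m]_x (phi x * ddot (A1 (S x)) (S x)) + \int[m]_x (chi n x * W x)) =
    \int[m]_x (phi x * ddot (mix_tensor A1 A2 (chi n x) (strain (w n) x)) (strain (w n) x)).
  rewrite -RintB// -RintD// -RintD; [|exact: L1B|exact: L1D].
  apply: eq_Rintegral => x _; have [lA sA yA _] := elA n x.
  rewrite /w strainB (lin_sub _ _ lA) !ddotBl !ddotBr ddotZr -/(s n x) -/S.
  have := yA _ _ (sym u x) (sym (u_ n) x); rewrite -/S -/(e n) -/(s n x) (ddotC (S x)) => ->.
  rewrite /W [ddot (mix_tensor _ _ _ (S x)) (S x)]ddot_mix_tensor.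
  move: (phi x) (chi n x) (ddot _ _) (ddot _ _) (ddot _ _) (ddot _ _) => p c a1 a2 a3 a4.
  by clear; lra.
apply: Rintegral_ge0 => x _; rewrite mulr_ge0//; have [_ _ _ bA] := elA n x.
have /andP[h _] := bA _ (sym (w n) x); apply: le_trans h.
by rewrite mulr_ge0 ?ddot_ge0// ltW.
Unshelve. all: by end_near. Qed.

(** Near [x0] the field is proportional to the affine map x |-> xi (x - x0),
    cut off by a bump function; the cut-off does not contribute to the
    gradient at [x0], as the affine map vanishes there. *)
Lemma test_field_strain x0 (xi : M) : Om x0 -> xi^T = xi ->
  exists phi, test_field Om phi /\ strain (classical_field phi) x0 = xi.
Proof.
move=> Ox0 sxi; have [psi [spsi psi0 psix0 [K [cK KO psiK]]]] := exists_bump oOm Ox0.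
pose l i (x : E) := \sum_j xi i j / psi x0 * (x 0 j + - x0 0 j).
have sc j : smooth (fun x : E => x 0 j + - x0 0 j).
  by apply: smoothD; [exact: smooth_coord|exact: smooth_cst].
have st i j : smooth (fun x : E => (fun=> xi i j / psi x0) x * (x 0 j + - x0 0 j)).
  exact: (smoothM (@smooth_cst R N _) (sc j)).
have sl i : smooth (l i) by apply: smooth_sum => j; exact: st.
have pl i j : partial j (l i) x0 = xi i j / psi x0.
  rewrite (partial_sum _ _ _ (st i)) (bigD1 j)//= big1 ?addr0 => [|k kj];
  rewrite (smooth_partialM _ _ (@smooth_cst R N _) (sc _)) partial_cst mulr0 addr0;
  rewrite (smooth_partialD _ _ (@smooth_coord R N _) (@smooth_cst R N _)) partial_coord partial_cst addr0.
    by rewrite eqxx mulr1.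
  by rewrite eq_sym (negbTE kj) mulr0.
have l0 i : l i x0 = 0 by rewrite /l big1// => j _; rewrite subrr mulr0.
exists (fun x => \row_i (psi x * l i x)).
have cE i : (fun x => (\row_i (psi x * l i x)) 0 i) = (fun x => psi x * l i x).
  by apply/funext => x; rewrite mxE.
split.
  move=> i; rewrite cE; split; first exact: (smoothM spsi (sl i)).
  by exists K; split => // x /psiK ->; rewrite mul0r.
rewrite /strain (_ : (classical_field _).2 x0 = xi); first exact: sym_part_id.
apply/matrixP => i j; rewrite mxE cE (smooth_partialM _ _ spsi (sl i)).
by rewrite pl l0 mul0r addr0 mulrC divfK// gt_eqF.
Qed.

(** If [h] were negative at [x0], a bump function in the set where [h < 0]
    would have a negative integral against [h]. *)
Lemma continuous_ge0_of_test (h : E -> R) x0 : Om x0 -> continuous h ->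
  (forall phi, test_function Om phi -> (forall x, 0 <= phi x) ->
    L1 m (fun x => phi x * h x) /\ 0 <= \int[m]_x (phi x * h x)) -> 0 <= h x0.
Proof.
move=> Ox0 ch H; rewrite leNgt; apply/negP => hx0.
have oU : open (Om `&` [set x | h x < 0]).
  apply: openI => //.
  by apply: (open_comp _ (@open_lt R 0)) => x _; exact: ch.
have [psi [spsi psi0 psix0 [K [cK KO psiK]]]] := exists_bump oU (conj Ox0 hx0).
have tpsi : test_function Om psi by split => //; exists K; split => // x /KO[].
have [lh Ih] := H psi tpsi psi0.
have nh x : 0 <= - (psi x * h x).
  rewrite -mulrN; have [Kx|/psiK ->] := pselect (K x); last by rewrite mul0r.
  by rewrite mulr_ge0// oppr_ge0 ltW//; case: (KO _ Kx).
have ln : L1 m (fun x => - (psi x * h x)).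
  by have := L1Z (-1) lh; congr (_ \in Lfun _ _); apply/funext => x; rewrite mulN1r.
have : \int[m]_x (- (psi x * h x)) = 0.
  apply/eqP; rewrite eq_le Rintegral_ge0// andbT RintN// oppr_le0//.
move=> /(Rint_eq0_ae ln nh) [B [mB B0 hB]].
have oV : open (Om `&` [set x | h x < 0] `&` [set x | 0 < psi x]).
  apply: openI => //.
  apply: (open_comp _ (@open_gt R 0)) => x _; exact: smooth_continuous.
have Vx0 : (Om `&` [set x | h x < 0] `&` [set x | 0 < psi x]) x0 by split.
have := lebesgue_rV_open_gt0 oV Vx0; rewrite ltNge => /negP; apply.
rewrite -B0 /leb_on /mrestr; apply: le_measure; rewrite ?inE.
- exact: open_measurable_rV.
- by apply: measurableI => //; exact: open_measurable_rV.
- move=> x [[Ox hx] px]; split => //; apply: hB => /= /eqP.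
  by rewrite oppr_eq0 mulf_eq0 !(gt_eqF px, lt_eqF hx).
Qed.

(** The load [f] is chosen such that the homogenized problem has the
    solution [w], of prescribed strain [xi] at [x0]; ellipticity of [Ast]
    identifies the strain of the limit [u] with that of [w]. Then localize
    [voigt_integral] at [x0]. *)
Lemma voigt_bound x0 al be (A1 A2 : M -> M) tau Ast xi : Om x0 ->
  0 < al -> 0 < be -> elasticity_tensor al be A1 -> elasticity_tensor al be A2 ->
  G_closure oOm A1 A2 tau Ast -> xi^T = xi ->
  ddot (Ast xi) xi <= ddot (mix_tensor A1 A2 tau xi) xi.
Proof.
move=> Ox0 al0 be0 e1 e2 [_ [chi [mchi chi01 cchi [_ [al' [be' [al0' [_ eA]]]] Hcv]]]] sxi.
have [lA sA yA bA] : elasticity_tensor al' be' Ast.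
  by apply: (ae_cst Ox0); apply: filterS eA => x.
have [l1 _ _ _] := e1; have [l2 _ _ _] := e2.
have [psi [tpsi epsi]] := test_field_strain Ox0 sxi.
pose w := classical_field psi; pose e := strain w; pose T x := Ast (e x).
have hw : H10 oOm w by exact: (H10_test oOm OmL tpsi).
have symE (v : field) (x : E) : (strain v x)^T = strain v x by exact: sym_partT.
have le_ : L2_matrix oOm e by apply: L2_strain; have [[_ h _] _] := hw.
have lT : L2_matrix oOm T by exact: L2_lin.
pose f (v : field) := \int[m]_x ddot (T x) (strain v x).
have fE v : H10 oOm v -> f v = lin_form oOm (fun=> 0) T v.
  move=> _; rewrite /lin_form (_ : \int[m]_x edot 0 (v.1 x) = 0) ?add0r.
    by apply: eq_Rintegral => x _; apply: ddot_sym_partr; apply: sA; exact: symE.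
  by rewrite -[RHS](Rint0 m); apply: eq_Rintegral => x _; exact: edot0l.
have Hf : Hm1 oOm f by apply: (Hm1_lin_form OmL (@L2_field0 _ _ _ oOm) lT).
have [u_ [u [sol_ [hu sol] cu cs]]] := Hcv f Hf.
have lu : L2_matrix oOm (strain u) by apply: L2_strain; have [[_ h _] _] := hu.
have hd : H10 oOm (u - w) by exact: (H10B OmL hu hw).
have ld : L2_matrix oOm (strain (u - w)) by apply: L2_strain; have [[_ h _] _] := hd.
have ldd := L2_ddot ld ld.
have I0 : \int[m]_x ddot (strain (u - w) x) (strain (u - w) x) = 0.
  apply/eqP; rewrite eq_le Rintegral_ge0 ?andbT; last by move=> x _; exact: ddot_ge0.
  rewrite -(pmulr_rle0 _ al0') -RintZ//.
  have lAu := L2_ddot (L2_lin lA lu) ld; have lAw := L2_ddot lT ld.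
  apply: (@le_trans _ _ (\int[m]_x (ddot (Ast (strain u x)) (strain (u - w) x) -
      ddot (T x) (strain (u - w) x)))); last first.
    by rewrite RintB// (sol _ hd) subrr.
  apply: le_Rint => [||x]; [exact: L1Z|exact: L1B|].
  have /andP[h _] := bA _ (symE (u - w) x); apply: (le_trans h).
  by rewrite -ddotBl /T -(lin_sub _ _ lA) -strainB.
have ue : {ae m, forall x, strain u x = e x}.
  have dd0 x : 0 <= ddot (strain (u - w) x) (strain (u - w) x) by exact: ddot_ge0.
  apply: filterS (Rint_eq0_ae ldd dd0 I0) => x hx; apply/eqP; rewrite -subr_eq0 -strainB.
  apply/eqP/matrixP => i j; rewrite [RHS]mxE; apply/eqP; rewrite -sqrf_eq0 eq_le sqr_ge0 andbT.
  by rewrite -hx ddot_ge_entry.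
pose q (eta : M) := ddot (mix_tensor A1 A2 tau eta) eta - ddot (Ast eta) eta.
have lM : linear (mix_tensor A1 A2 tau) by exact: linear_mix_tensor.
have se i j : continuous (fun x => e x i j).
  have cj k l : continuous (fun x => w.2 x k l).
    rewrite (_ : (fun x => _) = partial l (fun y => psi y 0 k)).
      exact: (smooth_continuous (smooth_partial l (tpsi k).1)).
    by apply/funext => x; rewrite mxE.
  rewrite (_ : (fun x => _) = fun x => (fun=> 2^-1) x * (w.2 x i j + w.2 x j i)).
    by apply: continuous_mul; [exact: cst_continuous|exact: continuous_add].
  by apply/funext => x; rewrite !mxE.
have cq : continuous (fun x => q (e x)).
  rewrite (_ : (fun x => _) = fun x => ddot (mix_tensor A1 A2 tau (e x)) (e x) +
      (fun=> -1) x * ddot (Ast (e x)) (e x)).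
    apply: continuous_add; first exact: continuous_quadratic.
    by apply: continuous_mul; [exact: cst_continuous|exact: continuous_quadratic].
  by apply/funext => x; rewrite mulN1r.
have lq F : L2_matrix oOm F -> L1 m (fun x => q (F x)).
  by move=> lF; apply: L1B; apply: L2_ddot => //; exact: L2_lin.
rewrite -subr_ge0 -epsi; apply: (continuous_ge0_of_test Ox0 cq) => phi tphi phi0.
have [mp [b pb]] := test_function_bmeas OmL tphi.
have l3 := L1_bounded_mul mp pb (lq _ le_); have l4 := L1_bounded_mul mp pb (lq _ lu).
split => //.
have -> : \int[m]_x (phi x * q (e x)) = \int[m]_x (phi x * q (strain u x)).
  apply: eq_Rint_ae; [exact: L1_measurable l3|exact: L1_measurable l4|].
  by apply: filterS ue => x ->.
exact: (voigt_integral al0 be0 e1 e2 mchi chi01 cchi lA lT fE sol_ hu cu cs tphi phi0).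
Qed.

End voigt.

(** * Bounded coefficients *)

Section essentially_bounded.
Context {R : realType} {N : nat}.
Local Notation E := 'rV[R]_N.
Variables (Om : set E) (oOm : open Om) (L : R).
Hypothesis OmL : Om `<=` cube L.
Hypothesis Om0 : (0 < leb_on oOm setT)%E.
Local Notation m := (leb_on oOm).
Local Notation X := (Linfty oOm).
Implicit Types (x y : X).

Lemma Linfty_normD x y : Linfty_norm (x + y) <= Linfty_norm x + Linfty_norm y.
Proof. exact: ler_LnormD. Qed.

Lemma Linfty_normZ a x : Linfty_norm (a *: x) = `|a| * Linfty_norm x.
Proof.
apply/EFin_inj; rewrite EFinM /Linfty_norm !finite_norm_fine.
exact: LnormZ.
Qed.

Lemma Linfty_measurable x : measurable_fun setT (x : E -> R).
Proof. exact: measurable_funPT. Qed.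

(** Positivity of the measure matters: the L^oo norm is set to 0 on a null
    space. *)
Lemma Linfty_norm_ae x : {ae m, forall z, `|x z| <= Linfty_norm x}.
Proof.
have h := ess_sup_ge m (abse \o (EFin \o x)).
apply: filterS h => z; rewrite -lee_fin /Linfty_norm finite_norm_fine unlock /=.
by rewrite Om0.
Qed.

Lemma LinftyB_ae x y : {ae m, forall z, `|x z - y z| <= Linfty_norm (x - y)}.
Proof. exact: (Linfty_norm_ae (x - y)). Qed.

Lemma L1_Linfty_mul x (b : E -> R) : L1 m b -> L1 m (fun z => x z * b z).
Proof.
move=> lb; apply: (@le_L1_ae _ _ _ m _ (fun z => Linfty_norm x * b z)).
- by apply: measurable_funM; [exact: Linfty_measurable|exact: L1_measurable lb].
- exact: L1Z.
- apply: filterS (Linfty_norm_ae x) => z h; rewrite !normrM ler_wpM2r//.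
  exact: (le_trans h (ler_norm _)).
Qed.

(** The strict inequalities on essential bounds give a margin [d] that is
    uniform over the domain, which is what openness needs. *)
Lemma ess_bandP eps x : ess_band oOm eps x <->
  exists2 d : R, 0 < d & {ae m, forall z, - eps + d <= x z <= 1 + eps - d}.
Proof.
split=> [[h1 h2]|[d d0 hd]]; last first.
  split.
    apply: (@lt_le_trans _ _ (- eps + d)%:E); first by rewrite lte_fin ltrDl.
    by apply/ess_infP; apply: filterS hd => z /andP[]; rewrite /= lee_fin.
  apply: (@le_lt_trans _ _ (1 + eps - d)%:E); last by rewrite lte_fin ltrBlDr ltrDl.
  by apply/ess_supP; apply: filterS hd => z /andP[]; rewrite /= lee_fin.
have [d1 d10 i1] : exists2 d : R, 0 < d & {ae m, forall z, - eps + d <= x z}.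
  have := ess_inf_le m (EFin \o x); move: h1; case: (ess_inf _ _) => [r| |]//=.
    rewrite lte_fin => h1 h; exists (r + eps); first by lra.
    by apply: filterS h => z; rewrite lee_fin; lra.
  move=> _ h; exists 1 => //; apply: filterS h => z.
  by rewrite leye_eq.
have [d2 d20 i2] : exists2 d : R, 0 < d & {ae m, forall z, x z <= 1 + eps - d}.
  have := ess_sup_ge m (EFin \o x); move: h2; case: (ess_sup _ _) => [r| |]//=.
    rewrite lte_fin => h2 h; exists (1 + eps - r); first by lra.
    by apply: filterS h => z; rewrite lee_fin; lra.
  move=> _ h; exists 1 => //; apply: filterS h => z.
  by rewrite leeNy_eq.
exists (Num.min d1 d2); first by rewrite lt_min d10.
apply: filterS2 i1 i2 => z h k.
have m1 : Num.min d1 d2 <= d1 by rewrite ge_min lexx.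
have m2 : Num.min d1 d2 <= d2 by rewrite ge_min lexx orbT.
by apply/andP; split; lra.
Qed.

Lemma ess_band_open eps : nopen Linfty_norm (ess_band oOm eps).
Proof.
move=> x /ess_bandP[d d0 hd]; exists (d / 2); first by rewrite divr_gt0.
move=> y yx; apply/ess_bandP; exists (d / 2); first by rewrite divr_gt0.
apply: filterS2 hd (LinftyB_ae y x) => z /andP[a b] c.
have := le_lt_trans c yx; rewrite ltr_norml => /andP[p q].
by apply/andP; split; lra.
Qed.

Lemma conv_le_lin (t p q c e : R) : 0 <= t <= 1 -> c <= p <= e -> c <= q <= e ->
  c <= t * p + (1 - t) * q <= e.
Proof.
move=> /andP[t0 t1] /andP[cp pe] /andP[cq qe]; apply/andP; split; nra.
Qed.

Lemma convex_ae_interval (c e : R) x y (t : R) : 0 <= t <= 1 ->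
  {ae m, forall z, c <= x z <= e} -> {ae m, forall z, c <= y z <= e} ->
  {ae m, forall z, c <= (t *: x + (1 - t) *: y : X) z <= e}.
Proof. by move=> t01; apply: filterS2 => z; exact: conv_le_lin. Qed.

Lemma ess_band_convex eps : convex_set (ess_band oOm eps).
Proof.
move=> x y t; rewrite !inE => /ess_bandP[d1 d10 h1] /ess_bandP[d2 d20 h2].
apply/ess_bandP; exists (Num.min d1 d2); first by rewrite lt_min d10.
have m1 : Num.min d1 d2 <= d1 by rewrite ge_min lexx.
have m2 : Num.min d1 d2 <= d2 by rewrite ge_min lexx orbT.
apply: (@convex_ae_interval _ _ x y t%:num); first by rewrite ge0 le1.
  by apply: filterS h1 => z /andP[a b]; apply/andP; split; lra.
by apply: filterS h2 => z /andP[a b]; apply/andP; split; lra.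
Qed.

Lemma admissible_ess_band gamma eps : 0 < eps -> admissible oOm gamma `<=` ess_band oOm eps.
Proof.
move=> eps0 x [h _]; apply/ess_bandP; exists eps => //.
by apply: filterS h => z; rewrite addNr addrK.
Qed.

Lemma L1_cst (a : R) : L1 m (fun=> a).
Proof. by apply: (@bounded_L1 _ _ _ oOm _ OmL `|a|) => //; exact: measurable_cst. Qed.

Lemma L1_Linfty x : L1 m x.
Proof.
have := L1_Linfty_mul x (L1_cst 1).
by congr (_ \in Lfun _ _); apply/funext => z; rewrite mulr1.
Qed.

Lemma admissible_convex gamma : convex_set (admissible oOm gamma).
Proof.
move=> x y t; rewrite !inE => -[h1 g1] [h2 g2]; split.
  by apply: (@convex_ae_interval _ _ x y t%:num) => //; rewrite ge0 le1.
transitivity (\int[m]_z (t%:num * x z + (1 - t%:num) * y z)); first by [].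
rewrite RintD ?RintZ; [|exact: L1_Linfty|exact: L1_Linfty|..]; last 2 first.
- exact: L1Z (L1_Linfty x).
- exact: L1Z (L1_Linfty y).
by rewrite g1 g2; lra.
Qed.

Lemma Rint_cst (a : R) : \int[m]_z a = a * \int[m]_z 1.
Proof. by rewrite -(RintZ a (L1_cst 1)); apply: eq_Rintegral => z _; rewrite mulr1. Qed.

Lemma Rint_dist x y : `|\int[m]_z x z - \int[m]_z y z| <= Linfty_norm (x - y) * \int[m]_z 1.
Proof.
rewrite -(RintB (L1_Linfty x) (L1_Linfty y)) -Rint_cst.
have l1 := L1B (L1_Linfty x) (L1_Linfty y); have l2 := L1_cst (Linfty_norm (x - y)).
rewrite ler_norml -RintN//; apply/andP; split; apply: le_Rint_ae => //.
- by have := L1Z (-1) l2; congr (_ \in Lfun _ _); apply/funext => z; rewrite mulN1r.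
- by apply: filterS (LinftyB_ae x y) => z; rewrite ler_norml => /andP[].
- by apply: filterS (LinftyB_ae x y) => z; rewrite ler_norml => /andP[].
Qed.

(** A limit in L^oo of admissible functions lies between [- 1 / n] and [1 +
    1 / n] for all [n], and its integral is the limit of theirs. *)
Lemma admissible_closed gamma : nclosed Linfty_norm (admissible oOm gamma).
Proof.
move=> x nx; apply: contrapT => H; apply: nx.
have near_x (r : R) : 0 < r -> exists2 y, admissible oOm gamma y & Linfty_norm (x - y) < r.
  move=> r0; apply: contrapT => nH; apply: H; exists r => // y yx ay.
  by apply: nH; exists y => //; rewrite (seminormB Linfty_normZ).
split.
  have : {ae m, forall z, forall n : nat, - n.+1%:R^-1 <= x z <= 1 + n.+1%:R^-1}.
    apply: ae_foralln => n; have [|y [ay _] xy] := near_x n.+1%:R^-1; first by rewrite invr_gt0.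
    apply: filterS2 ay (LinftyB_ae x y) => z /andP[a b] c.
    have := le_lt_trans c xy; rewrite ltr_norml; set q := _^-1 => /andP[p s].
    by apply/andP; split; lra.
  apply: filterS => z h; apply/andP; split; apply/ler_addgt0Pr => e e0.
    have [k _ /(_ k (leqnn k)) /= ke] := near_infty_natSinv_lt (PosNum e0).
    by have /andP[+ _] := h k; move: ke; set q := _^-1; rewrite /=; lra.
  have [k _ /(_ k (leqnn k)) /= ke] := near_infty_natSinv_lt (PosNum e0).
  by have /andP[_ +] := h k; move: ke; set q := _^-1; rewrite /=; lra.
have I0 : 0 <= \int[m]_z (1 : R) by apply: Rintegral_ge0.
apply/eqP; rewrite -subr_eq0 -normr_le0; apply/ler_addgt0Pr => e e0; rewrite add0r.
have I1 : 0 < \int[m]_z (1 : R) + 1 by rewrite ltr_wpDl.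
have [|y [_ gy] xy] := near_x (e / (\int[m]_z (1 : R) + 1)); first by rewrite divr_gt0.
rewrite -gy; apply: (le_trans (Rint_dist x y)).
apply: (le_trans (ler_wpM2r I0 (ltW xy))).
by rewrite mulrAC ler_pdivrMr// ler_pM2l// lerDl.
Qed.

(** With the density [a + theta b], both the energy and the mass of a field
    are of this form: [a] is the contribution of the first material, and [b]
    that of the contrast. *)
Definition affine_int (a b : E -> R) x : R := \int[m]_z (a z + x z * b z).

Lemma L1_affine_int a b x : L1 m a -> L1 m b -> L1 m (fun z => a z + x z * b z).
Proof. by move=> la lb; apply: L1D => //; exact: L1_Linfty_mul. Qed.

Lemma affine_int_affine a b x y t : L1 m a -> L1 m b ->
  affine_int a b (x + t *: (y - x)) =
  affine_int a b x + t * (affine_int a b y - affine_int a b x).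
Proof.
move=> la lb; have lx := L1_affine_int x la lb; have ly := L1_affine_int y la lb.
rewrite /affine_int -RintB// -RintZ; last exact: L1B.
rewrite -RintD//; last by apply: L1Z; exact: L1B.
apply: eq_Rintegral => z _.
rewrite (_ : (x + t *: (y - x) : X) z = x z + t * (y z - x z))//.
by move: (x z) (y z) (a z) (b z); clear => *; lra.
Qed.

Lemma affine_int_ge a b c eps x : L1 m a -> L1 m b -> L1 m c ->
  (forall z, 0 <= b z) -> (forall z, c z <= a z - eps * b z) ->
  ess_band oOm eps x -> \int[m]_z c z <= affine_int a b x.
Proof.
move=> la lb lc b0 ca /ess_bandP[d d0 hd].
apply: le_Rint_ae => //; first exact: L1_affine_int.
apply: filterS hd => z /andP[h _]; apply: (le_trans (ca z)).
have : 0 <= (x z + eps - d) * b z by rewrite mulr_ge0//; lra.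
have : 0 <= d * b z by rewrite mulr_ge0// ltW.
by move: (b z); clear => *; lra.
Qed.

(** On the band [theta > - eps], the density is at least [k * b], so that
    [\int b], which controls the variation, is at most [affine_int a b x /
    k]. *)
Lemma affine_int_lip a b eps k x y : L1 m a -> L1 m b -> 0 < k ->
  (forall z, 0 <= b z) -> (forall z, k * b z <= a z - eps * b z) ->
  ess_band oOm eps x ->
  `|affine_int a b y - affine_int a b x| <= k^-1 * Linfty_norm (y - x) * affine_int a b x.
Proof.
move=> la lb k0 b0 kb bx.
have h := affine_int_ge la lb (L1Z k lb) b0 kb bx; rewrite RintZ// in h.
have n0 : 0 <= Linfty_norm (y - x) by exact: (seminorm_ge0 Linfty_normD Linfty_normZ).
apply: (@le_trans _ _ (Linfty_norm (y - x) * \int[m]_z b z)); last first.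
  by rewrite -mulrA mulrCA ler_wpM2l// ler_pdivlMl.
have lx := L1_affine_int x la lb; have ly := L1_affine_int y la lb.
have l1 := L1B ly lx; have l2 := L1Z (Linfty_norm (y - x)) lb.
rewrite /affine_int -RintB// -RintZ// ler_norml -RintN//; apply/andP.
have key : {ae m, forall z, `|a z + y z * b z - (a z + x z * b z)| <= Linfty_norm (y - x) * b z}.
  apply: filterS (LinftyB_ae y x) => z hz.
  rewrite (_ : _ - _ = (y z - x z) * b z); last by move: (a z) (b z); clear => *; lra.
  by rewrite normrM (ger0_norm (b0 z)) ler_wpM2r.
split; apply: le_Rint_ae => //.
- by have := L1Z (-1) l2; congr (_ \in Lfun _ _); apply/funext => z; rewrite mulN1r.
- by apply: filterS key => z; rewrite ler_norml => /andP[].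
- by apply: filterS key => z; rewrite ler_norml => /andP[].
Qed.

End essentially_bounded.

(** * The objective *)

Section isotropic_tensors.
Context {R : realType} {N : nat}.
Hypothesis N0 : (0 < N)%N.
Local Notation M := 'M[R]_N.
Implicit Types (xi eta : M) (mu ka : R).

Let N0R : 0 < N%:R :> R. Proof. by rewrite ltr0n. Qed.

Lemma ddot1 xi : ddot xi 1%:M = \tr xi.
Proof. by rewrite /ddot mulmx1 mxtrace_tr. Qed.

Lemma iso_linear mu ka : linear (@iso_tensor R N mu ka).
Proof.
move=> a u v; rewrite /iso_tensor mxtraceD mxtraceZ.
by apply/matrixP => i j; rewrite !mxE; case: (i == j); rewrite ?mulr1n ?mulr0n; lra.
Qed.

Lemma ddot_iso mu ka xi eta : ddot (iso_tensor mu ka xi) eta =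
  2 * mu * ddot xi eta + (ka - 2 * mu / N%:R) * \tr xi * \tr eta.
Proof. by rewrite /iso_tensor ddotDl !ddotZl (ddotC 1%:M) ddot1. Qed.

(** The squared norm of the deviatoric part of a symmetric matrix. *)
Definition dev_sqr xi : R := ddot xi xi - (\tr xi) ^+ 2 / N%:R.

(** It is the squared norm of [xi - (\tr xi / N) 1]. *)
Lemma dev_sqr_ge0 xi : 0 <= dev_sqr xi.
Proof.
have := ddot_ge0 (xi - (\tr xi / N%:R) *: 1%:M).
rewrite ddotBl !ddotBr !ddotZl !ddotZr (ddotC 1%:M) !ddot1 mxtrace1.
suff -> : \tr xi / N%:R * (\tr xi / N%:R * N%:R) = \tr xi * (\tr xi / N%:R).
  by rewrite /dev_sqr; lra.
by rewrite divfK ?gt_eqF// mulrC.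
Qed.

(** Isotropic tensors are diagonal in the decomposition into deviatoric and
    spherical parts, so that all comparisons between them reduce to the two
    moduli. *)
Lemma iso_quad mu ka xi : ddot (iso_tensor mu ka xi) xi =
  2 * mu * dev_sqr xi + ka * (\tr xi) ^+ 2.
Proof. by rewrite ddot_iso /dev_sqr; lra. Qed.

Lemma iso_elasticity al be mu ka : al <= 2 * mu -> al <= N%:R * ka ->
  2 * mu <= be -> N%:R * ka <= be -> elasticity_tensor al be (@iso_tensor R N mu ka).
Proof.
move=> h1 h2 h3 h4; split.
- exact: iso_linear.
- by move=> xi sxi; rewrite /iso_tensor linearD/= !linearZ/= sxi trmx1.
- by move=> xi eta _ _; rewrite [in RHS]ddotC !ddot_iso (ddotC eta xi); lra.
- move=> xi _; rewrite iso_quad.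
  have -> : ddot xi xi = dev_sqr xi + (\tr xi) ^+ 2 / N%:R by rewrite /dev_sqr subrK.
  have d0 := dev_sqr_ge0 xi; have t0 : 0 <= (\tr xi) ^+ 2 / N%:R.
    by rewrite divr_ge0 ?sqr_ge0// ltW.
  have -> : ka * \tr xi ^+ 2 = N%:R * ka * (\tr xi ^+ 2 / N%:R).
    have {1}-> : \tr xi ^+ 2 = N%:R * (\tr xi ^+ 2 / N%:R) by rewrite mulrC divfK// gt_eqF.
    by rewrite mulrCA mulrA.
  move: (dev_sqr xi) (_ / _) d0 t0 => p q p0 q0.
  by apply/andP; split; rewrite mulrDr; apply: lerD; rewrite ler_wpM2r.
Qed.

(** The energies being combinations of the same two squares, comparing them
    amounts to comparing the moduli. *)
Lemma iso_gap mu1 mu2 ka1 ka2 eps k xi :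
  k * (mu2 - mu1) <= mu1 - eps * (mu2 - mu1) ->
  k * (ka2 - ka1) <= ka1 - eps * (ka2 - ka1) ->
  k * (ddot (iso_tensor mu2 ka2 xi) xi - ddot (iso_tensor mu1 ka1 xi) xi) <=
  ddot (iso_tensor mu1 ka1 xi) xi -
    eps * (ddot (iso_tensor mu2 ka2 xi) xi - ddot (iso_tensor mu1 ka1 xi) xi).
Proof.
move=> h1 h2; rewrite !iso_quad.
have := ler_wpM2r (dev_sqr_ge0 xi) h1; have := ler_wpM2r (sqr_ge0 (\tr xi)) h2.
by move: (dev_sqr xi) (\tr xi ^+ 2) => p q; lra.
Qed.

Lemma iso_mono mu1 mu2 ka1 ka2 xi : mu1 <= mu2 -> ka1 <= ka2 ->
  0 <= ddot (iso_tensor mu2 ka2 xi) xi - ddot (iso_tensor mu1 ka1 xi) xi.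
Proof.
rewrite -(subr_ge0 mu1) -(subr_ge0 ka1) => h1 h2; rewrite !iso_quad.
have := mulr_ge0 h1 (dev_sqr_ge0 xi); have := mulr_ge0 h2 (sqr_ge0 (\tr xi)).
by move: (dev_sqr xi) (\tr xi ^+ 2) => p q; lra.
Qed.

End isotropic_tensors.

Lemma ereal_inf_quotient {R : realType} (I : Type) (V : set I) (n d : I -> R) :
  V !=set0 -> (forall v, V v -> 0 <= n v) -> (forall v, V v -> 0 < d v) ->
  let F := ereal_inf [set (n v / d v)%:E | v in V] in
  [/\ F \is a fin_num, forall v, V v -> fine F * d v <= n v &
      forall e, 0 < e -> exists2 v, V v & n v < (fine F + e) * d v].
Proof.
move=> [v0 V0] n0 d0 F.
have Ffin : F \is a fin_num.
  rewrite fin_numElt; apply/andP; split.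
    apply: (@lt_le_trans _ _ 0%E) => //; apply: le_ereal_inf_tmp => _ [v Vv <-].
    by rewrite lee_fin divr_ge0 ?n0// ltW// d0.
  by apply: (@le_lt_trans _ _ (n v0 / d v0)%:E); [apply: ereal_inf_lbound; exists v0|exact: ltry].
split => // [v Vv|e e0].
  rewrite -ler_pdivlMr ?d0// -lee_fin fineK//.
  by apply: ereal_inf_lbound; exists v.
have [_ [v Vv <-] h] := lb_ereal_inf_adherent e0 Ffin.
exists v => //; rewrite -ltr_pdivrMr ?d0// -lte_fin EFinD fineK//.
Qed.

(** The integral is a difference of suprema over simple functions, hence
    monotone on arbitrary functions, such as the Hashin--Shtrikman density,
    a supremum over an uncountable set. *)
Lemma le_integral_any d (T : measurableType d) (R : realType)
    (mu : {measure set T -> \bar R}) (f g : T -> \bar R) :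
  (forall x, f x <= g x)%E -> (\int[mu]_x f x <= \int[mu]_x g x)%E.
Proof.
move=> fg; rewrite /integral; apply: leeB.
  apply: le_ereal_sup => _ [h hf <-]; exists h => // x.
  apply: (le_trans (hf x)); rewrite !patch_setT !funeposE.
  by rewrite ge_max le_max fg/= le_max lexx orbT.
apply: le_ereal_sup => _ [h hf <-]; exists h => // x.
apply: (le_trans (hf x)); rewrite !patch_setT !funenegE.
by rewrite ge_max le_max leeN2 fg/= le_max lexx orbT.
Qed.

Lemma caratheodory_integral0 {R : realType} (T : pointedType)
    (mu : {outer_measure set T -> \bar R}) D (f : T -> \bar R) :
  (forall x, D x -> f x = 0)%E ->
  (\int[(mu : set (caratheodory_type mu) -> \bar R)]_(x in D) f x = 0)%E.
Proof. by move=> f0; exact: (@integral0_eq _ (caratheodory_type mu) R _ D f f0). Qed.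

Section clamped_fields.
Context {R : realType} {N : nat}.
Local Notation E := 'rV[R]_N.
Local Notation M := 'M[R]_N.
Local Notation field := ((E -> E) * (E -> M))%type.
Variables (Om : set E) (oOm : open Om) (L : R).
Hypothesis OmL : Om `<=` cube L.
Local Notation m := (leb_on oOm).

Definition nonzero_VD (GD : set E) : set field :=
  [set v | VD oOm GD v /\ ~ {ae m, forall x, v.1 x = 0}].

(** Test fields vanish near the boundary, so that the constant sequence
    witnesses the trace 0. *)
Lemma test_field_VD (GD : set E) phi : test_field Om phi -> VD oOm GD (classical_field phi).
Proof.
move=> tphi; split; first exact: (H1_test oOm OmL tphi).
exists (fun=> 0); split; last first.
  rewrite (_ : _ `&` _ = set0) ?outer_measure0//.
  by apply/seteqP; split => // x [_ /=]; rewrite eqxx.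
split; first by move=> i; exact: measurable_cst.
exists (fun=> phi); split.
- by move=> k i; have [] := tphi i.
- rewrite (_ : (fun k => _) = fun=> 0%E); first exact: cvg_cst.
  apply/funext => k; rewrite subrr /H1_sqnorm; apply: integral0_eq => x _ /=.
  by rewrite edot0l ddot0l addr0.
- rewrite (_ : (fun k => _) = fun=> 0%E); first exact: cvg_cst.
  apply/funext => k.
  apply: (@caratheodory_integral0 R E (@hausdorff R N N.-1)) => x [_ /= nOx].
  rewrite (_ : phi x = 0) ?subr0 ?edot0l//.
  apply/rowP => i; rewrite mxE; apply: (test_function_Om0 (tphi i)) => Ox.
  by apply: nOx; move/interior_id : oOm => ->.
Qed.

Lemma nonzero_VD_nonempty GD x0 : (0 < N)%N -> Om x0 -> nonzero_VD GD !=set0.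
Proof.
move=> N0 Ox0; have [psi [spsi psi0 psix0 [K [cK KO psiK]]]] := exists_bump oOm Ox0.
have tpsi : test_function Om psi by split => //; exists K.
pose phi x : E := \row_i psi x.
have tphi : test_field Om phi.
  by move=> i; rewrite (_ : (fun x => _) = psi)//; apply/funext => x; rewrite mxE.
exists (classical_field phi); split; first exact: test_field_VD.
move=> [B [mB B0 hB]].
have oV : open (Om `&` [set x | 0 < psi x]).
  apply: openI => //.
  apply: (open_comp _ (@open_gt R 0)) => x _; exact: smooth_continuous.
have := lebesgue_rV_open_gt0 oV (conj Ox0 psix0); rewrite ltNge => /negP; apply.
rewrite -B0 /leb_on /mrestr; apply: le_measure; rewrite ?inE.
- exact: open_measurable_rV.
- by apply: measurableI => //; exact: open_measurable_rV.
- move=> x [Ox px]; split => //; apply: hB => /= /rowP /(_ (Ordinal N0)).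
  by rewrite !mxE => h; move: px; rewrite /= h ltxx.
Qed.

End clamped_fields.

Lemma exists_common_slope {R : realType} (a1 a2 a3 d1 d2 d3 : R) :
  0 < a1 -> 0 < a2 -> 0 < a3 -> 0 <= d1 -> 0 <= d2 -> 0 <= d3 ->
  exists2 k, 0 < k & [/\ k * d1 <= a1, k * d2 <= a2 & k * d3 <= a3].
Proof.
move=> a10 a20 a30 d10 d20 d30.
have key (a d : R) : 0 < a -> 0 <= d ->
    exists2 k, 0 < k & forall k', 0 <= k' <= k -> k' * d <= a.
  move=> a0 d0; exists (a / (d + 1)) => [|k' /andP[k0 kk]].
    by rewrite divr_gt0// ltr_wpDl.
  apply: (le_trans (ler_wpM2r d0 kk)).
  by rewrite mulrAC ler_pdivrMr ?ltr_wpDl// ler_pM2l// lerDl.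
have [k1 k10 h1] := key _ _ a10 d10; have [k2 k20 h2] := key _ _ a20 d20.
have [k3 k30 h3] := key _ _ a30 d30.
pose k := Num.min k1 (Num.min k2 k3).
have k0 : 0 < k by rewrite !lt_min k10 k20.
exists k => //; split; [apply: h1|apply: h2|apply: h3];
  by rewrite (ltW k0)/= /k !ge_min lexx ?orbT.
Qed.

Section objective.
Context {R : realType} {N : nat}.
Local Notation E := 'rV[R]_N.
Local Notation M := 'M[R]_N.
Local Notation field := ((E -> E) * (E -> M))%type.
Variables (Om : set E) (oOm : open Om) (L : R).
Hypotheses (OmL : Om `<=` cube L) (N0 : (0 < N)%N).
Hypothesis Om0 : (0 < leb_on oOm setT)%E.
Variables (x0 : E) (Ox0 : Om x0) (GD : set E).
Variables mu1 mu2 ka1 ka2 rho1 rho2 : R.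
Hypotheses (mu0 : 0 < mu1) (ka0 : 0 < ka1) (rho0 : 0 < rho1).
Hypotheses (mu12 : mu1 <= mu2) (ka12 : ka1 <= ka2) (rho12 : rho1 <= rho2).
Local Notation m := (leb_on oOm).
Local Notation X := (Linfty oOm).
Let A1 : M -> M := iso_tensor mu1 ka1.
Let A2 : M -> M := iso_tensor mu2 ka2.
Let rho tau := rho1 + (rho2 - rho1) * tau.
Let Wplus tau (xi : M) : \bar R := (ddot (mix_tensor A1 A2 tau xi) xi)%:E.
Let Fplus (th : X) := min_rayleigh oOm (VD oOm GD) Wplus rho th.
Let VD' := nonzero_VD oOm GD.

Let num (th : X) (v : field) : R :=
  affine_int (fun x => ddot (A1 (strain v x)) (strain v x))
    (fun x => ddot (A2 (strain v x)) (strain v x) - ddot (A1 (strain v x)) (strain v x)) th.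

Let den (th : X) (v : field) : R :=
  affine_int (fun x => rho1 * edot (v.1 x) (v.1 x))
    (fun x => (rho2 - rho1) * edot (v.1 x) (v.1 x)) th.

Let L1_energy mu ka (v : field) : VD' v ->
  L1 m (fun x => ddot (iso_tensor mu ka (strain v x)) (strain v x)).
Proof.
move=> [[[_ v2 _] _] _]; apply: L2_ddot; last exact: L2_strain.
by apply: L2_lin; [exact: iso_linear|exact: L2_strain].
Qed.

Let L1_gap (v : field) : VD' v -> L1 m (fun x =>
  ddot (A2 (strain v x)) (strain v x) - ddot (A1 (strain v x)) (strain v x)).
Proof. by move=> Vv; apply: L1B; exact: L1_energy. Qed.

Let L1_mass (v : field) : VD' v -> L1 m (fun x => edot (v.1 x) (v.1 x)).
Proof. by move=> [[[v1 _ _] _] _]; exact: L2_edot. Qed.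

Lemma numE (th : X) (v : field) : VD' v ->
  (\int[m]_x Wplus (th x) (strain v x) = (num th v)%:E)%E.
Proof.
move=> Vv; rewrite /num /affine_int -EFin_Rint; last first.
  by apply: L1_affine_int; [exact: Om0|exact: L1_energy|exact: L1_gap].
by apply: eq_integral => x _; rewrite /Wplus ddot_mix_tensor.
Qed.

Lemma denE (th : X) (v : field) :
  \int[m]_x (rho (th x) * edot (v.1 x) (v.1 x)) = den th v.
Proof.
by apply: eq_Rintegral => x _; rewrite /rho; move: (th x) (edot _ _) => t n; lra.
Qed.

Lemma FplusE (th : X) : Fplus th = ereal_inf [set (num th v / den th v)%:E | v in VD'].
Proof.
rewrite /Fplus /min_rayleigh; congr ereal_inf; apply/seteqP; split => _ [v Vv <-];
  by exists v => //; rewrite /rayleigh numE// denE EFinM.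
Qed.

Section band.
Variable eps : R.
Hypotheses (emu : 0 < mu1 - eps * (mu2 - mu1)) (eka : 0 < ka1 - eps * (ka2 - ka1))
  (erho : 0 < rho1 - eps * (rho2 - rho1)).

Let gap0 (v : field) x :
  0 <= ddot (A2 (strain v x)) (strain v x) - ddot (A1 (strain v x)) (strain v x).
Proof. exact: iso_mono. Qed.

Let mass0 (v : field) x : 0 <= (rho2 - rho1) * edot (v.1 x) (v.1 x).
Proof. by rewrite mulr_ge0 ?edot_ge0// subr_ge0. Qed.

Lemma den_band_gt0 th v : ess_band oOm eps th -> VD' v -> 0 < den th v.
Proof.
move=> bth Vv; have l := L1_mass Vv.
pose c x := (rho1 - eps * (rho2 - rho1)) * edot (v.1 x) (v.1 x).
have lc : L1 m c by exact: L1Z.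
apply: (@lt_le_trans _ _ (\int[m]_x c x)).
  rewrite /c RintZ// mulr_gt0//; apply: Rint_gt0 => // [x|h]; first exact: edot_ge0.
  have [_] := Vv; apply; apply: filterS h => x; exact: edot_eq0.
apply: (@affine_int_ge _ _ _ oOm Om0 _ _ _ eps) => //; [exact: L1Z|exact: L1Z|].
by move=> x; rewrite /c; move: (edot _ _) => n; lra.
Qed.

Lemma num_band_ge0 th v : ess_band oOm eps th -> VD' v -> 0 <= num th v.
Proof.
move=> bth Vv; have l0 : L1 m (fun=> 0) by exact: L1_0.
rewrite -(Rint0 m); apply: (@affine_int_ge _ _ _ oOm Om0 _ _ _ eps) => //.
- exact: L1_energy.
- exact: L1_gap.
- move=> x; have := @iso_gap _ _ N0 mu1 mu2 ka1 ka2 eps 0 (strain v x).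
  by rewrite !mul0r; apply; exact: ltW.
Qed.

Lemma objective_quotient th : ess_band oOm eps th ->
  [/\ Fplus th \is a fin_num,
      forall v, VD' v -> fine (Fplus th) * den th v <= num th v &
      forall e, 0 < e -> exists2 v, VD' v & num th v < (fine (Fplus th) + e) * den th v].
Proof.
move=> bth; rewrite FplusE; apply: ereal_inf_quotient.
- exact: (nonzero_VD_nonempty oOm OmL GD N0 Ox0).
- by move=> v; exact: num_band_ge0.
- by move=> v; exact: den_band_gt0.
Qed.

(** Common constant: [K = k^-1], where [k] bounds from below the ratio of
    each modulus of the extrapolated material to the corresponding contrast. *)
Lemma objective_fractional_inf : exists K, fractional_inf Linfty_norm (ess_band oOm eps)
  VD' num den (fun th => fine (Fplus th)) K.
Proof.
have [k k0 [kmu kka krho]] : exists2 k, 0 < k & [/\ k * (mu2 - mu1) <= mu1 - eps * (mu2 - mu1),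
    k * (ka2 - ka1) <= ka1 - eps * (ka2 - ka1) &
    k * (rho2 - rho1) <= rho1 - eps * (rho2 - rho1)].
  by apply: exists_common_slope; rewrite ?subr_ge0.
exists k^-1; split.
- exact: Linfty_normD.
- exact: Linfty_normZ.
- exact: ess_band_open.
- exact: ess_band_convex.
- by rewrite invr_gt0.
- move=> v x y t Vv; apply: affine_int_affine => //; [exact: L1_energy|exact: L1_gap].
- move=> v x y t Vv; apply: affine_int_affine => //; apply: L1Z; exact: L1_mass.
- by move=> th v; exact: num_band_ge0.
- by move=> th v; exact: den_band_gt0.
- move=> x y v bx _ Vv; apply: (@affine_int_lip _ _ _ oOm Om0 _ _ eps k) => //.
  + exact: L1_energy.
  + exact: L1_gap.
  + by move=> z; exact: iso_gap.
- move=> x y v bx _ Vv; apply: (@affine_int_lip _ _ _ oOm Om0 _ _ eps k) => //.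
  + by apply: L1Z; exact: L1_mass.
  + by apply: L1Z; exact: L1_mass.
  + move=> z; have := ler_wpM2r (edot_ge0 (v.1 z)) krho.
    by move: (edot _ _) => n; lra.
- by move=> th v bth; have [_ h _] := objective_quotient bth; exact: h.
- by move=> th e bth; have [_ _ h] := objective_quotient bth; exact: h.
Qed.

End band.

(** Outside [0 <= tau <= 1] the G-closure is empty and the supremum is
    [-oo]; otherwise [voigt_bound] applies, with ellipticity constants
    common to the two materials. *)
Lemma HS_le_voigt tau (xi : M) : xi^T = xi ->
  (HS_upper_bound oOm A1 A2 tau xi <= Wplus tau xi)%E.
Proof.
move=> sxi; apply: ge_ereal_sup => _ [Ast GA <-]; rewrite lee_fin.
pose al := Num.min (2 * mu1) (N%:R * ka1); pose be := Num.max (2 * mu2) (N%:R * ka2).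
have N0R : 0 < N%:R :> R by rewrite ltr0n.
have al0 : 0 < al by rewrite lt_min !mulr_gt0.
have a1 : al <= 2 * mu1 by rewrite ge_min lexx.
have a2 : al <= N%:R * ka1 by rewrite ge_min lexx orbT.
have b1 : 2 * mu2 <= be by rewrite le_max lexx.
have b2 : N%:R * ka2 <= be by rewrite le_max lexx orbT.
have m12 : 2 * mu1 <= 2 * mu2 by rewrite ler_pM2l.
have k12 : N%:R * ka1 <= N%:R * ka2 by rewrite ler_pM2l.
have be0 : 0 < be by apply: lt_le_trans b1; apply: lt_le_trans m12; rewrite mulr_gt0.
apply: (voigt_bound OmL Ox0 al0 be0 _ _ GA sxi); apply: iso_elasticity => //.
- exact: le_trans b1.
- exact: le_trans b2.
- exact: le_trans m12.
- exact: le_trans k12.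
Qed.

(** The quotients compare for each field, as strains are symmetric and the
    denominators are the same. *)
Lemma Fstar_le_Fplus gamma th : admissible oOm gamma th ->
  (min_rayleigh oOm (VD oOm GD) (HS_upper_bound oOm A1 A2) rho th <= Fplus th)%E.
Proof.
move=> [ath _]; apply: le_ereal_inf_tmp => _ [v Vv <-].
apply: (@le_trans _ _ (rayleigh oOm (HS_upper_bound oOm A1 A2) rho th v)).
  by apply: ereal_inf_lbound; exists v.
apply: lee_wpmul2r.
  rewrite lee_fin invr_ge0; apply: Rint_ge0_ae.
    have l := L1_mass Vv; rewrite (_ : (fun x => _) = fun x => rho1 * edot (v.1 x) (v.1 x) +
        th x * ((rho2 - rho1) * edot (v.1 x) (v.1 x))).
      by apply: L1_measurable; apply: L1_affine_int => //; exact: L1Z l.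
    by apply/funext => x; rewrite /rho; move: (th x) (edot _ _) => t n; lra.
  apply: filterS ath => x /andP[t0 t1]; rewrite mulr_ge0 ?edot_ge0// addr_ge0 ?mulr_ge0 ?subr_ge0//.
  exact: ltW.
by apply: le_integral_any => x; apply: HS_le_voigt; exact: sym_partT.
Qed.

End objective.

(** * Pseudo-concavity and comparison of optimal values *)

Lemma bounded_cube {R : realType} {N : nat} (Om : set 'rV[R]_N) : bounded_set Om ->
  exists L, Om `<=` cube L.
Proof.
move=> [M [_ hM]]; exists (M + 1) => x Ox i.
have := hM (M + 1) (ltac:(by rewrite ltrDl)) x Ox; apply: le_trans.
rewrite [leRHS]/Num.Def.normr/= mx_normrE.
exact: (le_bigmax _ (fun ij : 'I_1 * 'I_N => `|x ij.1 ij.2|) (0, i)).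
Qed.

Theorem theorem8 (R : realType) (N : nat) (Om GD GN : set 'rV[R]_N)
    (oOm : open Om) (gamma mu1 mu2 ka1 ka2 rho1 rho2 : R) :
  (0 < N)%N ->
  bounded_set Om ->
  lipschitz_boundary Om ->
  GD `|` GN = boundary Om ->
  GD `&` GN = set0 ->
  (0 < hausdorff N.-1 GD)%E ->
  0 < gamma -> (gamma%:E < lebesgue_rV N Om)%E ->
  0 < mu1 <= mu2 -> 0 < ka1 <= ka2 -> 0 < rho1 < rho2 ->
  let A1 : 'M[R]_N -> 'M[R]_N := iso_tensor mu1 ka1 in
  let A2 : 'M[R]_N -> 'M[R]_N := iso_tensor mu2 ka2 in
  let rho := fun tau : R => rho1 + (rho2 - rho1) * tau in
  let ad := admissible oOm gamma in
  let Fplus := fun theta : Linfty oOm =>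
    min_rayleigh oOm (VD oOm GD)
      (fun tau xi => (ddot (mix_tensor A1 A2 tau xi) xi)%:E) rho theta in
  let Fstar := fun theta : Linfty oOm =>
    min_rayleigh oOm (VD oOm GD) (HS_upper_bound oOm A1 A2) rho theta in
  let f := fun theta : Linfty oOm => fine (Fplus theta) in
  [/\ pseudo_concave_in Linfty_norm ad Fplus,
      (forall eps : R, 0 < eps ->
        0 < mu1 - eps * (mu2 - mu1) ->
        0 < ka1 - eps * (ka2 - ka1) ->
        0 < rho1 - eps * (rho2 - rho1) ->
        [/\ ad `<=` ess_band oOm eps,
            (forall theta, ess_band oOm eps theta -> Fplus theta \is a fin_num) &
            pseudo_concave_on Linfty_norm (ess_band oOm eps) f]),
      (forall theta, clarke_stationary Linfty_norm ad f theta ->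
        forall theta', ad theta' -> (Fplus theta' <= Fplus theta)%E) &
      (ereal_sup [set Fstar theta | theta in ad] <=
       ereal_sup [set Fplus theta | theta in ad])%E].

Proof.
move=> N0 bOm _ _ _ _ gamma0 gammaOm /andP[mu0 mu12] /andP[ka0 ka12] /andP[rho0 rho12].
move=> A1 A2 rho ad Fplus Fstar f.
have [L OmL] := bounded_cube bOm.
have Om0 : (0 < leb_on oOm setT)%E.
  by rewrite leb_on_setT; apply: lt_trans gammaOm; rewrite lte_fin.
have [x0 Ox0] : exists x0, Om x0.
  apply: contrapT => nO; move: Om0; rewrite leb_on_setT (_ : Om = set0) ?measure0 ?ltxx//.
  by apply/seteqP; split => // x Ox; apply: nO; exists x.
have rho12' := ltW rho12.
have frac eps := objective_fractional_inf OmL N0 Om0 Ox0 GD mu12 ka12 rho12' (eps := eps).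
have quot eps := objective_quotient OmL N0 Om0 Ox0 GD mu12 ka12 rho12' (eps := eps).
have pc eps : 0 < eps -> 0 < mu1 - eps * (mu2 - mu1) -> 0 < ka1 - eps * (ka2 - ka1) ->
    0 < rho1 - eps * (rho2 - rho1) ->
    [/\ ad `<=` ess_band oOm eps,
        (forall theta, ess_band oOm eps theta -> Fplus theta \is a fin_num) &
        pseudo_concave_on Linfty_norm (ess_band oOm eps) f].
  move=> eps0 h1 h2 h3; split; first exact: admissible_ess_band.
    by move=> th bth; have [] := quot eps h1 h2 h3 th bth.
  by have [K F] := frac eps h1 h2 h3; exact: (fractional_inf_pseudo_concave F).
have [eps eps0 [h1 h2 h3]] : exists2 eps, 0 < eps & [/\ 0 < mu1 - eps * (mu2 - mu1),
    0 < ka1 - eps * (ka2 - ka1) & 0 < rho1 - eps * (rho2 - rho1)].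
  have [k k0 [kmu kka krho]] : exists2 k, 0 < k &
      [/\ k * (mu2 - mu1) <= mu1, k * (ka2 - ka1) <= ka1 & k * (rho2 - rho1) <= rho1].
    by apply: exists_common_slope; rewrite ?subr_ge0.
  exists (k / 2); first by rewrite divr_gt0.
  have half (a d : R) : 0 < a -> k * d <= a -> 0 < a - k / 2 * d by clear; lra.
  by split; exact: half.
have [adb fin pcf] := pc eps eps0 h1 h2 h3.
have FE th : ad th -> Fplus th = (f th)%:E.
  by move=> /adb /fin h; rewrite /f fineK.
split.
- split; [exact: (admissible_closed OmL Om0)|exact: (admissible_convex OmL Om0)|].
  by exists (ess_band oOm eps), f.
- exact: pc.
- move=> th [ath [g gsub gle]] th' ath'; rewrite (FE _ ath) (FE _ ath') lee_fin leNgt.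
  apply/negP => lt; have [_ _ _ h] := pcf.
  have := h _ _ _ (adb _ ath) (adb _ ath') gsub lt.
  by rewrite ltNge gle.
- apply: ge_ereal_sup => _ [th ath <-]; apply: (@le_trans _ _ (Fplus th)).
    exact: (Fstar_le_Fplus OmL N0 Om0 Ox0 GD mu0 ka0 rho0 mu12 ka12 rho12' ath).
  by apply: ereal_sup_ubound; exists th.
Qed.
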